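(* Let $K \in \mathbb{N}^*$ and $\mu \in H^3((0,1),\mathbb{R})$ be such that $$\langle \mu \varphi_1 , \varphi_K \rangle = 0 \quad \text{and} \quad A_K:=\langle (\mu')^2 \varphi_1 , \varphi_K \rangle \neq 0,$$ and let $\alpha_K:=\mathrm{sign}(A_K) \in \{-1,+1\}$. There exists $T_K^*>0$ such that, for every $T \in (0,T_K^* )$, there exists $\epsilon>0$ such that, for every $u \in L^2((0,T),\mathbb{R})$ with $\|u\|_{L^2(0,T)}<\epsilon$, the solution $\psi$ of $$i\partial_t\psi=-\partial_x^2\psi-u(t)\mu(x)\psi \ \text{ on } (0,T)\times(0,1),\qquad \psi(t,0)=\psi(t,1)=0,\qquad \psi(0,\cdot)=\varphi_1$$ satisfies $$\psi(T)\neq\left[\sqrt{1-\delta^2}\,\varphi_1+i\alpha_K\delta\,\varphi_K\right]e^{-i\lambda_1T}\quad\text{for every } \delta\in(0,1].$$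
   Context: $\mathbb{N}^*=\{1,2,\dots\}$. $\langle f,g\rangle=\int_0^1 f\overline{g}\,dx$. $\lambda_k=(k\pi)^2$ and $\varphi_k(x)=\sqrt2\sin(k\pi x)$ for $k\in\mathbb{N}^*$: these are the eigenvalues and an orthonormal basis of eigenvectors of $A=-\frac{d^2}{dx^2}$ with domain $D(A)=H^2\cap H^1_0((0,1),\mathbb{C})$. For $s>0$, $H^s_{(0)}(0,1)=D(A^{s/2})$ with norm $\|\varphi\|_{H^s_{(0)}}=(\sum_k|k^s\langle\varphi,\varphi_k\rangle|^2)^{1/2}$. Solution means weak (mild) solution: the unique $\psi\in C^0([0,T],H^3_{(0)}(0,1))$ such that $\psi(t)=e^{-iAt}\varphi_1+i\int_0^te^{-iA(t-\tau)}u(\tau)\mu\psi(\tau)\,d\tau$ in $H^3_{(0)}(0,1)$ for all $t\in[0,T]$. *)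

(* Defs.v *)
From mathcomp Require Import all_boot all_order all_algebra.
From mathcomp Require Import all_classical all_reals all_analysis.
From mathcomp Require Export complex.

Set Implicit Arguments.
Unset Strict Implicit.
Unset Printing Implicit Defensive.

Import Order.TTheory GRing.Theory Num.Theory.
Import numFieldNormedType.Exports.

Local Open Scope classical_set_scope.
Local Open Scope ring_scope.
Local Open Scope complex_scope.

(* Elements of the Lebesgue and Sobolev spaces are represented by functions
   defined on the whole of [R]; only their values almost everywhere on the
   relevant open interval matter. *)

Section FunctionSpaces.
Context {R : realType}.
Local Notation mu := (@lebesgue_measure R).

Definition L2norm (a b : R) (f : R -> R[i]) : \bar R :=
  'N[mu]_(2%:E)[EFin \o ((fun x => Normc.normc (f x)) \_ `]a, b[)].

Definition L2dist (a b : R) (f g : R -> R[i]) : \bar R :=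
  L2norm a b (fun x => f x - g x).

Definition inL2 (a b : R) (f : R -> R[i]) : Prop :=
  [/\ measurable_fun `]a, b[ (fun x => complex.Re (f x)),
      measurable_fun `]a, b[ (fun x => complex.Im (f x)) &
      (L2norm a b f < +oo)%E].

Definition eq_ae01 (f g : R -> R[i]) : Prop :=
  {ae mu, forall x : R, x \in `]0, 1[ -> f x = g x}.

Definition test_function (a b : R) (phi : R -> R) : Prop :=
  (forall n x, derivable (derive1n n phi) x 1) /\
  exists c d, [/\ a < c, d < b & forall x, x \notin `[c, d] -> phi x = 0].

Definition weak_derivative (a b : R) (f g : R -> R) : Prop :=
  [/\ locally_integrable `]a, b[ f, locally_integrable `]a, b[ g &
      forall phi, test_function a b phi ->
        \int[mu]_(x in `]a, b[) (f x * derive1 phi x) =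
        - \int[mu]_(x in `]a, b[) (g x * phi x)].

Fixpoint sobolev (a b : R) (m : nat) (f : R -> R) : Prop :=
  inL2 a b (fun x => (f x)%:C) /\
  if m is m'.+1 then exists2 g, weak_derivative a b f g & sobolev a b m' g
  else True.

Definition inner (f g : R -> R[i]) : R[i] :=
  let h x := f x * (g x)^* in
  (\int[mu]_(x in `]0, 1[) complex.Re (h x)) +i*
  (\int[mu]_(x in `]0, 1[) complex.Im (h x)).

Definition lambda (k : nat) : R := (k%:R * pi) ^+ 2.

Definition phi (k : nat) (x : R) : R[i] :=
  (Num.sqrt 2 * sin (k%:R * pi * x))%:C.

Definition cexpi (theta : R) : R[i] := cos theta +i* sin theta.

(* The norm of D(A^{s/2}), with value +oo outside of this space. *)
Definition Hs0norm (s : R) (f : R -> R[i]) : \bar R :=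
  ((\sum_(1 <= k <oo)
      ((k%:R `^ s * Normc.normc (inner f (phi k))) ^+ 2)%:E) `^ 2^-1)%E.

Definition inHs0 (s : R) (f : R -> R[i]) : Prop :=
  inL2 0 1 f /\ (Hs0norm s f < +oo)%E.

End FunctionSpaces.

Section Evolution.
Context {R : realType}.
Local Notation mu := (@lebesgue_measure R).

(* [schrodinger_group t f g] reads g = e^{-iAt} f in L2(0,1), the operator
   being given by its spectral expansion, convergent in L2(0,1). *)
Definition schrodinger_group (t : R) (f g : R -> R[i]) : Prop :=
  [/\ inL2 0 1 f, inL2 0 1 g &
      L2dist 0 1 g (fun x => \sum_(1 <= k < n.+1)
        cexpi (- (lambda k * t)) * inner f (phi k) * phi k x)
      @[n --> \oo] --> 0%E].

(* The L2(0,1)-valued simple function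
   tau |-> \sum_(j < simple_size) 1_(simple_dom j)(tau) simple_val j. *)
Record L2simple := {
  simple_size : nat;
  simple_dom : 'I_simple_size -> set R;
  simple_val : 'I_simple_size -> R -> R[i];
  simple_dom_measurable : forall j, measurable (simple_dom j);
  simple_val_inL2 : forall j, inL2 0 1 (simple_val j) }.

Definition simple_eval (S : L2simple) (tau x : R) : R[i] :=
  \sum_(j < simple_size S) (\1_(simple_dom j) tau)%:C * simple_val j x.

Definition simple_integral (a b : R) (S : L2simple) (x : R) : R[i] :=
  \sum_(j < simple_size S)
    (fine (mu (@simple_dom S j `&` `]a, b[)))%:C * simple_val j x.

(* [G] is the Bochner integral over (a,b) of the L2(0,1)-valued function
   tau |-> F tau. *)
Definition bochner_integral (a b : R) (F : R -> R -> R[i]) (G : R -> R[i])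
    : Prop :=
  [/\ forall tau, tau \in `]a, b[ -> inL2 0 1 (F tau),
      inL2 0 1 G &
      exists S : nat -> L2simple,
      [/\ forall n, mu.-integrable `]a, b[
            (fun tau : R => L2dist 0 1 (F tau) (simple_eval (S n) tau)),
          (\int[mu]_(tau in `]a, b[)
             L2dist 0 1 (F tau) (simple_eval (S n) tau))%E
            @[n --> \oo] --> 0%E &
          L2dist 0 1 G (simple_integral a b (S n)) @[n --> \oo] --> 0%E]].

(* Mild solutions in C^0([0,T], H^3_(0)(0,1)) of
   i psi_t = - psi_xx - u(t) m(x) psi with psi(0) = psi0. The integrand of the
   Duhamel term is in general not H^3_(0)-valued (the second derivative of
   m psi need not vanish at 0 and 1), so that the integral is taken in
   L2(0,1). *)
Definition mild_solution (T : R) (m u : R -> R) (psi0 : R -> R[i])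
    (psi : R -> R -> R[i]) : Prop :=
  [/\ forall t, t \in `[0, T] -> inHs0 3 (psi t),
      forall t, t \in `[0, T] ->
        Hs0norm 3 (fun x => psi s x - psi t x)
          @[s --> within `[0, T] (nbhs t)] --> 0%E &
      forall t, t \in `[0, T] ->
        exists (g : R -> R[i]) (F : R -> R -> R[i]) (G : R -> R[i]),
        [/\ schrodinger_group t psi0 g,
            forall tau, tau \in `]0, t[ ->
              schrodinger_group (t - tau)
                (fun x => (u tau * m x)%:C * psi tau x) (F tau),
            bochner_integral 0 t F G &
            eq_ae01 (psi t) (fun x => g x + 'i * G x)]].

(* [dm] stands for the derivative of the function m. *)
Definition A_coef (dm : R -> R) (K : nat) : R[i] :=
  inner (fun x => (dm x ^+ 2)%:C * phi 1 x) (phi K).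

Definition target (alpha : R[i]) (K : nat) (T delta : R) (x : R) : R[i] :=
  ((Num.sqrt (1 - delta ^+ 2))%:C * phi 1 x + 'i * alpha * delta%:C * phi K x)
  * cexpi (- (lambda 1 * T)).

End Evolution.

(* Main.v *)
(** Let s be the primitive of u vanishing at 0 and let a C^2 representative of mu
    be given by the lemma of du Bois-Reymond. Pair the solution psi with
    exp(i th) phi_k, th = s(t) mu(x) - lambda_k t + beta. This gauge removes u
    from the equation: the real part X_k of the pairing satisfies
      X_k(t) - X_k(0) = int_0^t (s l_k(psi) + s^2 q_k(psi)),
    where l_k is a pairing with 2 mu' phi_k' + mu'' phi_k, and q_k one with
    mu'^2 phi_k. Since the pairing of 2 mu' phi_k' + mu'' phi_k with phi_1 is
    (lambda_k - lambda_1) <mu phi_1, phi_k>, which vanishes for k = 1 and k = K,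
    the linear term is small as soon as psi is close to exp(i th) phi_1. For
    k = 1 and by conservation of mass, psi - exp(i th) phi_1 is O(sigma),
    sigma = ||s||_{L2}. For k = K and beta = (lambda_K - lambda_1) T + pi/2, a
    final state of the forbidden form gives, for T and sigma small,
      delta / 4 + |A_K| sigma^2 / 4 <= 0,
    because X_K(0) = 0, alpha_K X_K(T) is about delta, and the quadratic term is
    about - A_K int_0^T s^2 cos((lambda_K - lambda_1)(T - t)) dt. *)
Require Import Defs.
From mathcomp Require Import all_boot all_order all_algebra.
From mathcomp Require Import all_classical all_reals all_analysis.
From mathcomp Require Import measurable_realfun ring lra zify.

Import Order.TTheory GRing.Theory Num.Theory.
Import numFieldNormedType.Exports.

Local Open Scope classical_set_scope.
Local Open Scope ring_scope.

Set Implicit Arguments.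
Unset Strict Implicit.

(** * Integrals and derivatives on the real line *)
Section Calculus.
Context {R : realType}.
Local Notation mu := (@lebesgue_measure R).
Implicit Types (f g h : R -> R) (a b : R) (D : set R).

(** The quadratic term controls only [||s||_{L2}], a weaker norm than that of [u], so every error
    has to be small compared with [sigma^2]. The gauge trades [u] for [s], at the price of a final
    phase [s(T) mu] that [sigma] alone does not bound. The forbidden final state supplies the
    missing bound: comparing it with [exp(i s(T) mu) phi_1] along [mu phi_1] gives
    [|s(T)| = O(sigma)]. In [X_K(T)] the phase then costs a cubic term, its linear part being killed
    by [<mu phi_1, phi_K> = 0], and a small multiple of [delta]. Short times serve twice: the cosine
    in the quadratic term stays above 1/2, and the linear term is at most
    [O(sigma) ||s||_{L1} = O(sqrt(T) sigma^2)]. Since [u] is only square integrable and [psi] only a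
    mild solution, no identity can be differentiated in time classically. The sine coefficients of
    [psi] are primitives of functions dominated by [1 + |u|]; identities are proved for partial
    sums, and the decay of the coefficients, due to the bound in [H^3_(0)], makes the truncation
    errors [O(1/n)]. *)

Definition intg D f := mu.-integrable D (EFin \o f).

Lemma ctsD f g : continuous f -> continuous g -> continuous (fun x => f x + g x).
Proof. by move=> cf cg x; apply: continuousD; [exact: cf|exact: cg]. Qed.

Lemma ctsN f : continuous f -> continuous (fun x => - f x).
Proof. by move=> cf x; apply: continuousN; exact: cf. Qed.

Lemma ctsM f g : continuous f -> continuous g -> continuous (fun x => f x * g x).
Proof. by move=> cf cg x; apply: continuousM; [exact: cf|exact: cg]. Qed.

Lemma cts_comp (f g : R -> R) : continuous f -> continuous g -> continuous (fun x => g (f x)).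
Proof. by move=> cf cg x; apply: continuous_comp; [exact: cf|exact: cg]. Qed.

Lemma cts_norm f : continuous f -> continuous (fun x => `|f x|).
Proof. by move=> cf x; apply: continuous_comp; [exact: cf|exact: norm_continuous]. Qed.

Lemma cts_cst (c : R) : continuous (fun _ : R => c).
Proof. by move=> x; exact: cst_continuous. Qed.

Lemma cts_id : continuous (fun x : R => x).
Proof. by move=> x. Qed.

Lemma ctsX f n : continuous f -> continuous (fun x => f x ^+ n).
Proof.
move=> cf; elim: n => [|n IH]; first exact: cts_cst.
have -> : (fun x => f x ^+ n.+1) = (fun x => f x * f x ^+ n).
  by apply/funext => x; rewrite exprS.
exact: ctsM.
Qed.

Lemma cts_sum (n : nat) (F : nat -> R -> R) : (forall j, continuous (F j)) ->
  continuous (fun x => \sum_(j < n) F j x).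
Proof.
move=> cF; elim: n => [|n IH].
  have -> : (fun x => \sum_(j < 0) F j x) = (fun=> 0); last exact: cts_cst.
  by apply/funext => x; rewrite big_ord0.
have -> : (fun x => \sum_(j < n.+1) F j x) = (fun x => \sum_(j < n) F j x + F n x).
  by apply/funext => x; rewrite big_ord_recr.
exact: ctsD.
Qed.

Lemma intg_cts f a b : continuous f -> intg `[a, b] f.
Proof.
move=> cf; apply: continuous_compact_integrable; first exact: segment_compact.
exact: continuous_subspaceT.
Qed.

Lemma intgS D D' f : measurable D -> measurable D' -> D `<=` D' -> intg D' f -> intg D f.
Proof. by move=> mD mD' DD'; exact: integrableS. Qed.

Lemma intg_oo f a b : continuous f -> intg `]a, b[ f.
Proof.
move=> cf; apply: (@intgS _ `[a, b]) => //; last exact: intg_cts.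
exact: subset_itv_oo_cc.
Qed.

Lemma intg_eq D f g : (forall x, D x -> f x = g x) -> intg D f -> intg D g.
Proof.
move=> fg; rewrite /intg => /integrableP[mf If]; apply/integrableP; split.
  apply: eq_measurable_fun mf => x; rewrite inE => Dx /=; by rewrite fg.
rewrite (_ : (\int[mu]_(x in D) _)%E = (\int[mu]_(x in D) `|(EFin \o f) x|)%E)//.
by apply: eq_integral => x; rewrite inE => Dx /=; rewrite fg.
Qed.

Lemma intg_meas D f : intg D f -> measurable_fun D f.
Proof. by move=> /measurable_int /measurable_EFinP. Qed.

Lemma intg_le D f g : measurable D -> measurable_fun D f -> intg D g ->
  (forall x, D x -> `|f x| <= g x) -> intg D f.
Proof.
move=> mD mf ig fg; apply: (@le_integrable _ _ _ mu _ mD _ (EFin \o g)) => //.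
  exact/measurable_EFinP.
move=> x Dx /=; rewrite lee_fin (le_trans (fg x Dx))// ler_norm//.
Qed.

Lemma intgD D f g : measurable D -> intg D f -> intg D g -> intg D (fun x => f x + g x).
Proof. by move=> mD; exact: integrableD. Qed.

Lemma intgZ D (k : R) f : measurable D -> intg D f -> intg D (fun x => k * f x).
Proof. by move=> mD; exact: integrableZl. Qed.

Lemma intgN D f : measurable D -> intg D f -> intg D (fun x => - f x).
Proof. by move=> mD; exact: integrableN. Qed.

Lemma intgB D f g : measurable D -> intg D f -> intg D g -> intg D (fun x => f x - g x).
Proof. by move=> mD If Ig; apply: intgD => //; exact: intgN. Qed.

Lemma intg_norm D f : measurable D -> intg D f -> intg D (fun x => `|f x|).
Proof. by move=> mD /(integrable_norm). Qed.

Lemma intg_cst D (c : R) : measurable D -> (mu D < +oo)%E -> intg D (fun=> c).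
Proof.
move=> mD Df; apply/integrableP; split; first exact: measurable_cst.
under eq_integral do rewrite /=.
rewrite integral_cst//=; exact: lte_mul_pinfty.
Qed.

Lemma intg_bnd D f (C : R) : measurable D -> (mu D < +oo)%E -> measurable_fun D f ->
  (forall x, D x -> `|f x| <= C) -> intg D f.
Proof. by move=> mD Df mf fC; apply: (@intg_le _ _ (fun=> C)) => //; exact: intg_cst. Qed.

Lemma RintN D f : measurable D -> intg D f ->
  \int[mu]_(x in D) (- f x) = - \int[mu]_(x in D) f x.
Proof.
move=> mD If; rewrite -mulN1r -RintegralZl//.
by apply: eq_Rintegral => x _; rewrite mulN1r.
Qed.

Lemma RintD D f g : measurable D -> intg D f -> intg D g ->
  \int[mu]_(x in D) (f x + g x) = \int[mu]_(x in D) f x + \int[mu]_(x in D) g x.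
Proof. by move=> mD If Ig; rewrite RintegralD. Qed.

Lemma RintB D f g : measurable D -> intg D f -> intg D g ->
  \int[mu]_(x in D) (f x - g x) = \int[mu]_(x in D) f x - \int[mu]_(x in D) g x.
Proof. by move=> mD If Ig; rewrite RintegralB. Qed.

Lemma RintZ D (k : R) f : measurable D -> intg D f ->
  \int[mu]_(x in D) (k * f x) = k * \int[mu]_(x in D) f x.
Proof. by move=> mD If; rewrite RintegralZl. Qed.

Lemma Rint_sum D (n : nat) (F : nat -> R -> R) : measurable D ->
  (forall j, intg D (F j)) ->
  intg D (fun x => \sum_(j < n) F j x) /\
  \int[mu]_(x in D) (\sum_(j < n) F j x) = \sum_(j < n) \int[mu]_(x in D) F j x.
Proof.
move=> mD IF; elim: n => [|n [IH1 IH2]].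
  rewrite big_ord0; split.
    apply: (@intg_eq _ (fun=> 0)); last exact: integrable0.
    by move=> x _; rewrite big_ord0.
  rewrite (_ : \int[mu]_(x in D) _ = \int[mu]_(x in D) (0 : R)).
    by rewrite Rintegral_cst// mul0r.
  by apply: eq_Rintegral => x _; rewrite big_ord0.
split.
  apply: (@intg_eq _ (fun x => \sum_(j < n) F j x + F n x)); last exact: intgD.
  by move=> x _; rewrite big_ord_recr.
rewrite big_ord_recr /= -IH2 -RintegralD//; last exact: IF.
by apply: eq_Rintegral => x _; rewrite big_ord_recr.
Qed.

Lemma Rint_eq D f g : (forall x, D x -> f x = g x) ->
  \int[mu]_(x in D) f x = \int[mu]_(x in D) g x.
Proof. by move=> fg; apply: eq_Rintegral => x; rewrite inE; exact: fg. Qed.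

Lemma Rint_bnd D f g : measurable D -> intg D f -> intg D g ->
  (forall x, D x -> `|f x| <= g x) ->
  `|\int[mu]_(x in D) f x| <= \int[mu]_(x in D) g x.
Proof.
move=> mD If Ig fg; apply: (le_trans (le_normr_Rintegral _ _)) => //.
by apply: le_Rintegral => //; exact: intg_norm.
Qed.

Lemma mu_cc a b : a <= b -> fine (mu `[a, b]) = b - a.
Proof.
move=> ab; rewrite lebesgue_measure_itv/= lte_fin; case: ltP => //=.
by move=> ba; rewrite (@le_anti _ _ a b) ?ab// subrr.
Qed.

Lemma mu_cc_fin a b : (mu `[a, b] < +oo)%E.
Proof. by rewrite lebesgue_measure_itv/=; case: ifP => //= _; rewrite -EFinB ltry. Qed.

Lemma mu_oo a b : a <= b -> fine (mu `]a, b[) = b - a.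
Proof.
move=> ab; rewrite lebesgue_measure_itv/= lte_fin; case: ltP => //=.
by move=> ba; rewrite (@le_anti _ _ a b) ?ab// subrr.
Qed.

Lemma mu_oo_fin a b : (mu `]a, b[ < +oo)%E.
Proof. by rewrite lebesgue_measure_itv/=; case: ifP => //= _; rewrite -EFinB ltry. Qed.

Lemma Rint_split f a b c : a <= b -> b <= c -> intg `[a, c] f ->
  \int[mu]_(x in `[a, c]) f x =
  \int[mu]_(x in `[a, b]) f x + \int[mu]_(x in `[b, c]) f x.
Proof.
move=> ab bc If.
have := @Rintegral_itvB R f (BLeft a) (BRight c) b If.
rewrite !bnd_simp => /(_ ab bc) E; rewrite -[LHS](subrK (\int[mu]_(x in `[a, b]) f x)).
rewrite E addrC Rintegral_itv_obnd_cbnd//.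
apply: intgS If => //; apply: subset_itvr; by rewrite bnd_simp.
Qed.

Lemma Rint_cc_oo f a b : intg `[a, b] f ->
  \int[mu]_(x in `]a, b[) f x = \int[mu]_(x in `[a, b]) f x.
Proof.
move=> If; rewrite Rintegral_itv_bndo_bndc ?Rintegral_itv_obnd_cbnd//.
  by apply: intgS If => //; apply: subset_itvr; rewrite bnd_simp.
by apply: intgS If => //; exact: subset_itv_oo_cc.
Qed.

Lemma meas_cts f D : measurable D -> continuous f -> measurable_fun D f.
Proof.
move=> mD cf; apply: (@measurable_funS _ _ _ _ setT) => //.
exact: continuous_measurable_fun.
Qed.

Definition has_deriv f g := forall x, is_derive x (1 : R) f (g x).

Lemma hder_eq f g g' : (forall x, g x = g' x) -> has_deriv f g -> has_deriv f g'.
Proof. by move=> /funext ->. Qed.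

Lemma hderD f f' g g' : has_deriv f f' -> has_deriv g g' ->
  has_deriv (fun x => f x + g x) (fun x => f' x + g' x).
Proof. by move=> df dg x; have := df x; have := dg x => ? ?; exact: is_deriveD. Qed.

Lemma hderN f f' : has_deriv f f' -> has_deriv (fun x => - f x) (fun x => - f' x).
Proof. by move=> df x; have := df x => ?; exact: is_deriveN. Qed.

Lemma hderM f f' g g' : has_deriv f f' -> has_deriv g g' ->
  has_deriv (fun x => f x * g x) (fun x => f' x * g x + f x * g' x).
Proof.
move=> df dg x; have := df x; have := dg x => ? ?.
by apply: (is_derive_eq (is_deriveM _ _)); rewrite /GRing.scale/= addrC [g x * _]mulrC.
Qed.

Lemma hder_cst (c : R) : has_deriv (fun=> c) (fun=> 0).
Proof. by move=> x; exact: is_derive_cst. Qed.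

Lemma hder_id : has_deriv (fun x => x) (fun=> 1).
Proof. by move=> x; exact: is_derive_id. Qed.

Lemma hderZ (k : R) f f' : has_deriv f f' -> has_deriv (fun x => k * f x) (fun x => k * f' x).
Proof.
move=> df; apply: (hder_eq _ (hderM (hder_cst k) df)) => x.
by rewrite mul0r add0r.
Qed.

Lemma hderB f f' g g' : has_deriv f f' -> has_deriv g g' ->
  has_deriv (fun x => f x - g x) (fun x => f' x - g' x).
Proof. by move=> df dg; apply: hderD => //; exact: hderN. Qed.

Lemma hder_comp f f' g g' : has_deriv f f' -> has_deriv g g' ->
  has_deriv (fun x => f (g x)) (fun x => f' (g x) * g' x).
Proof. by move=> df dg x; apply: is_derive1_comp; [exact: df|exact: dg]. Qed.

Lemma hder_sin : has_deriv sin cos.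
Proof. by move=> x; exact: is_derive_sin. Qed.

Lemma hder_cos : has_deriv cos (fun x => - sin x).
Proof. by move=> x; exact: is_derive_cos. Qed.

Lemma hder_cts f f' : has_deriv f f' -> continuous f.
Proof.
move=> df x; apply: differentiable_continuous; apply/derivable1_diffP.
by have [] := df x.
Qed.

Lemma cts_sin : continuous (@sin R).
Proof. exact: hder_cts hder_sin. Qed.

Lemma cts_cos : continuous (@cos R).
Proof. exact: hder_cts hder_cos. Qed.

Lemma hder_derive1 f f' x : has_deriv f f' -> derivable f x 1 /\ derive1 f x = f' x.
Proof. by move=> /(_ x) [d e]; rewrite derive1E e. Qed.

Lemma ftc F f a b : a <= b -> has_deriv F f -> continuous f ->
  \int[mu]_(x in `[a, b]) f x = F b - F a.
Proof.
rewrite le_eqVlt => /predU1P[<- _ _|ab dF cf].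
  by rewrite set_itv1 Rintegral_set1 subrr.
rewrite /Rintegral (@continuous_FTC2 _ f F)//.
- exact: continuous_subspaceT.
- split.
  + by move=> x _; have [] := dF x.
  + by apply: cvg_at_right_filter; apply: (hder_cts dF).
  + by apply: cvg_at_left_filter; apply: (hder_cts dF).
- by move=> x _; have [] := hder_derive1 x dF.
Qed.

Lemma mvt_bnd f f' (C : R) a b : has_deriv f f' -> (forall x, `|f' x| <= C) ->
  `|f b - f a| <= C * `|b - a|.
Proof.
move=> df f'C; wlog ab : a b / a < b => [H|].
  have [ab|ba|->] := ltgtP a b; first exact: H.
  - by rewrite distrC (distrC b a); exact: H.
  - by rewrite !subrr normr0 mulr0.
have [||c _ ->] := @MVT R f f' a b ab.
- by move=> x _; exact: df.
- by apply: continuous_subspaceT; exact: hder_cts df.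
- by rewrite normrM ler_wpM2r.
Qed.

Lemma ler_abs_Rint f (C : R) a b : a <= b -> intg `[a, b] f ->
  (forall x, a <= x <= b -> `|f x| <= C) ->
  `|\int[mu]_(x in `[a, b]) f x| <= C * (b - a).
Proof.
move=> ab If fC.
apply: (le_trans (@Rint_bnd _ _ (fun=> C) _ _ _ _)) => //.
  by apply: intg_cst => //; exact: mu_cc_fin.
by rewrite Rintegral_cst// mu_cc.
Qed.

Lemma antideriv f : continuous f -> exists F, has_deriv F f.
Proof.
move=> cf.
(* At least one of the two integrals is over an empty interval or a point, so [F] is the oriented
   integral from 0. *)
pose F x := \int[mu]_(t in `[0, x]) f t - \int[mu]_(t in `[x, 0]) f t.
exists F => x.
(* A base point to the left of both [x] and 0 turns [F] near [x] into a single integral with moving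
   upper end, up to a constant. *)
pose c := Num.min x 0 - 1.
have cx : c < x by rewrite /c ltrBlDr (@le_lt_trans _ _ x)// ?ltrDl// ge_min lexx.
have c0 : c < 0 by rewrite /c ltrBlDr (@le_lt_trans _ _ 0)// ?add0r// ge_min lexx orbT.
have FE y : c < y -> F y = \int[mu]_(t in `[c, y]) f t - \int[mu]_(t in `[c, 0]) f t.
  move=> cy; rewrite /F; have [y0|y0] := leP 0 y.
    rewrite (@Rint_split f c 0 y) ?(ltW c0)//; last exact: intg_cts.
    have -> : \int[mu]_(t in `[y, 0]) f t = 0.
      move: y0; rewrite le_eqVlt => /predU1P[<-|y0]; first by rewrite set_itv1 Rintegral_set1.
      by rewrite set_itv_ge ?Rintegral_set0// bnd_simp -ltNge.
    by rewrite subr0 addrAC subrr add0r.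
  rewrite (@Rint_split f c y 0) ?(ltW cy) ?(ltW y0)//; last exact: intg_cts.
  rewrite set_itv_ge ?Rintegral_set0; last by rewrite bnd_simp -ltNge.
  by rewrite opprD addrA subrr.
have x1 : x < x + 1 by rewrite ltrDl.
have [dG eG] := @continuous_FTC1_closed R f c x (x + 1) x1 (intg_cts _ _ cf) cx (cf x).
have dH : is_derive x (1 : R) (fun y => \int[mu]_(t in `[c, y]) f t - \int[mu]_(t in `[c, 0]) f t) (f x).
  rewrite -[f x]subr0; apply: is_deriveB.
  by apply: DeriveDef; [exact: dG|rewrite -derive1E; exact: eG].
apply: near_eq_is_derive dH.
near=> y; rewrite FE//; near: y; exact: lt_nbhsr.
Unshelve. all: by end_near. Qed.
End Calculus.

(* [continuous f] is a notation for a product, which [intro]-based tactics would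
   open; the constant [cont] keeps the goal folded. *)
Definition cont {R : realType} (f : R -> R) : Prop := continuous f.

Create HintDb cts discriminated.

Ltac cts_leaf :=
  match goal with
  | H : forall x, continuous_at x ?h |- cont ?h => exact H
  | H : forall y : _, forall x, continuous_at x (?h y) |- cont (?h _) => exact (H _)
  | |- cont _ => solve [simple apply cts_sin | simple apply cts_cos | auto 2 with cts nocore]
  end.

Ltac cts1 :=
  lazymatch goal with
  | |- cont (fun _ => ?c) => exact (@cts_cst _ c)
  | |- cont (fun x => x) => exact (@cts_id _)
  | |- cont (fun x => @?f x + @?g x) => refine (@ctsD _ f g _ _)
  | |- cont (fun x => - @?f x) => refine (@ctsN _ f _)
  | |- cont (fun x => @?f x * @?g x) => refine (@ctsM _ f g _ _)
  | |- cont (fun x => @?f x ^+ ?n) => refine (@ctsX _ f n _)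
  | |- cont (fun x => `|@?f x|) => refine (@cts_norm _ f _)
  | |- cont (fun x => ?h x) => change (cont h); cts_leaf
  | |- cont (fun x => sin (@?f x)) => refine (@cts_comp _ f sin _ (@cts_sin _))
  | |- cont (fun x => cos (@?f x)) => refine (@cts_comp _ f cos _ (@cts_cos _))
  | |- cont _ => cts_leaf
  end.
Ltac cts := lazymatch goal with
  | |- forall x, continuous_at x ?f => change (cont f) end;
  repeat (cts1; lazymatch goal with |- forall x, continuous_at x ?f => change (cont f) end).


(** * Square integrable functions *)
Section L2.
Context {R : realType}.
Local Notation mu := (@lebesgue_measure R).
Implicit Types (f g h : R -> R) (a b : R) (D : set R).

Definition L2 D f := measurable_fun D f /\ intg D (fun x => f x ^+ 2).

Lemma meas_sq D f : measurable_fun D f -> measurable_fun D (fun x => f x ^+ 2).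
Proof. by move=> mf; apply: measurable_funX. Qed.

Lemma L2M D f g : measurable D -> L2 D f -> L2 D g -> intg D (fun x => f x * g x).
Proof.
move=> mD [mf f2] [mg g2].
apply: (@intg_le _ _ _ (fun x => f x ^+ 2 + g x ^+ 2)) => //.
- exact: measurable_funM.
- exact: intgD.
- move=> x _; rewrite normrM -(real_normK (num_real (f x))) -(real_normK (num_real (g x))).
  have := normr_ge0 (f x); have := normr_ge0 (g x); nra.
Qed.

Lemma L2_bnd D f C : measurable D -> (mu D < +oo)%E -> measurable_fun D f ->
  (forall x, D x -> `|f x| <= C) -> L2 D f.
Proof.
move=> mD Df mf fC; split=> //; apply: (@intg_bnd _ _ _ (C ^+ 2)) => //; first exact: meas_sq.
move=> x Dx; rewrite normrX; have := fC x Dx; have := normr_ge0 (f x); nra.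
Qed.

Lemma L2_intg D f : measurable D -> (mu D < +oo)%E -> L2 D f -> intg D f.
Proof.
move=> mD Df Lf.
have L1 : L2 D (fun=> 1) by apply: (@L2_bnd _ _ 1) => // x _; rewrite normr1.
by apply: intg_eq (L2M mD Lf L1) => x _; rewrite mulr1.
Qed.

Lemma L2D D f g : measurable D -> L2 D f -> L2 D g -> L2 D (fun x => f x + g x).
Proof.
move=> mD Lf Lg; split; first by apply: measurable_funD; [case: Lf|case: Lg].
apply: (@intg_eq _ _ (fun x => (f x ^+ 2 + 2 * (f x * g x)) + g x ^+ 2)).
  by move=> x _; ring.
apply: intgD => //; last by case: Lg.
apply: intgD => //; first by case: Lf.
by apply: intgZ => //; exact: L2M.
Qed.

Lemma L2Z D k f : measurable D -> L2 D f -> L2 D (fun x => k * f x).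
Proof.
move=> mD Lf; split; first by apply: measurable_funM => //; case: Lf.
apply: (@intg_eq _ _ (fun x => k ^+ 2 * f x ^+ 2)); first by move=> x _; ring.
by apply: intgZ => //; case: Lf.
Qed.

Lemma L2B D f g : measurable D -> L2 D f -> L2 D g -> L2 D (fun x => f x - g x).
Proof.
move=> mD Lf Lg; have := L2D mD Lf (L2Z (-1) mD Lg); congr L2.
by apply/funext => x; rewrite mulN1r.
Qed.

Lemma L2S D D' f : measurable D -> measurable D' -> D `<=` D' -> L2 D' f -> L2 D f.
Proof.
move=> mD mD' DD' [mf f2]; split; first exact: measurable_funS mf.
exact: intgS f2.
Qed.

(** The polynomial [k |-> A - 2 k B + k^2 C], the integral of [(f - k g)^2], is nonnegative: its
    value at [B / C] gives the inequality. If [C = 0] it is affine in [k], which forces [B = 0]. *)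
Lemma CS D f g : measurable D -> L2 D f -> L2 D g ->
  (\int[mu]_(x in D) (f x * g x)) ^+ 2 <=
  \int[mu]_(x in D) (f x ^+ 2) * \int[mu]_(x in D) (g x ^+ 2).
Proof.
move=> mD Lf Lg.
set A := \int[mu]_(x in D) (f x ^+ 2); set B := \int[mu]_(x in D) (f x * g x).
set C := \int[mu]_(x in D) (g x ^+ 2).
have H k : 0 <= A + (- 2 * k) * B + k ^+ 2 * C.
  have fg := L2M mD Lf Lg; case: Lf => mf f2; case: Lg => mg g2.
  rewrite -!RintegralZl// -RintegralD//; last exact: intgZ.
  rewrite -RintegralD//; last exact: intgZ; last first.
    by apply: intgD => //; exact: intgZ.
  rewrite (_ : \int[mu]_(x in D) _ = \int[mu]_(x in D) ((f x - k * g x) ^+ 2)).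
    by apply: Rintegral_ge0 => x _; exact: sqr_ge0.
  by apply: Rint_eq => x _; ring.
have C0 : 0 <= C by apply: Rintegral_ge0 => x _; exact: sqr_ge0.
have A0 : 0 <= A by apply: Rintegral_ge0 => x _; exact: sqr_ge0.
move: C0; rewrite le_eqVlt => /predU1P[C0|C0].
  rewrite -C0 mulr0; have [->|B0] := eqVneq B 0; first by rewrite expr0n.
  have := H ((A + 1) / (2 * B)); rewrite -C0 mulr0 addr0.
  rewrite (_ : A + _ = -1); last by field.
  by rewrite oppr_ge0 leNgt ltr01.
have := H (B / C); rewrite (_ : A + _ + _ = A - B ^+ 2 / C).
  by rewrite subr_ge0 ler_pdivrMr.
by field; rewrite gt_eqF.
Qed.

Definition n2 D f := Num.sqrt (\int[mu]_(x in D) (f x ^+ 2)).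

Lemma n2_ge0 D f : 0 <= n2 D f. Proof. exact: sqrtr_ge0. Qed.

Lemma n2_sq D f : n2 D f ^+ 2 = \int[mu]_(x in D) (f x ^+ 2).
Proof. by rewrite sqr_sqrtr//; apply: Rintegral_ge0 => x _; exact: sqr_ge0. Qed.

Lemma CSn D f g : measurable D -> L2 D f -> L2 D g ->
  `|\int[mu]_(x in D) (f x * g x)| <= n2 D f * n2 D g.
Proof.
move=> mD Lf Lg; rewrite -ler_sqr ?nnegrE//; last by rewrite mulr_ge0// n2_ge0.
by rewrite real_normK ?num_real// exprMn !n2_sq; exact: CS.
Qed.

Lemma n2_le_bnd D f C : measurable D -> (mu D < +oo)%E -> fine (mu D) <= 1 ->
  measurable_fun D f -> 0 <= C -> (forall x, D x -> `|f x| <= C) -> n2 D f <= C.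
Proof.
move=> mD Df D1 mf C0 fC; rewrite -ler_sqr ?nnegrE ?n2_ge0// n2_sq.
apply: (@le_trans _ _ (\int[mu]_(x in D) (C ^+ 2))).
  apply: le_Rintegral => //; first by case: (L2_bnd mD Df mf fC).
    exact: intg_cst.
  move=> x Dx; rewrite -(real_normK (num_real (f x))).
  by rewrite ler_sqr ?nnegrE//; exact: fC.
by rewrite Rintegral_cst// ler_piMr// sqr_ge0.
Qed.

Lemma CSb D f g C : measurable D -> (mu D < +oo)%E -> fine (mu D) <= 1 -> 0 <= C ->
  measurable_fun D f -> L2 D g -> (forall x, D x -> `|f x| <= C) ->
  `|\int[mu]_(x in D) (f x * g x)| <= C * n2 D g.
Proof.
move=> mD Df D1 C0 mf Lg fC; apply: (le_trans (CSn mD (L2_bnd mD Df mf fC) Lg)).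
by rewrite ler_wpM2r ?n2_ge0// n2_le_bnd.
Qed.
End L2.

(** * Functions with quadratically small increments *)

Section Quad.
Context {R : realType}.
Local Notation mu := (@lebesgue_measure R).

(* Increments which are quadratic in those of [\int v] add up to [O(1/N)] along
   a subdivision into [N] equal intervals, because
   [(\int_a^b v)^2 <= (b - a) \int_a^b v^2]. *)
Lemma quad_const (T C : R) (v Phi : R -> R) : 0 <= T -> 0 <= C -> L2 `[0, T] v ->
  (forall a b, 0 <= a -> a <= b -> b <= T ->
     `|Phi b - Phi a| <= C * (\int[mu]_(x in `[a, b]) v x) ^+ 2) ->
  Phi T = Phi 0.
Proof.
move=> T0 C0 Lv HPhi.
have sub a b : 0 <= a -> b <= T -> `[a, b]%classic `<=` `[0, T]%classic.
  move=> a0 bT x; rewrite /= !in_itv/= => /andP[ax xb].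
  by rewrite (le_trans a0 ax) (le_trans xb bT).
have H a b : 0 <= a -> a <= b -> b <= T ->
    `|Phi b - Phi a| <= C * (b - a) * \int[mu]_(x in `[a, b]) (v x ^+ 2).
  move=> a0 ab bT; apply: (le_trans (HPhi a b a0 ab bT)).
  rewrite -mulrA ler_wpM2l//.
  have Lv' : L2 `[a, b] v by apply: L2S Lv => //; exact: sub.
  have L1 : L2 `[a, b] (fun=> 1 : R).
    by apply: (@L2_bnd _ _ _ 1) => //; [exact: mu_cc_fin|move=> x _; rewrite normr1].
  have := CS _ L1 Lv'; rewrite (_ : \int[mu]_(x in `[a, b]) (1 ^+ 2) = b - a).
    move=> /(_ (measurable_itv _)); congr (_ ^+ 2 <= _).
    by apply: Rint_eq => x _; rewrite mul1r.
  by rewrite Rintegral_cst// expr1n mul1r; exact: mu_cc.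
set V := \int[mu]_(x in `[0, T]) (v x ^+ 2).
have V0 : 0 <= V by apply: Rintegral_ge0 => x _; exact: sqr_ge0.
have main N : `|Phi T - Phi 0| <= C * T * V / N.+1%:R.
  pose t i := T * (i%:R / N.+1%:R).
  have Nn : (N.+1%:R : R) != 0 by rewrite pnatr_eq0.
  have tS i : t i.+1 = t i + T / N.+1%:R.
    by rewrite /t -natr1; field.
  have t0 i : 0 <= t i by rewrite /t mulr_ge0// divr_ge0.
  have tT i : (i <= N.+1)%N -> t i <= T.
    by move=> iN; rewrite /t ler_piMr// ler_pdivrMr ?ltr0n// mul1r ler_nat.
  have TN0 : 0 <= T / N.+1%:R by rewrite divr_ge0.
  have step i : (i <= N.+1)%N ->
      `|Phi (t i) - Phi 0| <= C * (T / N.+1%:R) * \int[mu]_(x in `[0, t i]) (v x ^+ 2).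
    elim: i => [|i IH] iN.
      by rewrite /t mul0r mulr0 subrr normr0 set_itv1 Rintegral_set1 mulr0.
    rewrite (@Rint_split _ (fun x => v x ^+ 2) 0 (t i) (t i.+1))//; last 2 first.
    - by rewrite tS lerDl.
    - by case: Lv => _; apply: intgS => //; apply: sub => //; exact: tT.
    rewrite mulrDr.
    rewrite (_ : Phi (t i.+1) - Phi 0 = (Phi (t i) - Phi 0) + (Phi (t i.+1) - Phi (t i))); last by ring.
    apply: (le_trans (ler_normD _ _)); rewrite lerD//; first by apply: IH; exact: ltnW.
    have := H (t i) (t i.+1) (t0 i); rewrite tS => H'.
    have := H'; rewrite lerDl -tS => /(_ TN0 (tT _ iN)).
    by rewrite {2}tS addrAC subrr add0r.
  have := step N.+1 (leqnn _); rewrite /t divff// mulr1 -/V.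
  by move=> /le_trans; apply; rewrite le_eqVlt; apply/orP; left; apply/eqP; field.
apply/eqP; rewrite -subr_eq0 -normr_le0; apply/ler_addgt0Pr => e e0; rewrite add0r.
have X0 : 0 <= C * T * V by rewrite !mulr_ge0.
have [N HN] : exists N, C * T * V / e <= N.+1%:R.
  exists (Num.truncn (C * T * V / e)).
  by apply: ltW; apply: truncnS_gt.
apply: (le_trans (main N)); rewrite ler_pdivrMr ?ltr0n// [leRHS]mulrC.
by rewrite -ler_pdivrMr.
Qed.
End Quad.

Unset Implicit Arguments.
Set Strict Implicit.

(** * Sine series *)
Section Fourier.
Context {R : realType}.
Local Notation mu := (@lebesgue_measure R).
Implicit Types (f g h w : R -> R) (a : nat -> R) (i j n : nat).

Definition I01 f : R := \int[mu]_(x in `]0, 1[) f x.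
(* [e_ 0 = 0], so that coefficient families can be indexed by all of [nat]. *)
Definition e_ j (x : R) : R := Num.sqrt 2 * sin (j%:R * pi * x).
Definition de_ j (x : R) : R := Num.sqrt 2 * (j%:R * pi) * cos (j%:R * pi * x).

Lemma mu01 : fine (mu `]0, 1[) <= 1.
Proof. by rewrite mu_oo// subr0. Qed.

Lemma I01_ext f g : (forall x, 0 < x < 1 -> f x = g x) -> I01 f = I01 g.
Proof. by move=> fg; apply: Rint_eq => x; rewrite /= in_itv/=; exact: fg. Qed.

Lemma I01_cc f : continuous f -> I01 f = \int[mu]_(x in `[0, 1]) f x.
Proof. by move=> cf; rewrite /I01 Rint_cc_oo//; exact: intg_cts. Qed.

Lemma I01_ftc (F f : R -> R) : has_deriv F f -> continuous f -> I01 f = F 1 - F 0.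
Proof. by move=> dF cf; rewrite I01_cc// (ftc _ dF). Qed.

Lemma I01D f g : continuous f -> continuous g -> I01 (fun x => f x + g x) = I01 f + I01 g.
Proof. by move=> cf cg; apply: RintegralD => //; exact: intg_oo. Qed.

Lemma I01B f g : continuous f -> continuous g -> I01 (fun x => f x - g x) = I01 f - I01 g.
Proof. by move=> cf cg; apply: RintegralB => //; exact: intg_oo. Qed.

Lemma I01Z (k : R) f : continuous f -> I01 (fun x => k * f x) = k * I01 f.
Proof. by move=> cf; apply: RintegralZl => //; exact: intg_oo. Qed.

Lemma I01N f : continuous f -> I01 (fun x => - f x) = - I01 f.
Proof. by move=> cf; apply: RintN => //; exact: intg_oo. Qed.

Lemma I01_cst (c : R) : I01 (fun=> c) = c.
Proof. by rewrite /I01 Rintegral_cst// mu_oo// subr0 mulr1. Qed.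

Lemma I01_bnd f C : continuous f -> (forall x, 0 < x < 1 -> `|f x| <= C) -> `|I01 f| <= C.
Proof.
move=> cf fC; rewrite -[leRHS]I01_cst; apply: Rint_bnd => //; try exact: intg_oo.
by apply: intg_cst => //; exact: mu_oo_fin.
Qed.

Lemma I01_le f g : continuous f -> continuous g -> (forall x, 0 < x < 1 -> f x <= g x) ->
  I01 f <= I01 g.
Proof.
move=> cf cg fg; by apply: le_Rintegral => //; exact: intg_oo.
Qed.

Lemma cts_bnd f : continuous f -> exists2 C, 0 <= C & forall x, 0 <= x <= 1 -> `|f x| <= C.
Proof.
move=> cf.
have [|c _ Hc] := @EVT_max R (fun x => `|f x|) 0 1 ler01.
  by apply: continuous_subspaceT; exact: cts_norm.
by exists (`|f c|) => // x x01; apply: Hc; rewrite in_itv.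
Qed.

Lemma L2_cts f : continuous f -> L2 `]0, 1[ f.
Proof.
by move=> cf; split; [exact: meas_cts|apply: intg_oo; exact: ctsX].
Qed.

Lemma e_cts j : continuous (e_ j).
Proof. by rewrite /e_; cts. Qed.

Lemma de_cts j : continuous (de_ j).
Proof. by rewrite /de_; cts. Qed.

#[local] Hint Extern 1 (cont (e_ _)) => (exact (e_cts _)) : cts.
#[local] Hint Extern 1 (cont (de_ _)) => (exact (de_cts _)) : cts.

Lemma sqrt2_bnd : 0 <= Num.sqrt (2 : R) <= 2.
Proof.
rewrite sqrtr_ge0/= -ler_sqr ?nnegrE ?sqrtr_ge0// sqr_sqrtr//; lra.
Qed.

Lemma abs_sin_le1 (x : R) : `|sin x| <= 1.
Proof. by rewrite ler_norml sin_geN1 sin_le1. Qed.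

Lemma abs_cos_le1 (x : R) : `|cos x| <= 1.
Proof. by rewrite ler_norml cos_geN1 cos_le1. Qed.

Lemma e_bnd j x : `|e_ j x| <= 2.
Proof.
rewrite /e_ normrM; have /andP[s0 s2] := sqrt2_bnd; rewrite (ger0_norm s0).
have := abs_sin_le1 (j%:R * pi * x); have := normr_ge0 (sin (j%:R * pi * x)); nra.
Qed.

Lemma hder_lin (c : R) : has_deriv (fun x => c * x) (fun=> c).
Proof. by apply: (hder_eq _ (hderZ c hder_id)) => x; rewrite mulr1. Qed.

Lemma hder_e j : has_deriv (e_ j) (de_ j).
Proof.
apply: (hder_eq _ (hderZ _ (hder_comp hder_sin (hder_lin (j%:R * pi))))) => x.
by rewrite /de_; ring.
Qed.

Lemma hder_de j : has_deriv (de_ j) (fun x => - lambda j * e_ j x).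
Proof.
apply: (hder_eq _ (hderZ _ (hder_comp hder_cos (hder_lin (j%:R * pi))))) => x.
by rewrite /lambda /e_; ring.
Qed.

Lemma e_0 j : e_ j 0 = 0. Proof. by rewrite /e_ mulr0 sin0 mulr0. Qed.
Lemma e0_ x : e_ 0 x = 0. Proof. by rewrite /e_ !mul0r sin0 mulr0. Qed.

Lemma sin_npi n : sin (n%:R * pi) = 0 :> R.
Proof.
elim: n => [|n IH]; first by rewrite mul0r sin0.
by rewrite -natr1 mulrDl mul1r sinD IH sinpi mul0r mulr0 addr0.
Qed.

Lemma e_1 j : e_ j 1 = 0. Proof. by rewrite /e_ mulr1 sin_npi mulr0. Qed.

Lemma lambda_inj j (k : nat) : lambda j = lambda k :> R -> j = k.
Proof.
move=> /eqP; rewrite /lambda eqrXn2// ?mulr_ge0 ?pi_ge0//.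
have pi0 : (pi : R) != 0 by rewrite gt_eqF ?pi_gt0.
by rewrite (inj_eq (mulIf pi0)) eqr_nat => /eqP.
Qed.

Lemma lambda_ge0 j : 0 <= lambda j :> R.
Proof. exact: sqr_ge0. Qed.

Lemma I01_green w w' w'' j : has_deriv w w' -> has_deriv w' w'' -> continuous w'' ->
  w 0 = 0 -> w 1 = 0 ->
  I01 (fun x => w'' x * e_ j x) = - lambda j * I01 (fun x => w x * e_ j x).
Proof.
move=> dw dw' cw'' w0 w1.
have cw := hder_cts dw; have cw' := hder_cts dw'; have ce := e_cts j; have cde := de_cts j.
have /I01_ftc : has_deriv (fun x => w' x * e_ j x - w x * de_ j x)
    (fun x => w'' x * e_ j x + lambda j * (w x * e_ j x)).
  apply: (hder_eq _ (hderB (hderM dw' (hder_e j)) (hderM dw (hder_de j)))) => x; ring.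
rewrite e_0 e_1 w0 w1 => E.
have : I01 (fun x => w'' x * e_ j x) + lambda j * I01 (fun x => w x * e_ j x) = 0.
  rewrite -I01Z; last by cts.
  rewrite -I01D; [|by cts|by cts].
  by rewrite E; [ring|cts].
by move/eqP; rewrite addr_eq0 => /eqP ->; ring.
Qed.

(** Green's formula moves the second derivative from one eigenfunction to the other, and the
    eigenvalues are distinct. *)
Lemma e_orth i j : i != j -> I01 (fun x => e_ i x * e_ j x) = 0.
Proof.
move=> ij; have := I01_green _ _ _ j (hder_e i) (hder_de i) _ (e_0 i) (e_1 i).
have ci := e_cts i; have cj := e_cts j.
have c1 : continuous (fun x => - lambda i * e_ i x) by cts.
move=> /(_ c1).
have -> : I01 (fun x => - lambda i * e_ i x * e_ j x) = - lambda i * I01 (fun x => e_ i x * e_ j x).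
  by rewrite -I01Z; [apply: I01_ext => x _; ring|cts].
move=> E; apply/eqP; have : (lambda i - lambda j) * I01 (fun x => e_ i x * e_ j x) = 0.
  by move: E; set J := I01 _ => E; lra.
move/eqP; rewrite mulf_eq0 subr_eq0 => /orP[/eqP/lambda_inj ijE|//].
by rewrite ijE eqxx in ij.
Qed.

Lemma lambda_gt0 j : (0 < j)%N -> 0 < lambda j :> R.
Proof. by move=> j0; rewrite exprn_gt0// mulr_gt0 ?pi_gt0// ltr0n. Qed.

(** From [e_j'^2 + lambda_j e_j^2 = 2 lambda_j] follows [(e_j e_j')' = 2 lambda_j (1 - e_j^2)], and
    [e_j e_j'] vanishes at both ends. *)
Lemma e_norm j : (0 < j)%N -> I01 (fun x => e_ j x * e_ j x) = 1.
Proof.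
move=> j0; have ce := e_cts j; have cde := de_cts j.
have /I01_ftc : has_deriv (fun x => e_ j x * de_ j x)
    (fun x => 2 * lambda j - 2 * lambda j * (e_ j x * e_ j x)).
  apply: (hder_eq _ (hderM (hder_e j) (hder_de j))) => x.
  have : de_ j x * de_ j x + lambda j * (e_ j x * e_ j x) = 2 * lambda j.
    have s2 : Num.sqrt 2 ^+ 2 = 2 :> R by rewrite sqr_sqrtr.
    have := cos2Dsin2 (j%:R * pi * x).
    rewrite /de_ /e_ /lambda => cs.
    transitivity (Num.sqrt 2 ^+ 2 * (j%:R * pi) ^+ 2 *
      (cos (j%:R * pi * x) ^+ 2 + sin (j%:R * pi * x) ^+ 2)); first by ring.
    by rewrite cs s2; ring.
  by move=> H; lra.
rewrite e_0 e_1 !mul0r subrr I01B; [|by cts|by cts].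
rewrite I01_cst I01Z; last by cts.
move=> E; have := E ltac:(cts) => /eqP; rewrite -[X in X - _]mulr1 -mulrBr mulf_eq0.
rewrite mulf_eq0 pnatr_eq0/= gt_eqF ?lambda_gt0//= subr_eq0 => /eqP <- //.
Qed.

(** * Sine series with quadratically decaying coefficients *)

Definition decay a (B : R) := forall j, `|a j| <= B / j.+1%:R ^+ 2.

Definition psum a n (x : R) := \sum_(j < n) a j * e_ j x.
Definition ssum a (x : R) : R := limn (fun n => psum a n x).

Lemma psum_cts a n : continuous (psum a n).
Proof.
by rewrite /psum; apply: (@cts_sum _ n (fun j x => a j * e_ j x)) => j; have ce := e_cts j; cts.
Qed.

Lemma exists_large (c : R) : exists N, c < N.+1%:R.
Proof. by exists (Num.truncn c); apply: truncnS_gt. Qed.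

Lemma exists_small (K e : R) : 0 < e -> exists N, K / N.+1%:R < e.
Proof.
move=> e0; have [N HN] := exists_large (K / e); exists N.
by rewrite ltr_pdivrMr ?ltr0n// [ltRHS]mulrC -ltr_pdivrMr.
Qed.

Lemma cauchy_rate (S : nat -> R) (K : R) :
  (forall n m, (n <= m)%N -> `|S m - S n| <= K / n.+1%:R) ->
  forall n, `|limn S - S n| <= K / n.+1%:R.
Proof.
move=> HS n.
have K0 : 0 <= K by have := HS 0%N 0%N isT; rewrite subrr normr0 divr1.
have cS : cvgn S.
  apply/cauchy_cvgP/cauchy_exP => e e0.
  have [N HN] := exists_small K e e0; exists (S N).
  exists N => // m /= Nm; rewrite /ball/= distrC.
  exact: le_lt_trans (HS _ _ Nm) HN.
apply/ler_addgt0Pr => e e0.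
have /cvgrPdist_lt /(_ e e0)[N _ HN] : S @ \oo --> limn S by [].
have := HN (maxn N n) (leq_maxl _ _).
have := HS n (maxn N n) (leq_maxr _ _).
set L := limn S; set m := maxn N n => H1 H2.
rewrite (_ : L - S n = (S m - S n) + (L - S m)); last by ring.
by apply: (le_trans (ler_normD _ _)); rewrite lerD// ltW.
Qed.

Lemma decay_ge0 a B : decay a B -> 0 <= B.
Proof. by move=> /(_ 0%N); rewrite expr1n divr1; exact: le_trans. Qed.

(** As [|e_j| <= 2], the term of index [j] is at most [4 B (1 / (j + 1) - 1 / (j + 2))], and these
    bounds telescope. The rate is uniform in [x]. *)
Lemma psum_tail a B n m x : decay a B -> (n <= m)%N ->
  `|psum a m x - psum a n x| <= 4 * B / n.+1%:R.
Proof.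
move=> aB nm; have B0 := decay_ge0 _ _ aB.
have : `|psum a m x - psum a n x| <= 4 * B * (n.+1%:R^-1 - m.+1%:R^-1).
  rewrite -(subnKC nm); elim: (m - n)%N => [|k IH].
    by rewrite addn0 subrr normr0 subrr mulr0.
  rewrite addnS /psum big_ord_recr /= -/(psum a (n + k) x).
  rewrite addrAC; apply: (le_trans (ler_normD _ _)).
  apply: (le_trans (lerD IH (lexx _))).
  rewrite normrM; have := aB (n + k)%N; set p := (n + k)%N => ap.
  have e2 := e_bnd p x.
  have p1 : 0 < p.+1%:R :> R by rewrite ltr0n.
  have p2 : 0 < p.+2%:R :> R by rewrite ltr0n.
  have : `|a p| * `|e_ p x| <= (B / p.+1%:R ^+ 2) * 2.
    by apply: ler_pM.
  have : (B / p.+1%:R ^+ 2) * 2 <= 4 * B * (p.+1%:R^-1 - p.+2%:R^-1).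
    have -> : 4 * B * (p.+1%:R^-1 - p.+2%:R^-1) = (B / p.+1%:R ^+ 2) * (4 * p.+1%:R / p.+2%:R).
      have -> : p.+2%:R = p.+1%:R + 1 :> R by rewrite -natr1.
      field; rewrite -natr1 in p2; rewrite !gt_eqF//.
    rewrite ler_wpM2l ?divr_ge0// ?exprn_ge0// ?(ltW p1)// ler_pdivlMr//.
    rewrite -!natr1; have : 0 <= p%:R :> R by []. lra.
  set X := B / _ * 2; set Y := `|a p| * _; move=> H1 H2.
  have := le_trans H2 H1; rewrite !mulrBr; set x1 := _ * n.+1%:R^-1; set x2 := _ * p.+1%:R^-1; set x3 := _ * p.+2%:R^-1; lra.
move=> /le_trans; apply; rewrite ler_wpM2l ?mulr_ge0// gerBl invr_ge0//.
Qed.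

Lemma ssum_tail a B n x : decay a B -> `|ssum a x - psum a n x| <= 4 * B / n.+1%:R.
Proof. by move=> aB; apply: cauchy_rate => p m pm; exact: psum_tail. Qed.

Lemma ssum_bnd a B x : decay a B -> `|ssum a x| <= 4 * B.
Proof. by move=> aB; have := ssum_tail _ _ 0 x aB; rewrite /psum big_ord0 subr0 divr1. Qed.

Lemma unif_cts (F : nat -> R -> R) f K : (forall n, continuous (F n)) ->
  (forall n x, `|f x - F n x| <= K / n.+1%:R) -> continuous f.
Proof.
move=> cF H x; apply/cvgrPdist_le => e e0.
have e3 : 0 < e / 3 by rewrite divr_gt0.
have [N HN] := exists_small K (e / 3) e3.
have /cvgrPdist_lt /(_ _ e3) := cF N x.
apply: filterS => y xy.
have := H N x; have := H N y.
move: HN xy; set k := K / _ => *.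
have -> : f x - f y = (f x - F N x) + (F N x - F N y) - (f y - F N y) by ring.
apply: (le_trans (ler_normB _ _)).
have := ler_normD (f x - F N x) (F N x - F N y); lra.
Qed.

Lemma ssum_cts a B : decay a B -> continuous (ssum a).
Proof.
move=> aB; apply: (@unif_cts (psum a) _ (4 * B)); first by move=> n; exact: psum_cts.
by move=> n x; exact: ssum_tail.
Qed.

Lemma I01_psum a n g : L2 `]0, 1[ g ->
  I01 (fun x => psum a n x * g x) = \sum_(j < n) a j * I01 (fun x => e_ j x * g x).
Proof.
move=> Lg.
have H j : intg `]0, 1[ (fun x => e_ j x * g x) by apply: L2M => //; apply: L2_cts; exact: e_cts.
have := @Rint_sum _ `]0, 1[ n (fun j x => a j * (e_ j x * g x)) (measurable_itv _) (fun j => intgZ _ (measurable_itv _) (H j)).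
move=> [_ E]; transitivity (\int[mu]_(x in `]0%R, 1%R[) (\sum_(j < n) a j * (e_ j x * g x))).
  by apply: Rint_eq => x _; rewrite /psum mulr_suml; apply: eq_bigr => j _; rewrite mulrA.
rewrite E; apply: eq_bigr => j _; apply: RintegralZl => //; exact: H.
Qed.

Lemma ssum_I01 a B n g : decay a B -> L2 `]0, 1[ g ->
  `|I01 (fun x => ssum a x * g x) - \sum_(j < n) a j * I01 (fun x => e_ j x * g x)|
    <= 4 * B / n.+1%:R * n2 `]0, 1[ g.
Proof.
move=> aB Lg; rewrite -I01_psum//.
have cs := ssum_cts _ _ aB; have cp := psum_cts a n.
rewrite -RintegralB//; [|exact: L2M (L2_cts _ cs) Lg|exact: L2M (L2_cts _ cp) Lg].
rewrite (_ : \int[mu]_(x in _) _ = \int[mu]_(x in `]0, 1[) ((ssum a x - psum a n x) * g x)); last first.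
  by apply: Rint_eq => x _; ring.
apply: CSb => //.
- exact: mu_oo_fin.
- exact: mu01.
- by rewrite divr_ge0// mulr_ge0// (decay_ge0 _ _ aB).
- apply: meas_cts => //; by cts.
- by move=> x _; exact: ssum_tail.
Qed.

Lemma small_eq (x y C : R) : (forall n, `|x - y| <= C / n.+1%:R) -> x = y.
Proof.
move=> H; apply/eqP; rewrite -subr_eq0 -normr_le0; apply/ler_addgt0Pr => e e0; rewrite add0r.
by have [N HN] := exists_small C e e0; apply: le_trans (H N) (ltW HN).
Qed.

Lemma ssum_coef a B j : decay a B -> (0 < j)%N -> I01 (fun x => ssum a x * e_ j x) = a j.
Proof.
move=> aB j0; have Le : L2 `]0, 1[ (e_ j) by apply: L2_cts; exact: e_cts.
apply: (@small_eq _ _ ((j.+1)%:R * (4 * B * n2 `]0, 1[ (e_ j)))) => n.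
have B0 := decay_ge0 _ _ aB.
have C0 : 0 <= 4 * B * n2 `]0, 1[ (e_ j) by rewrite !mulr_ge0// n2_ge0.
(* At least [j.+1] terms are taken, so that the partial sum contains the index [j]. *)
have := ssum_I01 _ _ (j.+1 + n)%N _ aB Le.
have -> : \sum_(i < j.+1 + n) a i * I01 (fun x => e_ i x * e_ j x) = a j.
  have lt : (j < j.+1 + n)%N by rewrite addSn ltnS leq_addr.
  rewrite (bigD1 (Ordinal lt))//= e_norm// mulr1 big1 ?addr0// => i ij.
  have ij' : (i : nat) != j by [].
  by rewrite e_orth ?mulr0.
move=> /le_trans; apply.
rewrite mulrAC -[leRHS]mulrA [leRHS]mulrCA ler_wpM2l//.
rewrite ler_pdivlMr ?ltr0n// mulrC ler_pdivrMr ?ltr0n// -natrM ler_nat.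
lia.
Qed.

(** * Uniqueness of the sine coefficients of a continuous function *)

Lemma sin_step j (y : R) : (0 < j)%N ->
  sin (j%:R * y) * cos y = (sin (j.+1%:R * y) + sin (j.-1%:R * y)) / 2.
Proof.
case: j => // j _ /=.
have -> : j%:R * y = j.+1%:R * y - y by rewrite -natr1; ring.
have -> : j.+2%:R * y = j.+1%:R * y + y by rewrite -natr1; ring.
by rewrite sinD sinB; field.
Qed.

(** By [sin_step] this class is stable under multiplication by [cos (pi x)], hence by polynomials in
    [cos (pi x)], among which peaking kernels are available. *)
Definition odd_ortho g := forall j, I01 (fun x => sin (j%:R * (pi * x)) * g x) = 0.

Lemma odd_orthoD (k : R) g h : continuous g -> continuous h ->
  odd_ortho g -> odd_ortho h -> odd_ortho (fun x => g x + k * h x).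
Proof.
move=> cg ch og oh j.
transitivity (I01 (fun x => sin (j%:R * (pi * x)) * g x + k * (sin (j%:R * (pi * x)) * h x))).
  by apply: I01_ext => x _; ring.
rewrite I01D; [|by cts|by cts].
by rewrite I01Z; [rewrite og oh mulr0 addr0|by cts].
Qed.

Lemma odd_ortho_cos g : continuous g -> odd_ortho g -> odd_ortho (fun x => cos (pi * x) * g x).
Proof.
move=> cg og [|j].
  rewrite -(I01_cst 0); apply: I01_ext => x _.
  by rewrite mul0r sin0 mul0r.
transitivity (I01 (fun x => 2^-1 * (sin (j.+2%:R * (pi * x)) * g x) +
                             2^-1 * (sin (j%:R * (pi * x)) * g x))).
  by apply: I01_ext => x _; rewrite mulrA sin_step//=; ring.
by rewrite I01D ?I01Z ?og ?mulr0 ?addr0//; cts.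
Qed.

Lemma Rint_ge f (C : R) (x y : R) : x <= y -> continuous f ->
  (forall z, x <= z <= y -> C <= f z) -> C * (y - x) <= \int[mu]_(z in `[x, y]) f z.
Proof.
move=> xy cf Cf; rewrite -[C * _](_ : \int[mu]_(z in `[x, y]) C = _).
  apply: le_Rintegral => //; [|exact: intg_cts].
    by apply: intg_cst => //; exact: mu_cc_fin.
by rewrite Rintegral_cst// mu_cc.
Qed.

Lemma bernoulli (x : R) n : 0 <= x -> 1 + n%:R * x <= (1 + x) ^+ n.
Proof.
move=> x0; elim: n => [|n IH]; first by rewrite mul0r addr0 expr0.
rewrite exprS -natr1; have := ler_pM _ _ (lexx (1 + x)) IH.
have n0 : 0 <= n%:R :> R by [].
move=> H; apply: le_trans (H _ _); nra.
Qed.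

(* [(1 + eps^2 - (cos (pi x) - cos (pi x0))^2 / 4)^n] times a sine is a sine
   polynomial, and it concentrates at [x0] as [n] grows. *)
Lemma sine_unique_pos (r : R -> R) (x0 : R) : continuous r -> (forall j, I01 (fun x => r x * e_ j x) = 0) ->
  0 < x0 < 1 -> 0 < r x0 -> False.
Proof.
move=> cr Hr /andP[x00 x01] rx0.
have or : odd_ortho r.
  move=> j; have s2 : Num.sqrt (2 : R) != 0 by rewrite gt_eqF// sqrtr_gt0.
  apply/eqP; rewrite -(mulrI_eq0 _ (mulfI s2)) -I01Z; last by cts.
  by rewrite -(Hr j); apply/eqP/I01_ext => x _; rewrite /e_ -[j%:R * pi * x]mulrA; ring.
pose c (x : R) := cos (pi * x).
have cc : continuous c by rewrite /c; cts.
(* The weight [sin (pi x)] is positive on (0, 1), so [g] has the sign of [r] there, and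
   orthogonality of [q^n r] to the first sine says that [g q^n] has integral zero. *)
pose g (x : R) := sin (1%:R * (pi * x)) * r x.
have cg : continuous g by rewrite /g; cts.
have pi0 := @pi_gt0 R.
have gx0 : 0 < g x0.
  rewrite /g mulr_gt0// mul1r sin_gt0_pi//; apply/andP; split; first exact: mulr_gt0.
  by rewrite gtr_pMr.
have [d [d0 dx0 dx1 gd]] : exists d, [/\ 0 < d, 0 < x0 - d, x0 + d < 1 &
    forall x, `|x - x0| <= d -> g x0 / 2 <= g x].
  have g2 : 0 < g x0 / 2 by rewrite divr_gt0.
  have /cvgrPdist_lt /(_ _ g2) /nbhs_ballP [d /= d0 Hd] := cg x0.
  pose d' := Num.min (d / 2) (Num.min (x0 / 2) ((1 - x0) / 2)).
  have a1 : d' <= d / 2 by rewrite /d' ge_min lexx.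
  have a2 : d' <= x0 / 2 by rewrite /d' !ge_min lexx orbT.
  have a3 : d' <= (1 - x0) / 2 by rewrite /d' !ge_min lexx !orbT.
  exists d'; split; [|lra|lra|].
    by rewrite /d' !lt_min !divr_gt0// subr_gt0.
  move=> x xd; have : ball x0 d x by rewrite /ball/= distrC; lra.
  by move=> /Hd /=; rewrite ltr_norml => /andP[_]; lra.
have cdec x y : 0 <= x -> x < y -> y <= 1 -> c y < c x.
  move=> x_0 xy y1; rewrite /c ltr_cos ?ltr_pM2l// in_itv/=; apply/andP; split.
  - by rewrite mulr_ge0// ltW.
  - by rewrite ger_pMr// ltW// (lt_le_trans xy).
  - by rewrite mulr_ge0 ?ltW// (le_lt_trans x_0).
  - by rewrite ger_pMr.
have [E [E0 E1 HE]] : exists E, [/\ 0 < E, E <= 1 & forall x, 0 <= x <= 1 -> d <= `|x - x0| -> 2 * E <= `|c x - c x0|].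
  pose E := Num.min 1 (Num.min ((c (x0 - d) - c x0) / 2) ((c x0 - c (x0 + d)) / 2)).
  have a1 : E <= 1 by rewrite /E ge_min lexx.
  have a2 : E <= (c (x0 - d) - c x0) / 2 by rewrite /E !ge_min lexx orbT.
  have a3 : E <= (c x0 - c (x0 + d)) / 2 by rewrite /E !ge_min lexx !orbT.
  have b2 : c x0 < c (x0 - d) by apply: cdec; lra.
  have b3 : c (x0 + d) < c x0 by apply: cdec; lra.
  exists E; split => //.
    by rewrite /E !lt_min ltr01 !divr_gt0// subr_gt0.
  move=> x /andP[x_0 x_1]; rewrite ler_normr => /orP[h|h].
    have : c x <= c (x0 + d).
      have : x0 + d <= x by lra.
      by rewrite le_eqVlt => /predU1P[->//|h']; apply/ltW/cdec; lra.
    by rewrite ler_normr => ?; apply/orP; right; lra.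
  have : c (x0 - d) <= c x.
    have : x <= x0 - d by lra.
    by rewrite le_eqVlt => /predU1P[->//|h']; apply/ltW/cdec; lra.
  by rewrite ler_normr => ?; apply/orP; left; lra.
(* The divisor 4 makes [q] nonnegative, since two cosines differ by at most 2. At distance at least
   [d] from [x0] one has [|c x - c x0| >= 2 E], hence [q <= 1]; where [|c x - c x0| <= E],
   [q >= 1 + 3 E^2 / 4]. *)
pose q (x : R) := 1 + E ^+ 2 - (c x - c x0) ^+ 2 / 4.
have cq : continuous q by rewrite /q; cts.
have oq n : odd_ortho (fun x => q x ^+ n * r x).
  elim: n => [|n IH]; first by move=> j; rewrite -[RHS](or j); apply: I01_ext => x _; ring.
  have cn : continuous (fun x => q x ^+ n * r x) by cts.
  have IH1 := odd_ortho_cos _ cn IH.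
  have cn1 : continuous (fun x => cos (pi * x) * (q x ^+ n * r x)) by cts.
  have IH2 := odd_ortho_cos _ cn1 IH1.
  have cn2 : continuous (fun x => cos (pi * x) * (cos (pi * x) * (q x ^+ n * r x))) by cts.
  have cn0 : continuous (fun x => 0 * (q x ^+ n * r x)) by cts.
  have IH0 : odd_ortho (fun x => 0 * (q x ^+ n * r x)).
    by move=> j; rewrite -[RHS](I01_cst 0); apply: I01_ext => x _; ring.
  have K1 := odd_orthoD (1 + E ^+ 2 - c x0 ^+ 2 / 4) _ _ cn0 cn IH0 IH.
  have K2 := odd_orthoD (c x0 / 2) _ _ _ cn1 K1 IH1.
  have K3 := odd_orthoD (- 4^-1) _ _ _ cn2 (K2 ltac:(cts)) IH2.
  move=> j; rewrite -[RHS](K3 _ j); last by cts.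
  by apply: I01_ext => x _; rewrite exprS {1}/q /c; field.
have [G G0 HG] := cts_bnd _ cg.
have q01 x : 0 <= q x.
  rewrite /q; have := abs_cos_le1 (pi * x); have := abs_cos_le1 (pi * x0).
  rewrite -/(c x) -/(c x0) !ler_norml => /andP[? ?] /andP[? ?].
  have : (c x - c x0) ^+ 2 <= 4 by nra.
  have := sqr_ge0 E; lra.
have low n x : 0 <= x <= 1 -> - G <= g x * q x ^+ n.
  move=> xx; have [h|h] := leP `|x - x0| d.
    apply: (@le_trans _ _ 0); first by rewrite oppr_le0.
    by rewrite mulr_ge0 ?exprn_ge0//; have := gd x h; lra.
  have q1 : q x <= 1.
    have := HE x xx (ltW h) => h2.
    have : (2 * E) ^+ 2 <= (c x - c x0) ^+ 2.
      rewrite -[leRHS]real_normK ?num_real// ler_sqr ?nnegrE//; lra.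
    rewrite /q; lra.
  have qn1 : q x ^+ n <= 1 by rewrite exprn_ile1.
  have qn0 : 0 <= q x ^+ n by rewrite exprn_ge0.
  have := HG x xx; rewrite ler_norml => /andP[g1 g2]; nra.
(* Since [c] is Lipschitz with constant [pi], distance at most [E / pi] from [x0] ensures
   [|c x - c x0| <= E]. *)
pose d1 := Num.min d (E / pi).
have d10 : 0 < d1 by rewrite /d1 lt_min d0 divr_gt0.
have d1d : d1 <= d by rewrite /d1 ge_min lexx.
have d1E : pi * d1 <= E by rewrite mulrC -ler_pdivlMr// /d1 ge_min lexx orbT.
pose eta := 3 * E ^+ 2 / 4.
have eta0 : 0 < eta by rewrite /eta divr_gt0// mulr_gt0// exprn_gt0.
have high n x : `|x - x0| <= d1 -> g x0 / 2 * (1 + n%:R * eta) <= g x * q x ^+ n.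
  move=> h; have h' : g x0 / 2 <= g x by apply: gd; exact: le_trans h d1d.
  apply: ler_pM => //; first by rewrite ltW// divr_gt0.
    by rewrite addr_ge0// mulr_ge0// ltW.
  apply: (le_trans (bernoulli eta n (ltW eta0))).
  apply: lerXn2r; rewrite ?nnegrE; [by rewrite addr_ge0// ltW|exact: q01|].
  have : `|c x - c x0| <= E.
    apply: le_trans d1E; apply: le_trans (_ : pi * `|x - x0| <= _); last by rewrite ler_wpM2l// ltW.
    apply: (mvt_bnd (f' := fun x => - sin (pi * x) * pi)).
      exact: (hder_comp hder_cos (hder_lin pi)).
    move=> y; rewrite normrM normrN (ger0_norm (ltW pi0)).
    by rewrite ger_pMl// abs_sin_le1.
  move=> h2; have : (c x - c x0) ^+ 2 <= E ^+ 2.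
    by rewrite -[leLHS]real_normK ?num_real// ler_sqr ?nnegrE// ltW.
  rewrite /q /eta; lra.
(* By Bernoulli's inequality the integral near [x0] grows at least linearly in [n], while the rest
   is never below [- G]; this [n] makes the total positive. *)
have [n Hn] := exists_large (G / (g x0 / 2 * eta * (d1 + d1))).
have cgq : continuous (fun x => g x * q x ^+ n.+1) by cts.
have I0 : I01 (fun x => g x * q x ^+ n.+1) = 0.
  by rewrite -(oq n.+1 1%N); apply: I01_ext => x _; rewrite /g; ring.
have := I0; rewrite I01_cc// (@Rint_split _ _ 0 (x0 - d1) 1); [|lra|lra|exact: intg_cts].
rewrite (@Rint_split _ _ (x0 - d1) (x0 + d1) 1); [|lra|lra|exact: intg_cts].
have J1 : - G * (x0 - d1 - 0) <= \int[mu]_(x in `[0, (x0 - d1)]) (g x * q x ^+ n.+1).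
  by apply: Rint_ge => //; [lra|move=> z /andP[z0 z1]; apply: low; lra].
have J3 : - G * (1 - (x0 + d1)) <= \int[mu]_(x in `[(x0 + d1), 1]) (g x * q x ^+ n.+1).
  by apply: Rint_ge => //; [lra|move=> z /andP[z0 z1]; apply: low; lra].
have J2 : g x0 / 2 * (1 + n.+1%:R * eta) * (x0 + d1 - (x0 - d1)) <= \int[mu]_(x in `[(x0 - d1), (x0 + d1)]) (g x * q x ^+ n.+1).
  apply: Rint_ge => //; [lra|move=> z /andP[z0 z1]; apply: high].
  rewrite ler_norml; lra.
have P0 : 0 < g x0 / 2 * eta * (d1 + d1) by apply: mulr_gt0; [apply: mulr_gt0; [exact: divr_gt0|exact: eta0]|exact: addr_gt0].
move: Hn; rewrite ltr_pdivrMr// => Hn.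
have P1 : 0 < g x0 / 2 * (d1 + d1) by apply: mulr_gt0; [exact: divr_gt0|exact: addr_gt0].
move: J1 J2 J3; set j1 := Rintegral _ _ _; set j2 := Rintegral _ _ _; set j3 := Rintegral _ _ _.
have Gd := mulr_ge0 G0 (ltW d10).
move=> J1 J2 J3 J; clear - J1 J2 J3 J Hn P1 Gd; lra.
Qed.

Lemma sine_unique (r : R -> R) : continuous r -> (forall j, I01 (fun x => r x * e_ j x) = 0) ->
  forall x, 0 < x < 1 -> r x = 0.
Proof.
move=> cr Hr x xx; have [h|h|//] := ltgtP (r x) 0; exfalso.
  apply: (@sine_unique_pos (fun x => - r x) x) => //; [by cts| |by rewrite oppr_gt0].
  move=> j; transitivity (I01 (fun x => - (r x * e_ j x))).
    by apply: I01_ext => y _; ring.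
  by rewrite I01N ?Hr ?oppr0//; have ce := e_cts j; cts.
exact: (@sine_unique_pos r x).
Qed.

(** * Sine coefficients of C2 functions vanishing at the ends *)

Lemma lambda_ge j : (0 < j)%N -> j.+1%:R ^+ 2 <= lambda j :> R.
Proof.
move=> j0; rewrite /lambda; apply: lerXn2r; rewrite ?nnegrE//.
  by rewrite mulr_ge0// pi_ge0.
have := @pi_ge2 R; have : 1 <= j%:R :> R by rewrite ler1n.
rewrite -natr1; nra.
Qed.

(** By Green's formula the coefficient of [w] is that of [w''] divided by [- lambda j], and
    [(j + 1)^2 <= lambda j]. The factor 2 bounds [e_j]. *)
Lemma coef_decay w w' w'' (C : R) : has_deriv w w' -> has_deriv w' w'' -> continuous w'' ->
  w 0 = 0 -> w 1 = 0 -> (forall x, 0 < x < 1 -> `|w'' x| <= C) ->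
  decay (fun j => I01 (fun x => w x * e_ j x)) (2 * C).
Proof.
move=> dw dw' cw'' w0 w1 wC j.
have C0 : 0 <= C by apply: le_trans (wC (1 / 2) _); rewrite ?normr_ge0//; lra.
have [->|j0] := posnP j.
  rewrite (_ : I01 _ = 0) ?normr0; first by rewrite expr1n divr1 mulr_ge0.
  by rewrite -[RHS](I01_cst 0); apply: I01_ext => x _; rewrite e0_ mulr0.
rewrite ler_pdivlMr ?exprn_gt0 ?ltr0n//.
apply: (@le_trans _ _ (lambda j * `|I01 (fun x => w x * e_ j x)|)).
  by rewrite mulrC ler_wpM2r// lambda_ge.
rewrite -[X in X * _]ger0_norm ?lambda_ge0// -normrM -normrN -mulNr.
rewrite -(I01_green _ _ _ _ dw dw')//.
apply: I01_bnd; first by cts.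
move=> x xx; rewrite normrM mulrC.
by apply: ler_pM => //; [exact: e_bnd|exact: wC].
Qed.

(** The difference of the two sides is continuous with vanishing sine coefficients, so [sine_unique]
    applies. *)
Lemma coef_ssum w w' w'' (C : R) : has_deriv w w' -> has_deriv w' w'' -> continuous w'' ->
  w 0 = 0 -> w 1 = 0 -> (forall x, 0 < x < 1 -> `|w'' x| <= C) ->
  forall x, 0 < x < 1 -> w x = ssum (fun j => I01 (fun x => w x * e_ j x)) x.
Proof.
move=> dw dw' cw'' w0 w1 wC x xx.
have D := coef_decay _ _ _ _ dw dw' cw'' w0 w1 wC.
have cs := ssum_cts _ _ D; have cw := hder_cts dw.
apply/eqP; rewrite -subr_eq0; apply/eqP; move: x xx.
apply: (@sine_unique (fun x => w x - ssum (fun j => I01 (fun x => w x * e_ j x)) x)).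
  by cts.
move=> j; have [->|j0] := posnP j.
  by rewrite -[RHS](I01_cst 0); apply: I01_ext => x _; rewrite e0_ mulr0.
rewrite (_ : I01 _ = I01 (fun x => w x * e_ j x) -
   I01 (fun x => ssum (fun j => I01 (fun x => w x * e_ j x)) x * e_ j x)).
  by rewrite (ssum_coef _ _ _ D)// subrr.
rewrite -I01B; [|by cts|by cts].
by apply: I01_ext => x _; rewrite mulrBl.
Qed.
End Fourier.

(** * Absolutely continuous functions of time *)
#[export] Hint Extern 1 (cont (e_ _)) => (exact (e_cts _)) : cts.
#[export] Hint Extern 1 (cont (de_ _)) => (exact (de_cts _)) : cts.

(** * Families continuous in time, uniformly on [0, 1] *)

Section Families.
Context {R : realType}.
Local Notation mu := (@lebesgue_measure R).
Implicit Types (F G : R -> R -> R) (f g s : R -> R).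

(** The second half is continuity in [t] for the sup norm on [0, 1]. It passes to products, because
    each [F t0] is bounded on [0, 1], and to integrals over (0, 1). *)
Definition fam F := (forall t, continuous (F t)) /\
  forall t0 (e : R), 0 < e -> \forall t \near t0, forall x, 0 <= x <= 1 -> `|F t x - F t0 x| <= e.

Lemma fam_x g : continuous g -> fam (fun _ x => g x).
Proof.
move=> cg; split=> // t0 e e0; apply: filterE => t x _.
by rewrite subrr normr0 ltW.
Qed.

Lemma fam_t s : continuous s -> fam (fun t _ => s t).
Proof.
move=> cs; split=> [t|t0 e e0]; first exact: cts_cst.
have /cvgrPdist_le /(_ e e0) := cs t0.
by apply: filterS => t st x _; rewrite distrC.
Qed.

Lemma famD F G : fam F -> fam G -> fam (fun t x => F t x + G t x).
Proof.
move=> [cF uF] [cG uG]; split=> [t|t0 e e0].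
  by have := cF t; have := cG t; move=> h1 h2; cts.
have e2 : 0 < e / 2 by rewrite divr_gt0.
apply: filterS2 (uF t0 _ e2) (uG t0 _ e2) => t hF hG x x01.
have h1 := hF x x01; have h2 := hG x x01.
rewrite (_ : _ - _ = (F t x - F t0 x) + (G t x - G t0 x)); last by ring.
apply: (le_trans (ler_normD _ _)); lra.
Qed.

Lemma famM F G : fam F -> fam G -> fam (fun t x => F t x * G t x).
Proof.
move=> [cF uF] [cG uG]; split=> [t|t0 e e0].
  by have := cF t; have := cG t; move=> h1 h2; cts.
have [C C0 HC] := cts_bnd _ (cF t0); have [D D0 HD] := cts_bnd _ (cG t0).
pose d := Num.min 1 (e / (1 + C + D)).
have K0 : 0 < 1 + C + D by lra.
have d0 : 0 < d by rewrite /d lt_min ltr01 divr_gt0.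
have d1 : d <= 1 by rewrite /d ge_min lexx.
have dE : d * (1 + C + D) <= e by rewrite -ler_pdivlMr// /d ge_min lexx orbT.
apply: filterS2 (uF t0 _ d0) (uG t0 _ d0) => t hF hG x x01.
have h2 := hF x x01; have h1 := hG x x01.
have h3 := HC x x01; have h4 := HD x x01.
rewrite (_ : _ - _ = (F t x - F t0 x) * (G t x - G t0 x) + (F t0 x * (G t x - G t0 x) + G t0 x * (F t x - F t0 x))); last by ring.
apply: (le_trans (ler_normD _ _)); apply: (le_trans (lerD (lexx _) (ler_normD _ _))).
rewrite !normrM.
have a1 := ler_pM (normr_ge0 _) (normr_ge0 _) h2 h1.
have a2 := ler_pM (normr_ge0 _) (normr_ge0 _) h3 h1.
have a3 := ler_pM (normr_ge0 _) (normr_ge0 _) h4 h2.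
nra.
Qed.

Lemma famN F : fam F -> fam (fun t x => - F t x).
Proof.
move=> [cF uF]; split=> [t|t0 e e0]; first by have := cF t => h1; cts.
apply: filterS (uF t0 e e0) => t h x x01.
by rewrite -opprD normrN h.
Qed.

Lemma fam_lip (h : R -> R) F : continuous h -> (forall x y, `|h x - h y| <= `|x - y|) ->
  fam F -> fam (fun t x => h (F t x)).
Proof.
move=> ch hl [cF uF]; split=> [t|t0 e e0].
  by apply: cts_comp => //; exact: cF.
by apply: filterS (uF t0 e e0) => t H x x01; apply: le_trans (hl _ _) (H x x01).
Qed.

Lemma cos_lip (x y : R) : `|cos x - cos y| <= `|x - y|.
Proof.
have := @mvt_bnd R cos _ 1 y x (@hder_cos R); rewrite mul1r; apply=> z.
by rewrite normrN abs_sin_le1.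
Qed.

Lemma sin_lip (x y : R) : `|sin x - sin y| <= `|x - y|.
Proof. have := @mvt_bnd R sin _ 1 y x (@hder_sin R); rewrite mul1r; apply=> z.
exact: abs_cos_le1. Qed.

Lemma fam_cos F : fam F -> fam (fun t x => cos (F t x)).
Proof. by apply: fam_lip; [exact: cts_cos|exact: cos_lip]. Qed.

Lemma fam_sin F : fam F -> fam (fun t x => sin (F t x)).
Proof. by apply: fam_lip; [exact: cts_sin|exact: sin_lip]. Qed.

Lemma fam_psum (a : nat -> R -> R) n : (forall j, continuous (a j)) ->
  fam (fun t => psum (a^~ t) n).
Proof.
move=> ca; elim: n => [|n IH].
  have -> : (fun t => psum (a^~ t) 0) = (fun _ _ => 0).
    by apply/funext => t; apply/funext => x; rewrite /psum big_ord0.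
  by apply: fam_t; exact: cts_cst.
have -> : (fun t => psum (a^~ t) n.+1) = (fun t x => psum (a^~ t) n x + a n t * e_ n x).
  by apply/funext => t; apply/funext => x; rewrite /psum big_ord_recr.
apply: famD => //; apply: famM; [exact: fam_t|by apply: fam_x; exact: e_cts].
Qed.

Lemma fam_ssum (a : nat -> R -> R) B : (forall j, continuous (a j)) ->
  (forall t, decay (a^~ t) B) -> fam (fun t => ssum (a^~ t)).
Proof.
move=> ca aB; split=> [t|t0 e e0]; first exact: ssum_cts (aB t).
have e3 : 0 < e / 3 by rewrite divr_gt0.
have [N HN] := exists_small (4 * B) (e / 3) e3.
have [_ /(_ t0 _ e3)] := fam_psum a N ca.
apply: filterS => t H x x01; have := H x x01.
have := ssum_tail _ _ N x (aB t); have := ssum_tail _ _ N x (aB t0).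
move: HN; set k := 4 * B / _ => HN h1 h2 h3.
rewrite (_ : _ - _ = (ssum (a^~ t) x - psum (a^~ t) N x) + (psum (a^~ t) N x - psum (a^~ t0) N x)
   - (ssum (a^~ t0) x - psum (a^~ t0) N x)); last by ring.
apply: (le_trans (ler_normB _ _)); apply: (le_trans (lerD (ler_normD _ _) (lexx _))); lra.
Qed.

Lemma fam_I01 F : fam F -> continuous (fun t => I01 (F t)).
Proof.
move=> [cF uF] t0; apply/cvgrPdist_le => e e0.
apply: filterS (uF t0 e e0) => t H.
rewrite distrC -I01B//; apply: I01_bnd; first by have := cF t; have := cF t0 => h1 h2; cts.
by move=> x /andP[x0 x1]; apply: H; rewrite !ltW.
Qed.
End Families.

Ltac fam1 := first [ assumption | match goal with
  | |- fam (fun t x => @?F t x + @?G t x) => refine (famD F G _ _)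
  | |- fam (fun t x => - @?F t x) => refine (famN F _)
  | |- fam (fun t x => @?F t x * @?G t x) => refine (famM F G _ _)
  | |- fam (fun t x => cos (@?F t x)) => refine (fam_cos F _)
  | |- fam (fun t x => sin (@?F t x)) => refine (fam_sin F _)
  | |- fam (fun t x => ?F t x) => change (fam F); assumption
  | |- fam (fun t x => @?f t) => refine (fam_t f _); solve [cts]
  | |- fam (fun t x => @?f x) => refine (fam_x f _); solve [cts]
  end ].
Ltac fam := repeat fam1.

(** * Primitives of functions dominated by 1 + |u| *)

Section AC.
Context {R : realType}.
Local Notation mu := (@lebesgue_measure R).
Variables (T : R) (u : R -> R).
Hypotheses (T0 : 0 <= T) (Lu : L2 `[0, T] u).

(** A single weight for elapsed time and for the control: being at least 1, its integral dominates
    [b - a]; being square integrable, it is admissible in [quad_const]. *)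
Definition wt (t : R) := 1 + `|u t|.

Lemma wt_ge1 t : 1 <= wt t. Proof. by rewrite /wt lerDl. Qed.

Lemma Lwt : L2 `[0, T] wt.
Proof.
have L1 : L2 `[0, T] (fun=> 1 : R).
  by apply: (L2_bnd (C := 1)) => //; [exact: mu_cc_fin|move=> x _; rewrite normr1].
apply: L2D => //; case: Lu => mu_ u2; split; first exact: measurableT_comp.
apply: intg_eq u2 => x _; by rewrite real_normK// num_real.
Qed.

Lemma sub0T a b : 0 <= a -> b <= T -> `[a, b]%classic `<=` `[0, T]%classic.
Proof.
move=> a0 bT x; rewrite /= !in_itv/= => /andP[ax xb].
by rewrite (le_trans a0 ax) (le_trans xb bT).
Qed.

Lemma intg_wt a b : 0 <= a -> b <= T -> intg `[a, b] wt.
Proof.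
move=> a0 bT; apply: L2_intg => //; first exact: mu_cc_fin.
by apply: (L2S _ _ _ Lwt) => //; exact: sub0T.
Qed.

Definition dwt a b : R := \int[mu]_(x in `[a, b]) wt x.

Definition dom (al : R -> R) := measurable_fun `[0, T] al /\
  exists2 C, 0 <= C & forall t, 0 <= t <= T -> `|al t| <= C * wt t.

(* Everything driven by the [L2] control is only absolutely continuous:
   [acf A al] says that [A] is on [[0, T]] a primitive of [al], where [dom]
   provides the bound by [1 + |u|] that controls the error terms. *)
Definition acf (A al : R -> R) :=
  [/\ continuous A, dom al &
    forall t, 0 <= t <= T -> A t = A 0 + \int[mu]_(x in `[0, t]) al x].

Lemma dwt_ge a b : 0 <= a -> a <= b -> b <= T -> b - a <= dwt a b.
Proof.
move=> a0 ab bT; rewrite -[b - a]mul1r -[leLHS](_ : \int[mu]_(x in `[a, b]) 1 = _).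
  apply: le_Rintegral => //.
  - by apply: intg_cst => //; exact: mu_cc_fin.
  - exact: intg_wt.
  - by move=> x _; exact: wt_ge1.
by rewrite Rintegral_cst// mu_cc.
Qed.

Lemma dwt_ge0 a b : 0 <= dwt a b.
Proof. by apply: Rintegral_ge0 => x _; apply: le_trans (wt_ge1 x). Qed.

Lemma dwt_mono a c b : 0 <= a -> a <= c -> c <= b -> b <= T -> dwt a c <= dwt a b.
Proof.
move=> a0 ac cb bT; rewrite /dwt (@Rint_split _ _ a c b)//; last exact: intg_wt.
by rewrite lerDl; exact: dwt_ge0.
Qed.

Lemma dom_intg al a b : dom al -> 0 <= a -> b <= T -> intg `[a, b] al.
Proof.
move=> [mal [C C0 HC]] a0 bT; apply: (intg_le (g := fun x => C * wt x)) => //.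
- by apply: measurable_funS mal => //; exact: sub0T.
- by apply: intgZ => //; exact: intg_wt.
- move=> x xab; apply: HC; have := sub0T _ _ a0 bT x xab.
  by rewrite /= in_itv.
Qed.

Lemma domD al be : dom al -> dom be -> dom (fun t => al t + be t).
Proof.
move=> [m1 [C C0 HC]] [m2 [D D0 HD]]; split; first exact: measurable_funD.
exists (C + D); first exact: addr_ge0.
move=> t tT; apply: (le_trans (ler_normD _ _)).
by rewrite mulrDl lerD// ?HC ?HD.
Qed.

Lemma cts_bnd_itv (f : R -> R) : continuous f -> exists2 C : R, 0 <= C & forall x, 0 <= x <= T -> `|f x| <= C.
Proof.
move=> cf.
have [|c _ Hc] := @EVT_max R (fun x => `|f x|) 0 T T0.
  by apply: continuous_subspaceT; exact: cts_norm.
by exists (`|f c|) => // x x01; apply: Hc; rewrite in_itv.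
Qed.

Lemma domMc al (f : R -> R) : dom al -> continuous f -> dom (fun t => f t * al t).
Proof.
move=> [m1 [C C0 HC]] cf; have [D D0 HD] := cts_bnd_itv _ cf; split.
  by apply: measurable_funM => //; exact: meas_cts.
exists (D * C); first exact: mulr_ge0.
move=> t tT; rewrite normrM -mulrA; apply: ler_pM => //; [exact: HD|exact: HC].
Qed.

Lemma dom_u : dom u.
Proof.
case: Lu => m1 _; split=> //; exists 1 => // t _; rewrite mul1r /wt lerDr//.
Qed.

Lemma dom_cts (f : R -> R) : continuous f -> dom f.
Proof.
move=> cf; have [D D0 HD] := cts_bnd_itv _ cf; split; first exact: meas_cts.
exists D => // t tT; rewrite -[leLHS]mulr1; apply: ler_pM => //; [exact: HD|exact: wt_ge1].
Qed.

Lemma dom_int_bnd al : dom al -> exists2 C, 0 <= C & forall a b, 0 <= a -> a <= b -> b <= T ->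
  forall (f : R -> R) (M : R), continuous f -> (forall t, a <= t <= b -> `|f t| <= M) ->
  `|\int[mu]_(x in `[a, b]) (f x * al x)| <= C * M * dwt a b.
Proof.
move=> dal; have [m1 [C C0 HC]] := dal; exists C => // a b a0 ab bT f M cf fM.
have M0 : 0 <= M by apply: le_trans (fM a _) => //; rewrite lexx.
rewrite /dwt -RintegralZl//; last exact: intg_wt.
apply: Rint_bnd => //.
- by apply: dom_intg => //; exact: domMc.
- by apply: intgZ => //; exact: intg_wt.
- move=> x; rewrite /= in_itv/= => /andP[ax xb]; rewrite normrM mulrAC mulrC.
  apply: ler_pM => //; last by apply: fM; rewrite ax.
  by apply: HC; rewrite (le_trans a0)// (le_trans xb).
Qed.

Lemma acf_incr A al a b : acf A al -> 0 <= a -> a <= b -> b <= T ->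
  A b - A a = \int[mu]_(x in `[a, b]) al x.
Proof.
move=> [cA dal HA] a0 ab bT.
rewrite HA ?(le_trans a0 ab)// [A a]HA ?a0 ?(le_trans ab bT)//.
rewrite (@Rint_split _ _ 0 a b)//; last exact: dom_intg.
ring.
Qed.

Lemma acf_bnd A al : acf A al -> exists2 C, 0 <= C & forall a b, 0 <= a -> a <= b -> b <= T ->
  `|A b - A a| <= C * dwt a b.
Proof.
move=> HA; have [cA dal _] := HA; have [C C0 HC] := dom_int_bnd _ dal; exists C => // a b a0 ab bT.
rewrite (acf_incr _ _ _ _ HA)//.
have := HC a b a0 ab bT (fun=> 1) 1 (@cts_cst _ 1); rewrite mulr1.
rewrite (_ : \int[mu]_(x in `[a, b]) (1 * al x) = \int[mu]_(x in `[a, b]) al x).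
  by apply=> t _; rewrite normr1.
by apply: Rint_eq => x _; rewrite mul1r.
Qed.

(** A first-order expansion of the increments is enough: subtracting the integral of [al] leaves a
    function with increments quadratic in [dwt], which is constant by [quad_const]. *)
Lemma acf_quad A al (C : R) : continuous A -> dom al -> 0 <= C ->
  (forall a b, 0 <= a -> a <= b -> b <= T ->
    `|A b - A a - \int[mu]_(x in `[a, b]) al x| <= C * dwt a b ^+ 2) -> acf A al.
Proof.
move=> cA dal C0 H; split=> // t /andP[t0 tT].
have := @quad_const _ t C wt (fun t => A t - \int[mu]_(x in `[0, t]) al x) t0 C0.
rewrite set_itv1 Rintegral_set1 subr0 => E.
rewrite -E ?subrK//; first by apply: (L2S _ _ _ Lwt) => //; exact: sub0T.
move=> a b a0 ab bt; have bT := le_trans bt tT.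
rewrite (@Rint_split _ _ 0 a b)//; last exact: dom_intg.
rewrite (_ : _ - _ = A b - A a - \int[mu]_(x in `[a, b]) al x); last by ring.
exact: H.
Qed.

(** Freezing [A] and [B] at [a] leaves [(A b - A a) (B b - B a)] and two integrals against
    [A x - A a] and [B x - B a], all of order [dwt a b ^+ 2]. *)
Lemma acfM A al B be : acf A al -> acf B be ->
  acf (fun t => A t * B t) (fun t => B t * al t + A t * be t).
Proof.
move=> HA HB; have [cA dA _] := HA; have [cB dB _] := HB.
have [CA CA0 HCA] := acf_bnd _ _ HA; have [CB CB0 HCB] := acf_bnd _ _ HB.
have [DA DA0 HDA] := dom_int_bnd _ dA; have [DB DB0 HDB] := dom_int_bnd _ dB.
apply: (acf_quad _ _ (CA * CB + DA * CB + DB * CA)); first by cts.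
- by apply: domD; exact: domMc.
- by rewrite !addr_ge0// mulr_ge0.
move=> a b a0 ab bT; have m0 := dwt_ge0 a b.
have aT := le_trans ab bT.
have E1 := acf_incr _ _ _ _ HA a0 ab bT; have E2 := acf_incr _ _ _ _ HB a0 ab bT.
have i1 : intg `[a, b] (fun x => (B x - B a) * al x).
  by apply: dom_intg => //; apply: domMc => //; cts.
have i2 : intg `[a, b] (fun x => (A x - A a) * be x).
  by apply: dom_intg => //; apply: domMc => //; cts.
have i3 := dom_intg _ _ _ dA a0 bT; have i4 := dom_intg _ _ _ dB a0 bT.
have -> : \int[mu]_(x in `[a, b]) (B x * al x + A x * be x) =
   B a * (A b - A a) + A a * (B b - B a) + \int[mu]_(x in `[a, b]) ((B x - B a) * al x)
    + \int[mu]_(x in `[a, b]) ((A x - A a) * be x).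
  rewrite E1 E2 -!RintegralZl// -!RintegralD//; last 4 first.
  - by apply: intgD => //; apply: intgD => //; exact: intgZ.
  - by apply: intgD => //; exact: intgZ.
  - exact: intgZ.
  - exact: intgZ.
  by apply: Rint_eq => x _; ring.
have k1 := HCA a b a0 ab bT; have k2 := HCB a b a0 ab bT.
have k3 := HDA a b a0 ab bT (fun x => B x - B a) (CB * dwt a b) ltac:(cts).
have k4 := HDB a b a0 ab bT (fun x => A x - A a) (CA * dwt a b) ltac:(cts).
have k3' := k3 ltac:(move=> t /andP[at_ tb]; apply: (le_trans (HCB a t a0 at_ (le_trans tb bT))); rewrite ler_wpM2l//; exact: dwt_mono).
have k4' := k4 ltac:(move=> t /andP[at_ tb]; apply: (le_trans (HCA a t a0 at_ (le_trans tb bT))); rewrite ler_wpM2l//; exact: dwt_mono).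
move: k3' k4'; set J1 := Rintegral _ _ _; set J2 := Rintegral _ _ _ => k3' k4'.
rewrite (_ : _ - _ = (A b - A a) * (B b - B a) - J1 - J2); last by ring.
apply: (le_trans (ler_normB _ _)); apply: (le_trans (lerD (ler_normB _ _) (lexx _))).
rewrite normrM; have := ler_pM (normr_ge0 _) (normr_ge0 _) k1 k2.
move: (dwt a b) m0 k3' k4' => m m0; lra.
Qed.

Lemma acfD A al B be : acf A al -> acf B be -> acf (fun t => A t + B t) (fun t => al t + be t).
Proof.
move=> [cA dA HA] [cB dB HB]; split; first by cts.
  exact: domD.
move=> t tT; have /andP[t0 t1] := tT; rewrite HA// HB// RintegralD//; [ring| |]; exact: dom_intg.
Qed.

Lemma acfZ (k : R) A al : acf A al -> acf (fun t => k * A t) (fun t => k * al t).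
Proof.
move=> [cA dA HA]; split; first by cts.
  by apply: (domMc _ (fun=> k)) => //; exact: cts_cst.
move=> t tT; have /andP[t0 t1] := tT; rewrite HA// RintegralZl//; first ring.
exact: dom_intg.
Qed.

Lemma acf_cst (k : R) : acf (fun=> k) (fun=> 0).
Proof.
split; [exact: cts_cst|by apply: dom_cts; exact: cts_cst|move=> t _].
by rewrite Rintegral_cst// mul0r addr0.
Qed.

Lemma acf_sum n (A al : nat -> R -> R) : (forall j, acf (A j) (al j)) ->
  acf (fun t => \sum_(j < n) A j t) (fun t => \sum_(j < n) al j t).
Proof.
move=> HA; elim: n => [|n IH].
  have := acf_cst 0; congr acf; by apply/funext => t; rewrite big_ord0.
have := acfD _ _ _ _ IH (HA n); congr acf; by apply/funext => t; rewrite big_ord_recr.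
Qed.

Lemma acf_ext A al be : acf A al -> dom be -> (forall t, 0 <= t <= T -> al t = be t) -> acf A be.
Proof.
move=> [cA dA HA] db E; split=> // t tT; rewrite HA//; congr (_ + _).
apply: Rint_eq => x; rewrite /= in_itv/= => /andP[x0 xt].
by apply: E; rewrite x0 (le_trans xt)//; case/andP: tT.
Qed.

Lemma acf_der A al : has_deriv A al -> continuous al -> acf A al.
Proof.
move=> dA cal; split; [exact: hder_cts dA|exact: dom_cts|].
move=> t /andP[t0 _]; rewrite (ftc t0 dA)//; ring.
Qed.

Lemma acf_exists al : dom al -> exists2 A, A 0 = 0 & acf A al.
Proof.
(* The bound on [al] holds on [0, T] only; clipping the upper limit keeps the primitive continuous
   on the whole line, as [acf] requires. *)
move=> dal; pose cl (t : R) := Num.max 0 (Num.min t T).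
have clT t : 0 <= cl t <= T by rewrite /cl le_max lexx/= ge_max T0 ge_min lexx orbT.
have clE t : 0 <= t <= T -> cl t = t by move=> /andP[t0 tT]; rewrite /cl (min_idPl tT) (max_idPr t0).
have cl_lip t t0 : `|cl t - cl t0| <= `|t - t0|.
  wlog tt : t t0 / t0 <= t => [H|].
    by have [/H//|/ltW/H] := leP t0 t; rewrite distrC (distrC t).
  rewrite !ger0_norm ?subr_ge0//; last first.
    by rewrite /cl ge_max le_max lexx/= le_max; apply/orP; right; rewrite le_min !ge_min tt lexx !orbT.
  rewrite /cl; have [?|?] := leP t T; have [?|?] := leP t0 T; have [?|?] := leP 0 t; have [?|?] := leP 0 t0; have [?|?] := leP 0 T; lra.
pose A t := \int[mu]_(x in `[0, cl t]) al x.
exists A; first by rewrite /A clE ?lexx// set_itv1 Rintegral_set1.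
have [C C0 HC] := dom_int_bnd _ dal.
set V := \int[mu]_(x in `[0, T]) (wt x ^+ 2).
have V0 : 0 <= V by apply: Rintegral_ge0 => x _; exact: sqr_ge0.
(* Cauchy-Schwarz against [wt]: the primitive is Hoelder continuous of exponent 1/2, which gives the
   continuity demanded by [acf]. *)
have incr a b : 0 <= a -> a <= b -> b <= T ->
    (\int[mu]_(x in `[0, b]) al x - \int[mu]_(x in `[0, a]) al x) ^+ 2 <= C ^+ 2 * V * (b - a).
  move=> a0 ab bT.
  rewrite (@Rint_split _ _ 0 a b)//; last exact: dom_intg.
  rewrite addrAC subrr add0r.
  have := HC a b a0 ab bT (fun=> 1) 1 (@cts_cst _ 1) ltac:(by move=> t _; rewrite normr1).
  rewrite mulr1 (_ : \int[mu]_(x in `[a, b]) (1 * al x) = \int[mu]_(x in `[a, b]) al x); last first.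
    by apply: Rint_eq => x _; rewrite mul1r.
  move=> h; rewrite -[leLHS]real_normK ?num_real//.
  apply: (@le_trans _ _ ((C * dwt a b) ^+ 2)).
    by apply: lerXn2r; rewrite ?nnegrE ?mulr_ge0 ?dwt_ge0.
  rewrite exprMn -mulrA ler_wpM2l ?sqr_ge0//.
  have Lw : L2 `[a, b] wt by apply: (L2S _ _ _ Lwt) => //; exact: sub0T.
  have L1 : L2 `[a, b] (fun=> 1 : R).
    by apply: (L2_bnd (C := 1)) => //; [exact: mu_cc_fin|move=> x _; rewrite normr1].
  have := CS (measurable_itv _) L1 Lw.
  rewrite (_ : \int[mu]_(x in `[a, b]) (1 * wt x) = dwt a b); last first.
    by apply: Rint_eq => x _; rewrite mul1r.
  rewrite expr1n Rintegral_cst// mu_cc// mul1r mulrC => /le_trans; apply.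
  rewrite ler_wpM2r ?subr_ge0// /V.
  have [_ iw] := Lwt.
  rewrite (@Rint_split _ (fun x => wt x ^+ 2) 0 a T) ?(le_trans ab)//.
  rewrite (@Rint_split _ (fun x => wt x ^+ 2) a b T)//; last first.
    by apply: intgS iw => //; apply: sub0T.
  rewrite addrCA lerDl addr_ge0//; by apply: Rintegral_ge0 => x _; exact: sqr_ge0.
split => //; last first.
  by move=> t tT; rewrite /A !clE ?lexx ?T0// set_itv1 Rintegral_set1 add0r.
move=> t0; apply/cvgrPdist_le => e e0.
pose K := C ^+ 2 * V; have K0 : 0 <= K by rewrite mulr_ge0// sqr_ge0.
have d0 : 0 < e ^+ 2 / (K + 1) by rewrite divr_gt0 ?exprn_gt0// ltr_wpDl.
have /cvgrPdist_le /(_ _ d0) := @cts_id R t0.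
apply: filterS => t tt0.
have H : (A t0 - A t) ^+ 2 <= K * `|cl t0 - cl t|.
  have /andP[a0 aT] := clT t; have /andP[b0 bT] := clT t0.
  have [h|/ltW h] := leP (cl t) (cl t0).
    by rewrite ger0_norm ?subr_ge0//; exact: incr.
  by rewrite distrC ger0_norm ?subr_ge0// -sqrrN opprB; exact: incr.
rewrite -ler_sqr ?nnegrE ?(ltW e0)// real_normK ?num_real//.
apply: (le_trans H); apply: (@le_trans _ _ ((K + 1) * (e ^+ 2 / (K + 1)))); last first.
  by rewrite mulrC divfK// gt_eqF// ltr_wpDl.
apply: ler_pM => //; first by rewrite lerDl.
exact: le_trans (cl_lip _ _) tt0.
Qed.

(** The location of [c] allows iteration: in the estimates of [cos h - 1] and [sin h - h] the
    derivative at [c] is bounded by an earlier estimate, where [|c| <= |h|]. *)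
Lemma mvt_loc (f f' : R -> R) a b : has_deriv f f' ->
  exists2 c, `|c - a| <= `|b - a| & f b - f a = f' c * (b - a).
Proof.
move=> df; have [ab|ba|->] := ltgtP a b.
- have [||c + ->] := @MVT R f f' a b ab.
  + by move=> x _; exact: df.
  + by apply: continuous_subspaceT; exact: hder_cts df.
  rewrite in_itv/= => /andP[ac cb]; exists c => //.
  by rewrite !ger0_norm ?subr_ge0 ?ltW// ltrD2r.
- have [||c + E] := @MVT R f f' b a ba.
  + by move=> x _; exact: df.
  + by apply: continuous_subspaceT; exact: hder_cts df.
  rewrite in_itv/= => /andP[bc ca]; exists c; last by rewrite -opprB E; ring.
  by rewrite !ler0_norm ?subr_le0 ?ltW// !opprB ltrD2l ltrN2.
- by exists b; rewrite ?subrr ?mulr0.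
Qed.

Lemma cos_sub1 (h : R) : `|cos h - 1| <= h ^+ 2.
Proof.
have [c ch] := mvt_loc cos _ 0 h (@hder_cos R); rewrite cos0 => ->.
move: ch; rewrite !subr0 normrM normrN => ch; rewrite -[leRHS]real_normK ?num_real// expr2.
apply: ler_pM => //; apply: le_trans ch.
by have := sin_lip c 0; rewrite sin0 !subr0.
Qed.

Lemma sin_sub (h : R) : `|sin h - h| <= `|h| ^+ 3.
Proof.
have [c ch] := mvt_loc (fun x => sin x - x) _ 0 h (hderB (@hder_sin R) hder_id).
rewrite sin0 !subr0 => ->; rewrite normrM exprSr ler_wpM2r//.
apply: (le_trans (cos_sub1 c)); rewrite -[leLHS]real_normK ?num_real//.
by apply: lerXn2r; rewrite ?nnegrE//; move: ch; rewrite !subr0.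
Qed.

Lemma sin_sub2 (h : R) : `|sin h - h| <= h ^+ 2.
Proof.
have [c ch] := mvt_loc (fun x => sin x - x) _ 0 h (hderB (@hder_sin R) hder_id).
rewrite sin0 !subr0 => ->; rewrite normrM -[leRHS]real_normK ?num_real// expr2 ler_wpM2r//.
apply: (@le_trans _ _ `|c|); last by move: ch; rewrite !subr0.
by have := cos_lip c 0; rewrite cos0 subr0.
Qed.

Lemma cos_taylor (x y : R) : `|cos y - cos x + sin x * (y - x)| <= 2 * (y - x) ^+ 2.
Proof.
set h := y - x.
have -> : cos y - cos x + sin x * h = cos x * (cos h - 1) - sin x * (sin h - h).
  rewrite (_ : y = x + h); last by rewrite /h; ring.
  by rewrite cosD; ring.
apply: (le_trans (ler_normB _ _)); rewrite !normrM.
have := ler_pM (normr_ge0 _) (normr_ge0 _) (abs_cos_le1 x) (cos_sub1 h).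
have := ler_pM (normr_ge0 _) (normr_ge0 _) (abs_sin_le1 x) (sin_sub2 h).
lra.
Qed.

(** * Differentiating the gauge phase in time *)

Section Phase.
Variables (s M : R -> R) (kap : R).
Hypotheses (Hs : acf s u) (cM : continuous M).

Definition th (beta t x : R) : R := s t * M x - kap * t + beta.

Lemma th_cts beta t : continuous (th beta t).
Proof. by rewrite /th; cts. Qed.

Lemma fam_th beta : fam (th beta).
Proof.
by have [cs _ _] := Hs; rewrite /th; fam.
Qed.

Lemma I01_bndb (g : R -> R) (C D : R) (f : R -> R) : continuous f -> continuous g -> (forall x, 0 < x < 1 -> `|f x| <= C) ->
  (forall x, 0 <= x <= 1 -> `|g x| <= D) -> `|I01 (fun x => f x * g x)| <= C * D.
Proof.
move=> cf cg fC gD; apply: I01_bnd; first by cts.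
move=> x /andP[x0 x1]; rewrite normrM; apply: ler_pM => //.
  by apply: fC; rewrite x0.
by apply: gD; rewrite !ltW.
Qed.

(** The phase is only absolutely continuous in time, so the chain rule is checked on increments.
    Those of [th] are [O(dwt)] uniformly in [x]; the second-order Taylor remainder and the freezing
    of the two sine integrals at [a] both cost [O(dwt^2)], as [acf_quad] allows. *)
Lemma acf_Icos beta (g : R -> R) : continuous g ->
  acf (fun t => I01 (fun x => cos (th beta t x) * g x))
      (fun t => I01 (fun x => sin (th beta t x) * (M x * g x)) * (- u t)
                + kap * I01 (fun x => sin (th beta t x) * g x)).
Proof.
move=> cg; have [cs du _] := Hs.
have fth := fam_th beta.
have cth t := th_cts beta t.
have cMg : continuous (fun x => M x * g x) by cts.
have cC : continuous (fun t => I01 (fun x => cos (th beta t x) * g x)).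
  by apply: fam_I01; apply: famM; [exact: fam_cos|exact: fam_x].
have cS (f : R -> R) : continuous f -> continuous (fun t => I01 (fun x => sin (th beta t x) * f x)).
  by move=> cf; apply: fam_I01; apply: famM; [exact: fam_sin|exact: fam_x].
have dNu : dom (fun t => - u t).
  have := domMc _ (fun=> -1) du (@cts_cst _ _); congr dom.
  by apply/funext => t; rewrite mulN1r.
have [CM CM0 HCM] := cts_bnd _ cM; have [Cg Cg0 HCg] := cts_bnd _ cg.
have [Cs Cs0 HCs] := acf_bnd _ _ Hs.
pose L := CM * Cs + `|kap|.
have L0 : 0 <= L by rewrite addr_ge0// mulr_ge0.
have thL a b x : 0 <= a -> a <= b -> b <= T -> 0 < x < 1 ->
    `|th beta b x - th beta a x| <= L * dwt a b.
  move=> a0 ab bT /andP[x0 x1].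
  rewrite (_ : _ - _ = M x * (s b - s a) - kap * (b - a)); last by rewrite /th; ring.
  apply: (le_trans (ler_normB _ _)); rewrite !normrM mulrDl -mulrA lerD//.
    by apply: ler_pM => //; [apply: HCM; rewrite !ltW|exact: HCs].
  by rewrite ler_wpM2l// ger0_norm ?subr_ge0// dwt_ge.
have SL (f : R -> R) (Cf : R) a t b : continuous f -> (forall x, 0 <= x <= 1 -> `|f x| <= Cf) ->
   0 <= a -> a <= t -> t <= b -> b <= T ->
   `|I01 (fun x => sin (th beta t x) * f x) - I01 (fun x => sin (th beta a x) * f x)| <= L * dwt a b * Cf.
  move=> cf fC a0 at_ tb bT; have ct := cth t; have ca := cth a.
  rewrite -I01B; [|by cts|by cts].
  rewrite (_ : I01 _ = I01 (fun x => (sin (th beta t x) - sin (th beta a x)) * f x)); last first.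
    by apply: I01_ext => x _; ring.
  apply: I01_bndb => //; first by cts.
  move=> x xx; apply: (le_trans (sin_lip _ _)); apply: (le_trans (thL _ _ _ a0 at_ (le_trans tb bT) xx)).
  by rewrite ler_wpM2l//; exact: dwt_mono.
have cI1 := cS _ cMg; have cI2 := cS _ cg.
have [D1 D10 HD1] := dom_int_bnd _ dNu.
have dal : dom (fun t => I01 (fun x => sin (th beta t x) * (M x * g x)) * (- u t)
                + kap * I01 (fun x => sin (th beta t x) * g x)).
  by apply: domD; [exact: domMc|apply: dom_cts; cts].
apply: (acf_quad _ _ (2 * L ^+ 2 * Cg + D1 * (L * (CM * Cg)) + `|kap| * (L * Cg))) => //.
  by rewrite !addr_ge0// !mulr_ge0.
move=> a b a0 ab bT; have m0 := dwt_ge0 a b; have aT := le_trans ab bT.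
have ctb := cth b; have cta := cth a.
pose S1 t := I01 (fun x => sin (th beta t x) * (M x * g x)).
pose S2 t := I01 (fun x => sin (th beta t x) * g x).
have i1 : intg `[a, b] (fun t => (S1 t - S1 a) * (- u t)).
  by apply: dom_intg => //; apply: domMc => //; rewrite /S1; cts.
have i2 : intg `[a, b] (fun t => kap * (S2 t - S2 a)).
  by apply: intg_cts; rewrite /S2; cts.
have iu : intg `[a, b] u by exact: dom_intg.
have i3 : intg `[a, b] (fun t => S1 a * (- u t)).
  by apply: intgZ => //; exact: intgN.
have i4 : intg `[a, b] (fun t => kap * S2 a) by apply: intg_cts; exact: cts_cst.
have E1 : \int[mu]_(t in `[a, b]) (S1 t * (- u t) + kap * S2 t) =
   \int[mu]_(t in `[a, b]) ((S1 t - S1 a) * (- u t)) + \int[mu]_(t in `[a, b]) (kap * (S2 t - S2 a))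
   - S1 a * (s b - s a) + kap * S2 a * (b - a).
  have F1 : \int[mu]_(t in `[a, b]) (S1 a * (- u t)) = - (S1 a * (s b - s a)).
    rewrite RintegralZl//; last exact: intgN.
    by rewrite RintN// mulrN (acf_incr _ _ _ _ Hs).
  have F2 : \int[mu]_(t in `[a, b]) (kap * S2 a) = kap * S2 a * (b - a).
    by rewrite Rintegral_cst// mu_cc.
  have mI : measurable `[a, b] := measurable_itv _.
  have j12 := intgD mI i1 i2; have j123 := intgD mI j12 i3.
  rewrite -F1 -F2 -(RintD mI i1 i2) -(RintD mI j12 i3) -(RintD mI j123 i4).
  by apply: Rint_eq => t _; ring.
have E2 : I01 (fun x => cos (th beta b x) * g x) - I01 (fun x => cos (th beta a x) * g x)
  = I01 (fun x => (cos (th beta b x) - cos (th beta a x) + sin (th beta a x) * (th beta b x - th beta a x)) * g x)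
    - S1 a * (s b - s a) + kap * S2 a * (b - a).
  rewrite -I01B; [|by cts|by cts].
  rewrite (_ : S1 a * (s b - s a) = I01 (fun x => (s b - s a) * (sin (th beta a x) * (M x * g x)))); last first.
    by rewrite I01Z; [rewrite mulrC|cts].
  rewrite (_ : kap * S2 a * (b - a) = I01 (fun x => (kap * (b - a)) * (sin (th beta a x) * g x))); last first.
    by rewrite I01Z; [rewrite mulrAC|cts].
  rewrite -I01B; [|by cts|by cts].
  rewrite -I01D; [|by cts|by cts].
  apply: I01_ext => x _; rewrite /th; ring.
rewrite -/(S1) E1 E2.
have k1 : `|\int[mu]_(t in `[a, b]) ((S1 t - S1 a) * (- u t))| <= D1 * (L * dwt a b * (CM * Cg)) * dwt a b.
  apply: HD1 => //; first by rewrite /S1; cts.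
  move=> t /andP[at_ tb]; apply: SL => //.
  by move=> x x01; rewrite normrM; apply: ler_pM => //; [exact: HCM|exact: HCg].
have k2 : `|\int[mu]_(t in `[a, b]) (kap * (S2 t - S2 a))| <= `|kap| * (L * dwt a b * Cg) * dwt a b.
  apply: (@le_trans _ _ (`|kap| * (L * dwt a b * Cg) * (b - a))); last first.
    by rewrite ler_wpM2l ?dwt_ge// !mulr_ge0.
  apply: ler_abs_Rint => // t /andP[at_ tb]; rewrite normrM ler_wpM2l//.
  exact: SL.
have k3 : `|I01 (fun x => (cos (th beta b x) - cos (th beta a x) + sin (th beta a x) * (th beta b x - th beta a x)) * g x)| <= 2 * (L * dwt a b) ^+ 2 * Cg.
  apply: I01_bndb => //; first by cts.
  move=> x xx; apply: (le_trans (cos_taylor _ _)); rewrite ler_wpM2l//.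
  rewrite -[leLHS]real_normK ?num_real//; apply: lerXn2r; rewrite ?nnegrE ?mulr_ge0//.
  exact: thL.
move: k1 k2 k3; set J1 := Rintegral _ _ _; set J2 := Rintegral _ _ _; set J3 := I01 _ => k1 k2 k3.
rewrite (_ : _ - _ = J3 - J1 - J2); last by ring.
apply: (le_trans (ler_normB _ _)); apply: (le_trans (lerD (ler_normB _ _) (lexx _))).
move: (dwt a b) k1 k2 k3 => m k1 k2 k3; lra.
Qed.

Lemma acf_Isin beta (g : R -> R) : continuous g ->
  acf (fun t => I01 (fun x => sin (th beta t x) * g x))
      (fun t => I01 (fun x => cos (th beta t x) * (M x * g x)) * u t
                - kap * I01 (fun x => cos (th beta t x) * g x)).
Proof.
move=> cg.
have E (h : R -> R) t : I01 (fun x => sin (th (beta - pi / 2) t x) * h x) =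
    I01 (fun x => - (cos (th beta t x) * h x)).
  by apply: I01_ext => x _; rewrite /th addrA sinBpihalf mulNr.
have := acf_Icos (beta - pi / 2) _ cg; congr acf; apply/funext => t.
  by apply: I01_ext => x _; rewrite /th addrA cosBpihalf.
have cth := th_cts beta t.
by rewrite !E !I01N; [ring|cts|cts].
Qed.
End Phase.
End AC.

(** * The moment identity and the coercive quadratic term *)
Ltac pos := repeat first [ assumption | exact: ler0n | exact: ler01 | exact: normr_ge0 | exact: sqr_ge0
  | apply: addr_ge0 | apply: mulr_ge0 ].

Section Core.
Context {R : realType}.

(** Sum of the eight truncation errors in [galerkin]: [q] is their common rate, [w] stands for [|u|]
    and [l] for the eigenvalue. *)
Lemma ler_norm8 (q w l z1 z2 z3 z4 z5 z6 z7 z8 : R) : 0 <= q -> 0 <= w -> 0 <= l ->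
  `|z1| <= q -> `|z2| <= w * q -> `|z3| <= w * q -> `|z4| <= l * q ->
  `|z5| <= q -> `|z6| <= w * q -> `|z7| <= w * q -> `|z8| <= l * q ->
  `|z1 + z2 + z3 - z4 - z5 - z6 - z7 + z8| <= (1 + w) * (4 + 2 * l) * q.
Proof.
move=> q0 w0 l0 *; apply: (@le_trans _ _ (q + w * q + w * q + l * q + q + w * q + w * q + l * q)).
  by do 7 (apply: (le_trans (ler_normD _ _)); apply: lerD => //; rewrite ?normrN//).
rewrite -subr_ge0 (_ : _ - _ = 2 * q + 2 * (w * (l * q))); last by ring.
by rewrite addr_ge0// !mulr_ge0.
Qed.

Local Notation mu := (@lebesgue_measure R).
(** [a j] and [b j] are the real and imaginary parts of the sine coefficients of [psi], with [P] and
    [Q] the corresponding parts of [psi]. [Ha] and [Hb] are the Schroedinger equation tested against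
    [e_ j]. *)
Variables (T : R) (u M M1 M2 s : R -> R) (a b : nat -> R -> R) (B : R).
Hypotheses (T0 : 0 <= T) (Lu : L2 `[0, T] u).
Hypotheses (dM : has_deriv M M1) (dM1 : has_deriv M1 M2) (cM2 : continuous M2).
Hypothesis Hs : acf T u s u.
Hypotheses (ca : forall j, continuous (a j)) (cb : forall j, continuous (b j)).
Hypotheses (aB : forall t, decay (a^~ t) B) (bB : forall t, decay (b^~ t) B).
Hypotheses (a_0 : forall t, a 0 t = 0) (b_0 : forall t, b 0 t = 0).
Let P t := ssum (a^~ t).
Let Q t := ssum (b^~ t).
Hypothesis Ha : forall j, acf T u (a j)
  (fun t => lambda j * b j t - I01 (fun x => e_ j x * (M x * Q t x)) * u t).
Hypothesis Hb : forall j, acf T u (b j)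
  (fun t => - lambda j * a j t + I01 (fun x => e_ j x * (M x * P t x)) * u t).

Let cM : continuous M. Proof. exact: hder_cts dM. Qed.
Let cM1 : continuous M1. Proof. exact: hder_cts dM1. Qed.
Let cP t : continuous (P t). Proof. exact: ssum_cts (aB t). Qed.
Let cQ t : continuous (Q t). Proof. exact: ssum_cts (bB t). Qed.
Let cs : continuous s. Proof. by case: Hs. Qed.
Let fP : fam P. Proof. exact: fam_ssum aB. Qed.
Let fQ : fam Q. Proof. exact: fam_ssum bB. Qed.
Let B0 : 0 <= B. Proof. exact: decay_ge0 (aB 0). Qed.
Let Pb t x : `|P t x| <= 4 * B. Proof. exact: ssum_bnd (aB t). Qed.
Let Qb t x : `|Q t x| <= 4 * B. Proof. exact: ssum_bnd (bB t). Qed.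

(** * Truncation errors and conservation of mass *)

Lemma ssum_err (c : nat -> R) (C G : R) (g : R -> R) n : decay c C -> continuous g ->
  (forall x, 0 < x < 1 -> `|g x| <= G) ->
  `|I01 (fun x => ssum c x * g x) - \sum_(j < n) c j * I01 (fun x => e_ j x * g x)|
    <= 4 * C * G / n.+1%:R.
Proof.
move=> cC cg gG.
have G0 : 0 <= G by apply: le_trans (gG (1 / 2) _); rewrite ?normr_ge0//; lra.
apply: (le_trans (ssum_I01 _ _ n _ cC (L2_cts _ cg))).
rewrite mulrAC ler_wpM2r ?invr_ge0// ler_wpM2l ?mulr_ge0 ?(decay_ge0 _ _ cC)//.
apply: n2_le_bnd => //; [exact: mu_oo_fin|exact: mu01|exact: meas_cts].
Qed.

Lemma int_err (al be : R -> R) (K t : R) n : dom T u al -> dom T u be -> 0 <= t <= T -> 0 <= K ->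
  (forall r, 0 <= r <= T -> `|al r - be r| <= wt u r * (K / n.+1%:R)) ->
  `|\int[mu]_(r in `[0, t]) al r - \int[mu]_(r in `[0, t]) be r| <= K * dwt u 0 T / n.+1%:R.
Proof.
move=> da db /andP[t0 tT] K0 H.
have i1 := dom_intg _ _ Lu _ 0 t da (lexx 0) tT.
have i2 := dom_intg _ _ Lu _ 0 t db (lexx 0) tT.
have i3 := intg_wt _ _ Lu 0 t (lexx 0) tT.
rewrite -RintB//.
apply: (@le_trans _ _ (\int[mu]_(r in `[0, t]) (K / n.+1%:R * wt u r))).
  apply: Rint_bnd => //; [exact: intgB|exact: intgZ|].
  move=> r; rewrite /= in_itv/= => /andP[r0 rt]; rewrite mulrC; apply: H.
  by rewrite r0 (le_trans rt).
rewrite RintZ// mulrAC ler_wpM2r ?invr_ge0// ler_wpM2l//.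
by apply: dwt_mono => //.
Qed.

Lemma I01_sq_ssum (c : nat -> R) (C : R) n : decay c C -> c 0%N = 0 ->
  `|I01 (fun x => ssum c x ^+ 2) - \sum_(j < n) c j * c j| <= 4 * C * (4 * C) / n.+1%:R.
Proof.
move=> cC c0; have cc := ssum_cts _ _ cC.
have := ssum_err _ _ _ _ n cC cc (fun x _ => ssum_bnd _ _ x cC).
congr (`| _ - _ | <= _); apply: eq_bigr => j _.
have [->|j0] := posnP j; first by rewrite c0 !mul0r.
rewrite -{3}(ssum_coef _ _ _ cC j0); congr (_ * _); apply: I01_ext => x _; ring.
Qed.

(** In the derivative of the truncated mass the eigenvalue terms cancel mode by mode. The control
    leaves [2 u (S2 - S1)], where [S1] and [S2] are partial sums of the same pairing of [M], [P] and
    [Q], so that their difference is [O(1/n)]. *)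
Lemma mass_conserved t : 0 <= t <= T ->
  I01 (fun x => P t x ^+ 2 + Q t x ^+ 2) = I01 (fun x => P 0 x ^+ 2 + Q 0 x ^+ 2).
Proof.
move=> tT; have [CM CM0 HCM] := cts_bnd _ cM.
pose K := 16 * B * (CM * (4 * B)); have K0 : 0 <= K by rewrite !mulr_ge0.
pose nN n t := \sum_(j < n) (a j t * a j t + b j t * b j t).
have hN n r : `|I01 (fun x => P r x ^+ 2 + Q r x ^+ 2) - nN n r| <= 32 * B ^+ 2 / n.+1%:R.
  rewrite I01D; [|by have := cP r => h; cts|by have := cQ r => h; cts].
  rewrite /nN big_split /=.
  have h1 := I01_sq_ssum _ _ n (aB r) (a_0 r); have h2 := I01_sq_ssum _ _ n (bB r) (b_0 r).
  rewrite opprD addrACA; apply: (le_trans (ler_normD _ _)).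
  apply: (le_trans (lerD h1 h2)); rewrite -mulrDl ler_wpM2r ?invr_ge0//; lra.
have acN n := acf_sum _ _ T0 Lu n _ _ (fun j => acfD _ _ Lu _ _ _ _ (acfM _ _ T0 Lu _ _ _ _ (Ha j) (Ha j))
    (acfM _ _ T0 Lu _ _ _ _ (Hb j) (Hb j))).
have main n : `|nN n t - nN n 0| <= K * dwt u 0 T / n.+1%:R.
  have [_ dN] := acN n; move=> /(_ t tT); rewrite -/(nN n t) -/(nN n 0) => ->.
  have d0 : dom T u (fun=> 0) by apply: dom_cts => //; exact: cts_cst.
  have := int_err _ _ K t n dN d0 tT K0.
  rewrite Rintegral_cst// mul0r subr0 => H; rewrite addrAC subrr add0r; apply: H.
  move=> r rT; rewrite subr0.
  have cPr := cP r; have cQr := cQ r.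
  have cMP : continuous (fun x => M x * P r x) by cts.
  have cMQ : continuous (fun x => M x * Q r x) by cts.
  have bMP x : 0 < x < 1 -> `|M x * P r x| <= CM * (4 * B).
    by move=> /andP[x0 x1]; rewrite normrM; apply: ler_pM => //; apply: HCM; rewrite !ltW.
  have bMQ x : 0 < x < 1 -> `|M x * Q r x| <= CM * (4 * B).
    by move=> /andP[x0 x1]; rewrite normrM; apply: ler_pM => //; apply: HCM; rewrite !ltW.
  have h1 := ssum_err _ _ _ _ n (aB r) cMQ bMQ; have h2 := ssum_err _ _ _ _ n (bB r) cMP bMP.
  have E : I01 (fun x => ssum (a^~ r) x * (M x * Q r x)) = I01 (fun x => ssum (b^~ r) x * (M x * P r x)).
    by apply: I01_ext => x _; rewrite /P /Q; ring.
  rewrite E in h1.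
  set S1 := \sum_(j < n) a j r * _ in h1; set S2 := \sum_(j < n) b j r * _ in h2.
  rewrite (_ : \sum_(j < n) _ = 2 * u r * (S2 - S1)); last first.
    rewrite /S1 /S2 -sumrB mulr_sumr; apply: eq_bigr => j _; ring.
  rewrite normrM; have h3 : `|S2 - S1| <= 8 * B * (CM * (4 * B)) / n.+1%:R.
    set J := I01 _ in h1 h2; rewrite (_ : S2 - S1 = (J - S1) - (J - S2)); last by ring.
    apply: (le_trans (ler_normB _ _)); apply: (le_trans (lerD h1 h2)).
    rewrite -mulrDl ler_wpM2r ?invr_ge0//; lra.
  rewrite normrM ger0_norm// [2 * _]mulrC -mulrA; apply: ler_pM => //; first by rewrite /wt lerDr.
  rewrite /K; apply: (@le_trans _ _ (2 * (8 * B * (CM * (4 * B)) / n.+1%:R))); first by rewrite ler_wpM2l.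
  by rewrite mulrA ler_wpM2r ?invr_ge0//; lra.
apply: (@small_eq _ _ _ (32 * B ^+ 2 + K * dwt u 0 T + 32 * B ^+ 2)) => n.
have h1 := hN n t; have h2 := hN n 0; have h3 := main n.
set X := I01 _ in h1 *; set X0 := I01 _ in h2 *.
rewrite (_ : X - X0 = (X - nN n t) + (nN n t - nN n 0) - (X0 - nN n 0)); last by ring.
apply: (le_trans (ler_normB _ _)); apply: (le_trans (lerD (ler_normD _ _) (lexx _))).
by apply: (le_trans (lerD (lerD h1 h3) h2)); rewrite -!mulrDl.
Qed.

(** * The moment identity by truncation *)

Section Galerkin.
Variables (k : nat) (beta : R).
Let tht := th s M (lambda k) beta.
(* In the gauge [th] the control disappears: the time derivative [Yk] of [Xk]
   involves only its primitive [s]. *)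
Definition Fk (x : R) := 2 * M1 x * de_ k x + M2 x * e_ k x.
Definition Xk t := I01 (fun x => (P t x * cos (tht t x) + Q t x * sin (tht t x)) * e_ k x).
Definition Yk t := s t * I01 (fun x => Fk x * (P t x * cos (tht t x) + Q t x * sin (tht t x)))
  + s t ^+ 2 * I01 (fun x => M1 x ^+ 2 * e_ k x * (Q t x * cos (tht t x) - P t x * sin (tht t x))).

Let cth t : continuous (tht t). Proof. exact: th_cts. Qed.
Let fth : fam tht. Proof. exact: (fam_th _ _ _ _ _ Hs cM). Qed.
Let cF : continuous Fk. Proof. by rewrite /Fk; cts. Qed.

Lemma Yk_cts : continuous Yk.
Proof.
have c1 : continuous (fun t => I01 (fun x => Fk x * (P t x * cos (tht t x) + Q t x * sin (tht t x)))).
  by apply: fam_I01; fam.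
have c2 : continuous (fun t => I01 (fun x => M1 x ^+ 2 * e_ k x * (Q t x * cos (tht t x) - P t x * sin (tht t x)))).
  by apply: fam_I01; fam.
by rewrite /Yk; cts.
Qed.

Let hth t : has_deriv (tht t) (fun x => s t * M1 x).
Proof.
have := hderD (hderZ (s t) dM) (hder_cst (- (lambda k * t) + beta)).
rewrite /has_deriv => H x; have := H x; rewrite addr0; congr is_derive.
by apply/funext => y; rewrite /tht /th addrA.
Qed.

(** [w1 + i w2] is the test function [exp(i th) e_k]. It vanishes at 0 and 1 because [e_k] does, so
    Green's formula applies to it; [w1''] and [w2''] sort its second derivative by powers of [s]. *)
Let w1 t x := cos (tht t x) * e_ k x.
Let w2 t x := sin (tht t x) * e_ k x.
Let w1' t x := - sin (tht t x) * (s t * M1 x) * e_ k x + cos (tht t x) * de_ k x.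
Let w2' t x := cos (tht t x) * (s t * M1 x) * e_ k x + sin (tht t x) * de_ k x.
Let w1'' t x := - s t * sin (tht t x) * Fk x - s t ^+ 2 * cos (tht t x) * (M1 x ^+ 2 * e_ k x)
  - lambda k * w1 t x.
Let w2'' t x := s t * cos (tht t x) * Fk x - s t ^+ 2 * sin (tht t x) * (M1 x ^+ 2 * e_ k x)
  - lambda k * w2 t x.

Let dw1 t : has_deriv (w1 t) (w1' t).
Proof. exact: hderM (hder_comp (@hder_cos R) (hth t)) (hder_e k). Qed.

Let dw2 t : has_deriv (w2 t) (w2' t).
Proof. exact: hderM (hder_comp (@hder_sin R) (hth t)) (hder_e k). Qed.

Let dw1' t : has_deriv (w1' t) (w1'' t).
Proof.
apply: (hder_eq _ (hderD (hderM (hderM (hderN (hder_comp (@hder_sin R) (hth t))) (hderZ (s t) dM1)) (hder_e k))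
  (hderM (hder_comp (@hder_cos R) (hth t)) (hder_de k)))) => x.
by rewrite /w1'' /w1 /Fk; ring.
Qed.

Let dw2' t : has_deriv (w2' t) (w2'' t).
Proof.
apply: (hder_eq _ (hderD (hderM (hderM (hder_comp (@hder_cos R) (hth t)) (hderZ (s t) dM1)) (hder_e k))
  (hderM (hder_comp (@hder_sin R) (hth t)) (hder_de k)))) => x.
by rewrite /w2'' /w2 /Fk; ring.
Qed.

Let cw1 t : continuous (w1 t). Proof. exact: hder_cts (dw1 t). Qed.
Let cw2 t : continuous (w2 t). Proof. exact: hder_cts (dw2 t). Qed.

Let cw1'' t : continuous (w1'' t).
Proof. by have h1 := cth t; have h2 := cw1 t; rewrite /w1''; cts. Qed.

Let cw2'' t : continuous (w2'' t).
Proof. by have h1 := cth t; have h2 := cw2 t; rewrite /w2''; cts. Qed.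

Let w1b t x : `|w1 t x| <= 2.
Proof.
rewrite normrM -[leRHS]mul1r; apply: ler_pM => //; [exact: abs_cos_le1|exact: e_bnd].
Qed.

Let w2b t x : `|w2 t x| <= 2.
Proof.
rewrite normrM -[leRHS]mul1r; apply: ler_pM => //; [exact: abs_sin_le1|exact: e_bnd].
Qed.

Let w''b : exists2 C, 0 <= C & forall t, 0 <= t <= T -> forall x, 0 < x < 1 ->
  `|w1'' t x| <= C /\ `|w2'' t x| <= C.
Proof.
have [S S0 HS] := cts_bnd_itv _ T0 _ cs; have [F F0 HF] := cts_bnd _ cF.
have [D D0 HD] : exists2 D, 0 <= D & forall x, 0 <= x <= 1 -> `|M1 x ^+ 2 * e_ k x| <= D.
  by apply: cts_bnd; cts.
have L0 := @lambda_ge0 R k.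
exists (S * F + S ^+ 2 * D + lambda k * 2).
  by pos.
move=> t tT x /andP[x0 x1]; have xx : 0 <= x <= 1 by rewrite !ltW.
have Hst := HS t tT; have HFx := HF x xx; have HDx := HD x xx.
have gen (v c d : R) : `|v| <= 2 -> `|c| <= 1 -> `|d| <= 1 ->
   `|s t * c * Fk x - s t ^+ 2 * d * (M1 x ^+ 2 * e_ k x) - lambda k * v| <= S * F + S ^+ 2 * D + lambda k * 2.
  move=> v2 c1 d1; apply: (le_trans (ler_normB _ _)); apply: lerD; last first.
    by rewrite normrM ger0_norm// ler_wpM2l.
  apply: (le_trans (ler_normB _ _)); apply: lerD.
    rewrite normrM; apply: ler_pM => //; rewrite normrM -[leRHS]mulr1; exact: ler_pM.
  rewrite normrM; apply: ler_pM => //; rewrite normrM -[leRHS]mulr1; apply: ler_pM => //.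
  by rewrite normrX; apply: lerXn2r.
split.
  rewrite (_ : w1'' t x = s t * (- sin (tht t x)) * Fk x - s t ^+ 2 * cos (tht t x) * (M1 x ^+ 2 * e_ k x)
    - lambda k * w1 t x); last by rewrite /w1''; ring.
  by apply: gen; [exact: w1b|rewrite normrN abs_sin_le1|exact: abs_cos_le1].
by apply: gen; [exact: w2b|exact: abs_cos_le1|exact: abs_sin_le1].
Qed.

(** The product rule is applied to the partial sums [XN n], whose terms are products of functions
    known to be absolutely continuous. Every term of the derivative is a partial sum of a pairing,
    and differs from the full pairing by [O(1/n)], up to a factor [|u|], thanks to the decay of the
    coefficients of one of the two factors. *)
Lemma galerkin t : 0 <= t <= T -> Xk t - Xk 0 = \int[mu]_(r in `[0, t]) Yk r.
Proof.
move=> tT; have [CM CM0 HCM] := cts_bnd _ cM; have [W W0 HW] := w''b.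
have L0 := @lambda_ge0 R k.
pose w1j j r := I01 (fun x => cos (tht r x) * (e_ k x * e_ j x)).
pose w2j j r := I01 (fun x => sin (tht r x) * (e_ k x * e_ j x)).
have w1jE j r : w1j j r = I01 (fun x => w1 r x * e_ j x) by apply: I01_ext => x _; rewrite /w1; ring.
have w2jE j r : w2j j r = I01 (fun x => w2 r x * e_ j x) by apply: I01_ext => x _; rewrite /w2; ring.
pose XN n r := \sum_(j < n) (a j r * w1j j r + b j r * w2j j r).
have cke j : continuous (fun x : R => e_ k x * e_ j x) by cts.
have ac1 j := acf_Icos _ _ T0 Lu _ _ (lambda k) Hs cM beta _ (cke j).
have ac2 j := acf_Isin _ _ T0 Lu _ _ (lambda k) Hs cM beta _ (cke j).
have acX n := acf_sum _ _ T0 Lu n _ _ (fun j => acfD _ _ Lu _ _ _ _ (acfM _ _ T0 Lu _ _ _ _ (Ha j) (ac1 j))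
    (acfM _ _ T0 Lu _ _ _ _ (Hb j) (ac2 j))).
have XNX n r : `|Xk r - XN n r| <= 2 * (4 * B * 2) / n.+1%:R.
  have cPr := cP r; have cQr := cQ r; have c1 := cw1 r; have c2 := cw2 r.
  have h1 := ssum_err _ _ _ _ n (aB r) c1 (fun x _ => w1b r x).
  have h2 := ssum_err _ _ _ _ n (bB r) c2 (fun x _ => w2b r x).
  rewrite (_ : Xk r = I01 (fun x => P r x * w1 r x) + I01 (fun x => Q r x * w2 r x)); last first.
    rewrite -I01D; [|by cts|by cts].
    by apply: I01_ext => x _; rewrite /w1 /w2; ring.
  rewrite /XN big_split /= opprD addrACA; apply: (le_trans (ler_normD _ _)).
  rewrite -mulrA mulrDl mul1r; apply: lerD.
    move: h1; congr (`| _ - _ | <= _); apply: eq_bigr => j _; rewrite w1jE; congr (_ * _).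
    by apply: I01_ext => x _; rewrite mulrC.
  move: h2; congr (`| _ - _ | <= _); apply: eq_bigr => j _; rewrite w2jE; congr (_ * _).
  by apply: I01_ext => x _; rewrite mulrC.
(* Each of the four summands bounds two of the eight truncation errors, so [E] serves for all of
   them. *)
pose E := 4 * B * W + 4 * B * (CM * 2) + 4 * (2 * W) * (CM * (4 * B)) + 4 * B * 2.
have p1 : 0 <= 4 * B * W by pos.
have p2 : 0 <= 4 * B * (CM * 2) by pos.
have p3 : 0 <= 4 * (2 * W) * (CM * (4 * B)) by pos.
have p4 : 0 <= 4 * B * 2 by pos.
have E0 : 0 <= E by rewrite /E; lra.
have E1 : 4 * B * W <= E by rewrite /E; lra.
have E2 : 4 * B * (CM * 2) <= E by rewrite /E; lra.
have E3 : 4 * (2 * W) * (CM * (4 * B)) <= E by rewrite /E; lra.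
have E4 : 4 * B * 2 <= E by rewrite /E; lra.
pose K := (4 + 2 * lambda k) * E.
have K0 : 0 <= K by rewrite /K; pos.
have main n : `|XN n t - XN n 0 - \int[mu]_(r in `[0, t]) Yk r| <= K * dwt u 0 T / n.+1%:R.
  have [_ dN] := acX n; move=> /(_ t tT); rewrite -/(XN n t) -/(XN n 0) => ->.
  have dY : dom T u Yk by apply: dom_cts => //; exact: Yk_cts.
  rewrite [XN n 0 + _]addrC addrK; apply: (int_err _ _ K t n dN dY tT K0).
  move=> r rT.
  have cPr := cP r; have cQr := cQ r; have c1 := cw1 r; have c2 := cw2 r.
  have d1 := cw1'' r; have d2 := cw2'' r; have cthr := cth r.
  have weak (C G : R) (c : nat -> R) (g : R -> R) : decay c C -> continuous g ->
     (forall x, 0 < x < 1 -> `|g x| <= G) -> 4 * C * G <= E ->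
     `|I01 (fun x => ssum c x * g x) - \sum_(j < n) c j * I01 (fun x => e_ j x * g x)| <= E / n.+1%:R.
    move=> h1 h2 h3 h4; apply: (le_trans (ssum_err _ _ _ _ n h1 h2 h3)).
    by rewrite ler_wpM2r ?invr_ge0.
  have xx01 x : 0 < x < 1 -> 0 <= x <= 1 by move=> /andP[x0 x1]; rewrite !ltW.
  have bM (G : R) (g : R -> R) : (forall x, `|g x| <= G) -> forall x, 0 < x < 1 -> `|M x * g x| <= CM * G.
    by move=> gG x xx; rewrite normrM; apply: ler_pM => //; apply: HCM; exact: xx01.
  have cMw1 : continuous (fun x => M x * w1 r x) by cts.
  have cMw2 : continuous (fun x => M x * w2 r x) by cts.
  have cMP : continuous (fun x => M x * P r x) by cts.
  have cMQ : continuous (fun x => M x * Q r x) by cts.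
  have h1 := weak _ _ _ _ (bB r) d1 (fun x xx => (HW r rT x xx).1) E1.
  have h5 := weak _ _ _ _ (aB r) d2 (fun x xx => (HW r rT x xx).2) E1.
  have h3 := weak _ _ _ _ (aB r) cMw2 (bM _ _ (w2b r)) E2.
  have h7 := weak _ _ _ _ (bB r) cMw1 (bM _ _ (w1b r)) E2.
  have h4 := weak _ _ _ _ (aB r) c2 (fun x _ => w2b r x) E4.
  have h8 := weak _ _ _ _ (bB r) c1 (fun x _ => w1b r x) E4.
  have z10 : w1 r 0 = 0 by rewrite /w1 e_0 mulr0.
  have z11 : w1 r 1 = 0 by rewrite /w1 e_1 mulr0.
  have z20 : w2 r 0 = 0 by rewrite /w2 e_0 mulr0.
  have z21 : w2 r 1 = 0 by rewrite /w2 e_1 mulr0.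
  have D1 := coef_decay _ _ _ _ (dw1 r) (dw1' r) d1 z10 z11 (fun x xx => (HW r rT x xx).1).
  have D2 := coef_decay _ _ _ _ (dw2 r) (dw2' r) d2 z20 z21 (fun x xx => (HW r rT x xx).2).
  have S1 := coef_ssum _ _ _ _ (dw1 r) (dw1' r) d1 z10 z11 (fun x xx => (HW r rT x xx).1).
  have S2 := coef_ssum _ _ _ _ (dw2 r) (dw2' r) d2 z20 z21 (fun x xx => (HW r rT x xx).2).
  have h2 := weak _ _ _ _ D1 cMQ (bM _ _ (Qb r)) E3.
  have h6 := weak _ _ _ _ D2 cMP (bM _ _ (Pb r)) E3.
  have G1 j := I01_green _ _ _ j (dw1 r) (dw1' r) d1 z10 z11.
  have G2 j := I01_green _ _ _ j (dw2 r) (dw2' r) d2 z20 z21.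
  set s1 := \sum_(j < n) _ in h1; set s2 := \sum_(j < n) _ in h2; set s3 := \sum_(j < n) _ in h3.
  set s4 := \sum_(j < n) _ in h4; set s5 := \sum_(j < n) _ in h5; set s6 := \sum_(j < n) _ in h6.
  set s7 := \sum_(j < n) _ in h7; set s8 := \sum_(j < n) _ in h8.
  rewrite (_ : \sum_(j < n) _ = - s1 - u r * s2 - u r * s3 + lambda k * s4 + s5 + u r * s6 + u r * s7 - lambda k * s8); last first.
    rewrite /s1 /s2 /s3 /s4 /s5 /s6 /s7 /s8 !mulr_sumr -!sumrN -!big_split /=.
    apply: eq_bigr => j _.
    have -> : I01 (fun x => e_ j x * w1'' r x) = - lambda j * w1j j r.
      by rewrite w1jE -G1; apply: I01_ext => x _; ring.
    have -> : I01 (fun x => e_ j x * w2'' r x) = - lambda j * w2j j r.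
      by rewrite w2jE -G2; apply: I01_ext => x _; ring.
    rewrite -w1jE -w2jE -/(w1j j r) -/(w2j j r).
    have -> : I01 (fun x => e_ j x * w2 r x) = w2j j r by rewrite w2jE; apply: I01_ext => x _; ring.
    have -> : I01 (fun x => e_ j x * w1 r x) = w1j j r by rewrite w1jE; apply: I01_ext => x _; ring.
    have -> : I01 (fun x => sin (th s M (lambda k) beta r x) * (M x * (e_ k x * e_ j x))) = I01 (fun x => e_ j x * (M x * w2 r x)).
      by apply: I01_ext => x _; rewrite /w2 /tht; ring.
    have -> : I01 (fun x => cos (th s M (lambda k) beta r x) * (M x * (e_ k x * e_ j x))) = I01 (fun x => e_ j x * (M x * w1 r x)).
      by apply: I01_ext => x _; rewrite /w1 /tht; ring.
    rewrite -/tht -/(w1j j r) -/(w2j j r); ring.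
  set J1 := I01 _ in h1; set J2 := I01 _ in h2; set J3 := I01 _ in h3; set J4 := I01 _ in h4.
  set J5 := I01 _ in h5; set J6 := I01 _ in h6; set J7 := I01 _ in h7; set J8 := I01 _ in h8.
  (* In the limit the four terms with [u] cancel in pairs, [J2 = J7] and [J6 = J3], since [w1] and
     [w2] are the sums of their sine series. The terms [lambda k * J4] and [lambda k * J8] cancel
     the multiples of [w2] and [w1] contained in [w2''] and [w1'']; what remains is [Yk]. *)
  have EY : Yk r = - J1 - u r * J2 - u r * J3 + lambda k * J4 + J5 + u r * J6 + u r * J7 - lambda k * J8.
    have e27 : J2 = J7.
      by apply: I01_ext => x xx; rewrite -S1//; rewrite /Q; ring.
    have e36 : J6 = J3.
      by apply: I01_ext => x xx; rewrite -S2//; rewrite /P; ring.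
    rewrite e27 e36.
    have -> : Yk r = - J1 + J5 + lambda k * (J4 - J8); last by ring.
    rewrite /Yk -!I01Z; [|by cts|by cts].
    rewrite /J1 /J5 /J4 /J8 -!I01B; [|by rewrite -/(P r) -/(Q r); cts|by rewrite -/(P r) -/(Q r); cts].
    rewrite -I01Z; last by rewrite -/(P r) -/(Q r); cts.
    rewrite -I01N; last by rewrite -/(Q r); cts.
    rewrite -!I01D; [|by rewrite -/(P r) -/(Q r); cts..].
    apply: I01_ext => x _; rewrite -/(P r x) -/(Q r x) /w1'' /w2'' /w1 /w2; ring.
  rewrite EY.
  set q := E / n.+1%:R in h1 h2 h3 h4 h5 h6 h7 h8.
  have q0 : 0 <= q by rewrite divr_ge0.
  rewrite [X in `|X|](_ : _ = (J1 - s1) + u r * (J2 - s2) + u r * (J3 - s3) - lambda k * (J4 - s4) - (J5 - s5)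
     - u r * (J6 - s6) - u r * (J7 - s7) + lambda k * (J8 - s8)); last by ring.
  have um (z : R) : `|z| <= q -> `|u r * z| <= `|u r| * q by move=> zq; rewrite normrM ler_wpM2l.
  have lm (z : R) : `|z| <= q -> `|lambda k * z| <= lambda k * q.
    by move=> zq; rewrite normrM ger0_norm// ler_wpM2l.
  move/um: h2 => h2; move/um: h3 => h3; move/um: h6 => h6; move/um: h7 => h7.
  move/lm: h4 => h4; move/lm: h8 => h8.
  have -> : wt u r * (K / n.+1%:R) = (1 + `|u r|) * (4 + 2 * lambda k) * q.
    by rewrite /wt /K /q; ring.
  exact: (ler_norm8 _ _ _ _ _ _ _ _ _ _ _ q0 (normr_ge0 _) (lambda_ge0 _) h1 h2 h3 h4 h5 h6 h7 h8).
apply: (@small_eq _ _ _ (2 * (4 * B * 2) + K * dwt u 0 T + 2 * (4 * B * 2))) => n.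
have h1 := XNX n t; have h2 := XNX n 0; have h3 := main n.
set Y := Rintegral _ _ _ in h3 *.
rewrite (_ : _ - Y = (Xk t - XN n t) + (XN n t - XN n 0 - Y) - (Xk 0 - XN n 0)); last by ring.
apply: (le_trans (ler_normB _ _)); apply: (le_trans (lerD (ler_normD _ _) (lexx _))).
by apply: (le_trans (lerD (lerD h1 h3) h2)); rewrite -!mulrDl.
Qed.
End Galerkin.

(** * Distance of the solution to the gauged ground state *)

Section Estimate.
Variables (K : nat) (C : R).
Hypotheses (T1 : T <= 1) (s0 : s 0 = 0) (a0 : forall j, a j 0 = (j == 1%N)%:R) (b0 : forall j, b j 0 = 0).
Hypotheses (K0 : (0 < K)%N) (hK : I01 (fun x => M x * e_ 1 x * e_ K x) = 0).
Hypotheses (C1 : 1 <= C) (bM : forall x, 0 <= x <= 1 -> `|M x| <= C)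
  (bF1 : forall x, 0 <= x <= 1 -> `|Fk 1 x| <= C) (bFK : forall x, 0 <= x <= 1 -> `|Fk K x| <= C)
  (bM1 : forall x, 0 <= x <= 1 -> `|M1 x ^+ 2 * e_ 1 x| <= C)
  (bMK : forall x, 0 <= x <= 1 -> `|M1 x ^+ 2 * e_ K x| <= C).

Let th1 := th s M (lambda 1) 0.
(** With [dQ], the real and imaginary parts of [psi - exp(i th1) phi_1]. *)
Let dP t x := P t x - cos (th1 t x) * e_ 1 x.
Let dQ t x := Q t x - sin (th1 t x) * e_ 1 x.
Let sig2 := \int[mu]_(t in `[0, T]) (s t ^+ 2).
Let abss := \int[mu]_(t in `[0, T]) `|s t|.

Let C0 : 0 <= C. Proof. exact: le_trans C1. Qed.
Let cth1 t : continuous (th1 t). Proof. exact: th_cts. Qed.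
Let cFk k : continuous (Fk k). Proof. by rewrite /Fk; cts. Qed.
Let cdP t : continuous (dP t). Proof. by have h := cth1 t; rewrite /dP; cts. Qed.
Let cdQ t : continuous (dQ t). Proof. by have h := cth1 t; rewrite /dQ; cts. Qed.

Lemma I01_CS (f g : R -> R) (D : R) : 0 <= D -> continuous f -> continuous g ->
  (forall x, 0 <= x <= 1 -> `|f x| <= D) -> `|I01 (fun x => f x * g x)| <= D * n2 `]0, 1[ g.
Proof.
move=> D0 cf cg fD; apply: CSb => //; [exact: mu_oo_fin|exact: mu01|exact: meas_cts|exact: L2_cts|].
by move=> x; rewrite /= in_itv/= => /andP[x0 x1]; apply: fD; rewrite !ltW.
Qed.

Let P0 x : P 0 x = e_ 1 x.
Proof.
apply: (@small_eq _ _ _ (4 * B)) => n.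
have := ssum_tail _ _ n.+2 x (aB 0).
rewrite (_ : psum (a^~ 0) n.+2 x = e_ 1 x); last first.
  rewrite /psum (bigD1 (Ordinal (isT : (1 < n.+2)%N)))//= a0 mul1r big1 ?addr0// => i i1.
  rewrite a0 (_ : (i == 1%N :> nat) = false) ?mul0r//.
  by apply: negbTE; apply: contra i1 => /eqP i1; apply/eqP/val_inj.
move=> /le_trans; apply.
by rewrite ler_wpM2l ?mulr_ge0// lef_pV2 ?posrE ?ltr0n// ler_nat ltnS -addn2 leq_addr.
Qed.

Let Q0 x : Q 0 x = 0.
Proof.
apply: (@small_eq _ _ _ (4 * B)) => n.
apply: le_trans (ssum_tail _ _ n x (bB 0)).
by rewrite /psum big1// => i _; rewrite b0 mul0r.
Qed.

Let mass t : 0 <= t <= T -> I01 (fun x => P t x ^+ 2 + Q t x ^+ 2) = 1.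
Proof.
move=> tT; rewrite mass_conserved//= -(@e_norm R 1)//.
by apply: I01_ext => x _; rewrite -/(P 0 x) -/(Q 0 x) P0 Q0; ring.
Qed.

Let nP t : 0 <= t <= T -> n2 `]0, 1[ (P t) <= 1.
Proof.
move=> tT; rewrite -ler_sqr ?nnegrE ?n2_ge0// n2_sq expr1n -[leRHS](mass _ tT).
have h1 := cP t; have h2 := cQ t.
by apply: I01_le; [cts|cts|move=> x _; rewrite lerDl sqr_ge0].
Qed.

Let nQ t : 0 <= t <= T -> n2 `]0, 1[ (Q t) <= 1.
Proof.
move=> tT; rewrite -ler_sqr ?nnegrE ?n2_ge0// n2_sq expr1n -[leRHS](mass _ tT).
have h1 := cP t; have h2 := cQ t.
by apply: I01_le; [cts|cts|move=> x _; rewrite lerDr sqr_ge0].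
Qed.

(* [int_0^1 e_1 (2 M' e_k' + M'' e_k) = (lambda_k - lambda_1) int_0^1 M e_1 e_k] *)
Lemma F_ortho k : I01 (fun x => M x * e_ 1 x * e_ k x) = 0 \/ k = 1%N ->
  I01 (fun x => Fk k x * e_ 1 x) = 0.
Proof.
move=> hk.
have dG : has_deriv (fun x => M1 x * (e_ 1 x * e_ k x) + M x * (e_ 1 x * de_ k x - de_ 1 x * e_ k x))
    (fun x => Fk k x * e_ 1 x - (lambda k - lambda 1) * (M x * e_ 1 x * e_ k x)).
  apply: (hder_eq _ (hderD (hderM dM1 (hderM (hder_e 1) (hder_e k)))
    (hderM dM (hderB (hderM (hder_e 1) (hder_de k)) (hderM (hder_de 1) (hder_e k)))))) => x.
  by rewrite /Fk; ring.
have cf := cFk k.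
have := I01_ftc _ _ dG ltac:(cts); rewrite !e_0 !e_1 !mul0r !mulr0 subrr !mulr0 addr0 subrr.
rewrite I01B; [|by cts|by cts].
rewrite I01Z; last by cts.
by case: hk => [->|->]; rewrite ?mulr0 ?subrr ?mul0r subr0.
Qed.

Let En t := I01 (fun x => dP t x ^+ 2 + dQ t x ^+ 2).

(** By conservation of mass both functions have norm one, so their squared distance is read off
    [Xk 1 0], which [galerkin] controls. *)
Let EnE t : 0 <= t <= T -> En t = 2 - 2 * Xk 1 0 t.
Proof.
move=> tT; have h1 := cth1 t; have h2 := cP t; have h3 := cQ t.
transitivity (I01 (fun x => (P t x ^+ 2 + Q t x ^+ 2) + e_ 1 x * e_ 1 x -
    2 * ((P t x * cos (th1 t x) + Q t x * sin (th1 t x)) * e_ 1 x))).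
  apply: I01_ext => x _; rewrite /dP /dQ.
  have := cos2Dsin2 (th1 t x); set c := cos _; set d := sin _ => cd.
  transitivity ((P t x ^+ 2 + Q t x ^+ 2) + (c ^+ 2 + d ^+ 2) * (e_ 1 x * e_ 1 x) -
    2 * ((P t x * c + Q t x * d) * e_ 1 x)); first by ring.
  by rewrite cd mul1r.
rewrite I01B; [|by cts|by cts].
rewrite I01D; [|by cts|by cts].
rewrite I01Z; last by cts.
by rewrite mass// e_norm.
Qed.

Let ndP t : n2 `]0, 1[ (dP t) <= Num.sqrt (En t).
Proof.
apply: ler_wsqrtr; have h1 := cdP t; have h2 := cdQ t.
by apply: I01_le; [cts|cts|move=> x _; rewrite lerDl sqr_ge0].
Qed.

Let ndQ t : n2 `]0, 1[ (dQ t) <= Num.sqrt (En t).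
Proof.
apply: ler_wsqrtr; have h1 := cdP t; have h2 := cdQ t.
by apply: I01_le; [cts|cts|move=> x _; rewrite lerDr sqr_ge0].
Qed.

Let rot_bnd (F f g c d : R -> R) (q : R) : continuous F -> continuous f -> continuous g ->
  continuous c -> continuous d -> (forall x, 0 <= x <= 1 -> `|F x| <= C) ->
  (forall x, `|c x| <= 1) -> (forall x, `|d x| <= 1) ->
  n2 `]0, 1[ f <= q -> n2 `]0, 1[ g <= q ->
  `|I01 (fun x => F x * (f x * c x + g x * d x))| <= 2 * C * q.
Proof.
move=> cF cf cg cc cd FC c1 d1 fq gq.
rewrite (_ : I01 _ = I01 (fun x => (F x * c x) * f x) + I01 (fun x => (F x * d x) * g x)); last first.
  by rewrite -I01D; [apply: I01_ext => x _; ring|cts|cts].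
have H (h e : R -> R) : continuous h -> continuous e -> (forall x, `|e x| <= 1) -> n2 `]0, 1[ h <= q ->
    `|I01 (fun x => (F x * e x) * h x)| <= C * q.
  move=> ch ce e1 hq; apply: le_trans (I01_CS _ _ C C0 _ ch _) _; first by cts.
    by move=> x xx; rewrite normrM -[leRHS]mulr1; apply: ler_pM => //; exact: FC.
  by rewrite ler_wpM2l.
apply: (le_trans (ler_normD _ _)); have := H _ _ cf cc c1 fq; have := H _ _ cg cd d1 gq; lra.
Qed.

Let is1 t1 : intg `[0, t1] (fun t => `|s t|). Proof. by apply: intg_cts; cts. Qed.
Let is2 t1 : intg `[0, t1] (fun t => s t ^+ 2). Proof. by apply: intg_cts; cts. Qed.
Let mono (f : R -> R) t : continuous f -> (forall x, 0 <= f x) -> 0 <= t <= T ->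
  \int[mu]_(r in `[0, t]) f r <= \int[mu]_(r in `[0, T]) f r.
Proof.
move=> cf f0 /andP[t0 tT]; rewrite (@Rint_split _ f 0 t T)//; last exact: intg_cts.
by rewrite lerDl; apply: Rintegral_ge0.
Qed.

Let sig2_ge0 : 0 <= sig2. Proof. by apply: Rintegral_ge0 => x _; exact: sqr_ge0. Qed.
Let sig := Num.sqrt sig2.
Let sigE : sig ^+ 2 = sig2. Proof. exact: sqr_sqrtr. Qed.

(** [tau] plays the role of [sqrt T]: here short times make the linear terms small compared with
    [sigma^2]. *)
Lemma abss_le (tau : R) : 0 <= tau -> T <= tau ^+ 2 -> abss <= tau * sig.
Proof.
move=> tau0 Ttau; rewrite -ler_sqr ?nnegrE ?mulr_ge0 ?sqrtr_ge0//; last exact: Rintegral_ge0.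
have L1 : L2 `[0, T] (fun=> 1 : R).
  by apply: (L2_bnd (C := 1)) => //; [exact: mu_cc_fin|move=> x _; rewrite normr1].
have Ls : L2 `[0, T] (fun t => `|s t|).
  split; first by apply: meas_cts => //; cts.
  by apply: intg_cts; cts.
have := CS (measurable_itv _) L1 Ls.
rewrite (_ : \int[mu]_(x in `[0, T]) (1 * `|s x|) = abss); last by apply: Rint_eq => x _; rewrite mul1r.
move/le_trans; apply; rewrite Rintegral_cst// mu_cc// subr0 expr1n mul1r exprMn sigE.
rewrite (_ : \int[mu]_(x in `[0, T]) (`|s x| ^+ 2) = sig2); first by rewrite ler_wpM2r.
by apply: Rint_eq => x _; rewrite real_normK// num_real.
Qed.

(** If [q > 5 c g], then also [q > (4 c + 1) g], because [c >= 1]; multiplying by [q] and using this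
    bound once more for the extra [g q] contradicts the hypothesis. *)
Lemma quad_absorb (c q g : R) : 1 <= c -> 0 <= g -> 0 <= q ->
  q ^+ 2 <= 4 * c * q * g + 4 * c * g ^+ 2 -> q <= 5 * c * g.
Proof.
move=> c1 g0 q0 H; rewrite leNgt; apply/negP => H1.
have g2 : (4 * c + 1) * g <= 5 * c * g by rewrite ler_wpM2r//; lra.
have q1 : 0 < q by apply: le_lt_trans H1; rewrite !mulr_ge0//; lra.
have H2 := le_lt_trans g2 H1.
have e1 : (4 * c + 1) * g * q < q * q by rewrite ltr_pM2r.
have e2 : g * ((4 * c + 1) * g) <= g * q by rewrite ler_wpM2l// ltW.
have e3 : 0 <= g * g by rewrite mulr_ge0.
lra.
Qed.

(** [q] is the square root of the maximum of [En] on [0, T]. The linear part of [Yk 1 0] is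
    [O(q |s|)] and the rest [O(s^2)], so the moment identity, taken at a point of maximum, becomes a
    quadratic inequality for [q] that [quad_absorb] resolves. *)
Lemma energy : exists2 q, 0 <= q <= 5 * C * sig &
  forall t, 0 <= t <= T -> n2 `]0, 1[ (dP t) <= q /\ n2 `]0, 1[ (dQ t) <= q.
Proof.
have cX : continuous (Xk 1 0).
  by apply: fam_I01; have fth := fam_th _ _ _ _ (lambda 1) Hs cM 0; fam.
have [m] := @EVT_max R (fun t => 2 - 2 * Xk 1 0 t) 0 T T0 ltac:(by apply: continuous_subspaceT; cts).
rewrite in_itv/= => mT Hm.
have Em t : 0 <= t <= T -> En t <= En m.
  by move=> tT; rewrite !EnE//; apply: Hm; rewrite in_itv.
have E0 t : 0 <= En t.
  by apply: Rintegral_ge0 => x _; rewrite addr_ge0// sqr_ge0.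
pose q := Num.sqrt (En m); have q0 : 0 <= q by exact: sqrtr_ge0.
have qE : q ^+ 2 = En m by exact: sqr_sqrtr.
have Eq t : 0 <= t <= T -> Num.sqrt (En t) <= q by move=> tT; apply: ler_wsqrtr; exact: Em.
exists q; last first.
  by move=> t tT; split; [apply: le_trans (ndP t) (Eq t tT)|apply: le_trans (ndQ t) (Eq t tT)].
rewrite q0 /=.
have X0 : Xk 1 0 0 = 1.
  rewrite /Xk -(@e_norm R 1)//; apply: I01_ext => x _.
  by rewrite -/(P 0 x) -/(Q 0 x) P0 Q0 /th s0 mul0r mulr0 subr0 addr0 cos0; ring.
have Yb t : 0 <= t <= T -> `|Yk 1 0 t| <= 2 * C * q * `|s t| + 2 * C * s t ^+ 2.
  move=> tT; rewrite /Yk -/th1; have h1 := cth1 t; have h2 := cdP t; have h3 := cdQ t.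
  have cFF := cFk 1; have h4 := cP t; have h5 := cQ t.
  (* By [F_ortho] the function [exp(i th1) phi_1] contributes nothing to the linear term, so [dP]
     and [dQ] may replace [P] and [Q]. *)
  rewrite (_ : I01 (fun x => Fk 1 x * _) = I01 (fun x => Fk 1 x * (dP t x * cos (th1 t x) + dQ t x * sin (th1 t x)))); last first.
    rewrite -[RHS]addr0 -(F_ortho 1 (or_intror erefl)) -I01D; [|by cts|by cts].
    apply: I01_ext => x _; rewrite -/(P t x) -/(Q t x) /dP /dQ.
    have := cos2Dsin2 (th1 t x); set c := cos _; set d := sin _ => cd.
    rewrite -{3}[Fk 1 x]mulr1 -cd; ring.
  have k1 := rot_bnd _ _ _ _ _ q cFF h2 h3 (cts_comp h1 (@cts_cos R)) (cts_comp h1 (@cts_sin R)) bF1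
    (fun x => abs_cos_le1 _) (fun x => abs_sin_le1 _) (le_trans (ndP t) (Eq t tT)) (le_trans (ndQ t) (Eq t tT)).
  have cG : continuous (fun x => M1 x ^+ 2 * e_ 1 x) by cts.
  have k2 := rot_bnd _ _ _ _ _ 1 cG h5 h4 (cts_comp h1 (@cts_cos R)) (ctsN (cts_comp h1 (@cts_sin R))) bM1
    (fun x => abs_cos_le1 _) (fun x => ltac:(by rewrite normrN abs_sin_le1)) (nQ t tT) (nP t tT).
  rewrite (_ : I01 (fun x => M1 x ^+ 2 * e_ 1 x * (Q t x * cos (th1 t x) + P t x * - sin (th1 t x))) =
    I01 (fun x => M1 x ^+ 2 * e_ 1 x * (ssum (b^~ t) x * cos (th1 t x) - ssum (a^~ t) x * sin (th1 t x)))) in k2; last first.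
    by apply: I01_ext => x _; rewrite /P /Q; ring.
  apply: (le_trans (ler_normD _ _)); rewrite !normrM mulr1 in k2 *; apply: lerD.
    by rewrite mulrC ler_wpM2r.
  by rewrite -normrM -expr2 ger0_norm ?sqr_ge0// mulrC ler_wpM2r ?sqr_ge0.
have main : q ^+ 2 <= 4 * C * q * sig + 4 * C * sig ^+ 2.
  rewrite qE EnE//.
  have := galerkin 1 0 m mT; rewrite X0 => G.
  rewrite (_ : _ - _ = - 2 * (Xk 1 0 m - 1)); last by ring.
  rewrite G; apply: (le_trans (ler_norm _)); rewrite normrM normrN (ger0_norm (ler0n _ 2)).
  have cY := Yk_cts 1 0.
  have : `|\int[mu]_(r in `[0, m]) Yk 1 0 r| <= \int[mu]_(r in `[0, m]) (2 * C * q * `|s r| + 2 * C * s r ^+ 2).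
    apply: Rint_bnd => //; [exact: intg_cts|by apply: intg_cts; cts|].
    move=> r; rewrite /= in_itv/= => /andP[r0 rm]; apply: Yb.
    by rewrite r0 (le_trans rm)//; case/andP: mT.
  have : \int[mu]_(r in `[0, m]) (2 * C * q * `|s r| + 2 * C * s r ^+ 2) <= 2 * C * q * sig + 2 * C * sig ^+ 2.
    apply: (@le_trans _ _ (\int[mu]_(r in `[0, T]) (2 * C * q * `|s r| + 2 * C * s r ^+ 2))).
      apply: mono => //; first by cts.
      by move=> r; pos.
    rewrite RintD//; [|by apply: intgZ|by apply: intgZ].
    rewrite RintZ// RintZ// sigE lerD// ler_wpM2l//; first by pos.
    rewrite -[leRHS]mul1r; apply: abss_le => //; by rewrite expr1n.
  lra.
have sg0 : 0 <= sig := sqrtr_ge0 _.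
exact: quad_absorb main.
Qed.

(** * Contradiction with the forbidden final state *)

Section Contradiction.
Variables (tau ep al de : R).
Let A := I01 (fun x => M1 x ^+ 2 * e_ K x * e_ 1 x).
Let kp := I01 (fun x => (M x * e_ 1 x) ^+ 2).
Let lamd := `|lambda K - lambda 1 : R|.
Hypotheses (tau0 : 0 <= tau) (Ttau : T <= tau ^+ 2) (Tlam : lamd * T <= 1 / 2).
Hypotheses (ep0 : 0 <= ep) (sep : forall t, 0 <= t <= T -> `|s t| <= ep).
Hypotheses (al1 : `|al| = 1) (alA : al * A = `|A|) (de01 : 0 < de <= 1).
Hypotheses (PT : forall x, 0 < x < 1 -> P T x = Num.sqrt (1 - de ^+ 2) * e_ 1 x * cos (lambda 1 * T)
    + al * de * e_ K x * sin (lambda 1 * T))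
  (QT : forall x, 0 < x < 1 -> Q T x = - (Num.sqrt (1 - de ^+ 2) * e_ 1 x * sin (lambda 1 * T))
    + al * de * e_ K x * cos (lambda 1 * T)).

Let TT : 0 <= T <= T. Proof. by rewrite T0 lexx. Qed.
Let sT := s T.

(** The quadratic bound suffices to estimate the phase in [phase_bnd]; [quad_id] uses the cubic one,
    where the error must be small compared with [sigma^2]. *)
Let sin_err (G : R -> R) (D : R) : continuous G -> 0 <= D -> (forall x, 0 <= x <= 1 -> `|G x| <= D) ->
  `|I01 (fun x => (sin (sT * M x) - sT * M x) * G x)| <= C ^+ 2 * `|sT| ^+ 2 * D
  /\ `|I01 (fun x => (sin (sT * M x) - sT * M x) * G x)| <= C ^+ 3 * `|sT| ^+ 3 * D.
Proof.
move=> cG D0 GD.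
have sM x : 0 < x < 1 -> `|sT * M x| <= C * `|sT|.
  by move=> /andP[x0 x1]; rewrite normrM mulrC ler_wpM2r// bM// !ltW.
split; apply: I01_bndb => //; try by cts.
- move=> x xx; apply: (le_trans (sin_sub2 _)); rewrite -exprMn -[leLHS]real_normK ?num_real//.
  by apply: lerXn2r; rewrite ?nnegrE ?mulr_ge0//; exact: sM.
- move=> x xx; apply: (le_trans (sin_sub _)); rewrite -exprMn.
  by apply: lerXn2r; rewrite ?nnegrE ?mulr_ge0//; exact: sM.
Qed.

Let e1eK (x : R) : `|e_ 1 x * e_ K x| <= 4.
Proof.
rewrite normrM (_ : 4 = 2 * 2 :> R); last by ring.
by apply: ler_pM => //; exact: e_bnd.
Qed.

Let hKs : I01 (fun x => sT * M x * (e_ 1 x * e_ K x)) = 0.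
Proof.
rewrite -[RHS](mulr0 sT) -hK -I01Z; last by cts.
by apply: I01_ext => x _; ring.
Qed.

(* The final phase shift [sT] is controlled by the energy: project the imaginary
   part of [psi(T) e^(i lambda_1 T) - e^(i sT M) e_1] on [M e_1]. *)
Let phase_bnd q : 0 <= q -> n2 `]0, 1[ (dP T) <= q -> n2 `]0, 1[ (dQ T) <= q ->
  `|sT| * kp <= 4 * C * q + 4 * C ^+ 3 * `|sT| ^+ 2.
Proof.
move=> q0 hP hQ; have h1 := cdP T; have h2 := cdQ T.
have cF : continuous (fun x => M x * (e_ 1 x / 2)) by cts.
have bF x : 0 <= x <= 1 -> `|M x * (e_ 1 x / 2)| <= C.
  move=> xx; rewrite normrM -[leRHS]mulr1; apply: ler_pM => //; first exact: bM.
  by rewrite normrM (ger0_norm (_ : 0 <= 2^-1 :> R))//; have := e_bnd 1 x; lra.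
have := rot_bnd _ _ _ (fun=> sin (lambda 1 * T)) (fun=> cos (lambda 1 * T)) q cF h1 h2
  (@cts_cst _ _) (@cts_cst _ _) bF (fun=> abs_sin_le1 _) (fun=> abs_cos_le1 _) hP hQ.
set J := I01 _ => hJ.
have cG : continuous (fun x => M x * (e_ 1 x * e_ 1 x)) by cts.
have [h3 _] := sin_err _ (4 * C) cG ltac:(by pos) ltac:(by move=> x xx; rewrite normrM mulrC normrM; apply: ler_pM => //;
  [rewrite (_ : 4 = 2 * 2 :> R); [by apply: ler_pM => //; exact: e_bnd|by ring]|exact: bM]).
set J2 := I01 _ in h3.
(* After rotation by [exp(i lambda_1 T)] the [e_1] part of the final state is real and drops out of
   the imaginary part; its [e_K] part is orthogonal to [M e_1] by [hK]. There remains
   [- sin (sT M) e_1], linearised up to [J2]. The factor 2 compensates the weight [e_1 / 2], halved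
   to be bounded by 1. *)
have E : 2 * J = - J2 - sT * kp.
  have <- : al * de * I01 (fun x => M x * e_ 1 x * e_ K x) - J2 - sT * kp = - J2 - sT * kp by rewrite hK; ring.
  rewrite /J /J2 /kp -!I01Z; [|by cts..].
  rewrite -!I01B; [|by cts..].
  apply: I01_ext => x xx; rewrite /dP /dQ PT// QT// /th1 /th -/sT addr0.
  set r := Num.sqrt _; set y := sT * M x; set l := lambda 1 * T.
  rewrite cosB sinB.
  have cd := cos2Dsin2 l.
  transitivity (M x * e_ 1 x * ((al * de * e_ K x - e_ 1 x * sin y) * (cos l ^+ 2 + sin l ^+ 2))); first by field.
  by rewrite cd /y; ring.
have kp0 : 0 <= kp by apply: Rintegral_ge0 => x _; exact: sqr_ge0.
have -> : `|sT| * kp = `|sT * kp| by rewrite normrM (ger0_norm kp0).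
rewrite (_ : sT * kp = - J2 - 2 * J); last by rewrite E; ring.
apply: (le_trans (ler_normB _ _)); rewrite normrN normrM (ger0_norm (ler0n _ 2)).
move: hJ h3; rewrite exprS; lra.
Qed.

(** At time [T] the phase for [k = K] becomes [s(T) M - lambda_1 T + pi / 2]: it undoes the factor
    [exp(- i lambda_1 T)] of the final state, and the quarter turn makes the real part of the
    pairing read the coefficient of [i phi_K]. *)
Let beta := (lambda K - lambda 1) * T + pi / 2.
Let gam t := (lambda K - lambda 1) * (T - t).

Let XK0 : Xk K beta 0 = 0.
Proof.
rewrite /Xk (_ : I01 _ = I01 (fun x => cos beta * (e_ 1 x * e_ K x))); last first.
  apply: I01_ext => x _; rewrite -/(P 0 x) -/(Q 0 x) P0 Q0 /th s0 mul0r mulr0 subr0 add0r; ring.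
rewrite I01Z; last by cts.
(* For [K = 1] there is no orthogonality to invoke, but then [beta = pi / 2] and its cosine
   vanishes. *)
have [K1|K1] := eqVneq 1%N K; last by rewrite e_orth ?mulr0.
by rewrite /beta -K1 subrr mul0r add0r cos_pihalf mul0r.
Qed.

Let XKT : Xk K beta T = al * de * I01 (fun x => cos (sT * M x) * (e_ K x * e_ K x))
  - Num.sqrt (1 - de ^+ 2) * I01 (fun x => sin (sT * M x) * (e_ 1 x * e_ K x)).
Proof.
rewrite -!I01Z; [|by cts..].
rewrite -I01B; [|by cts..].
apply: I01_ext => x xx; rewrite -/(P T x) -/(Q T x) PT// QT//.
set r := Num.sqrt _; set y := sT * M x; set l := lambda 1 * T.
have -> : th s M (lambda K) beta T x = (y - l) + pi / 2 by rewrite /th /beta /y /l /sT; ring.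
rewrite cosDpihalf sinDpihalf sinB cosB.
have cd := cos2Dsin2 l.
transitivity ((al * de * e_ K x * cos y - r * e_ 1 x * sin y) * (cos l ^+ 2 + sin l ^+ 2) * e_ K x); first by ring.
by rewrite cd; ring.
Qed.

(** For [exp(i th1) phi_1] in place of [psi], the linear term vanishes by [F_ortho], and the
    quadratic one equals [- s^2 A cos (gam t)] because the phases for 1 and [K] differ by
    [gam t + pi / 2]. The error is linear in the distance [q]. *)
Let YK q t : 0 <= q -> 0 <= t <= T -> n2 `]0, 1[ (dP t) <= q -> n2 `]0, 1[ (dQ t) <= q ->
  `|Yk K beta t + s t ^+ 2 * A * cos (gam t)| <= 2 * C * q * `|s t| + 2 * C * q * s t ^+ 2.
Proof.
move=> q0 tT hP hQ; rewrite /Yk; set thK := th s M (lambda K) beta.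
have cthK : continuous (thK t) by exact: th_cts.
have h1 := cth1 t; have h2 := cdP t; have h3 := cdQ t; have h4 := cP t; have h5 := cQ t.
have cFF := cFk K.
have thE x : th1 t x = thK t x - (gam t + pi / 2) by rewrite /th1 /thK /th /gam /beta; ring.
have cE x : cos (th1 t x) * cos (thK t x) + sin (th1 t x) * sin (thK t x) = - sin (gam t).
  by rewrite -cosB thE addrAC subrr add0r cosN cosDpihalf.
have sE x : sin (th1 t x) * cos (thK t x) - cos (th1 t x) * sin (thK t x) = - cos (gam t).
  by rewrite -sinB thE addrAC subrr add0r sinN sinDpihalf.
have ccK := cts_comp cthK (@cts_cos R); have csK := cts_comp cthK (@cts_sin R).
have k1 := rot_bnd _ _ _ _ _ q cFF h2 h3 ccK csK bFK
    (fun x => abs_cos_le1 _) (fun x => abs_sin_le1 _) hP hQ.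
have cG : continuous (fun x => M1 x ^+ 2 * e_ K x) by cts.
have k2 := rot_bnd _ _ _ _ _ q cG h3 h2 ccK (ctsN csK) bMK
    (fun x => abs_cos_le1 _) (fun x => ltac:(by rewrite normrN abs_sin_le1)) hQ hP.
set J1 := I01 _ in k1; set J2 := I01 _ in k2.
have -> : I01 (fun x => Fk K x * (ssum (a^~ t) x * cos (thK t x) + ssum (b^~ t) x * sin (thK t x))) = J1.
  rewrite -[RHS]addr0 -(mulr0 (- sin (gam t))) -(F_ortho K (or_introl hK)) -I01Z; last by cts.
  rewrite -I01D; [|by cts..].
  apply: I01_ext => x _; rewrite -(cE x) -/(P t x) -/(Q t x) /dP /dQ; ring.
have -> : I01 (fun x => M1 x ^+ 2 * e_ K x * (ssum (b^~ t) x * cos (thK t x) - ssum (a^~ t) x * sin (thK t x)))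
   = J2 - A * cos (gam t).
  rewrite (_ : - (A * cos (gam t)) = - cos (gam t) * A); last by ring.
  rewrite -I01Z; last by cts.
  rewrite -I01D; [|by cts..].
  apply: I01_ext => x _; rewrite -(sE x) -/(P t x) -/(Q t x) /dP /dQ; ring.
rewrite (_ : _ + _ = s t * J1 + s t ^+ 2 * J2); last by ring.
apply: (le_trans (ler_normD _ _)); rewrite !normrM; apply: lerD.
  by rewrite mulrC ler_wpM2r.
by rewrite -normrM -expr2 ger0_norm ?sqr_ge0// mulrC ler_wpM2r ?sqr_ge0.
Qed.

Let gam_cos t : 0 <= t <= T -> 1 / 2 <= cos (gam t).
Proof.
move=> /andP[t0 tT].
have : `|gam t| <= 1 / 2.
  apply: le_trans Tlam; rewrite normrM ler_wpM2l// ger0_norm ?subr_ge0//.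
  by rewrite lerBlDr lerDl.
have := cos_sub1 (gam t); rewrite -[_ ^+ 2]real_normK ?num_real// ler_norml => /andP[h _] h2.
have := normr_ge0 (gam t); nra.
Qed.

Let sig_ep : sig <= ep.
Proof.
rewrite -ler_sqr ?nnegrE ?sqrtr_ge0// sigE.
apply: (@le_trans _ _ (\int[mu]_(t in `[0, T]) (ep ^+ 2))).
  apply: le_Rintegral => //; [exact: is2|by apply: intg_cts; apply: cts_cst|].
  move=> t; rewrite /= in_itv/= => tT; rewrite -real_normK ?num_real//.
  by apply: lerXn2r; rewrite ?nnegrE//; exact: sep.
by rewrite Rintegral_cst// mu_cc// subr0 ler_piMr// sqr_ge0.
Qed.

(** The moment identity is multiplied by [al], so that [al * al = 1] and [al * A = |A|] give both
    main terms the same sign. The sine integral is cubic in [sT], its linear part vanishing by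
    [hKs]; the cosine integral differs from 1 by [O(sT^2)], whence the error proportional to
    [de]. *)
Let quad_id q : 0 <= q -> (forall t, 0 <= t <= T -> n2 `]0, 1[ (dP t) <= q /\ n2 `]0, 1[ (dQ t) <= q) ->
  de / 2 + `|A| / 2 * sig ^+ 2 <= 4 * C ^+ 3 * `|sT| ^+ 3 + 2 * C * q * (tau * sig) + 2 * C * q * sig ^+ 2
    + 4 * C ^+ 2 * `|sT| ^+ 2 * de.
Proof.
move=> q0 Hq; have /andP[d0 d1] := de01.
have G := galerkin K beta T TT; rewrite XK0 subr0 XKT in G.
have cg : continuous gam by rewrite /gam; cts.
have cY := Yk_cts K beta.
have iY : intg `[0, T] (Yk K beta) by exact: intg_cts.
have iA : intg `[0, T] (fun t => s t ^+ 2 * A * cos (gam t)) by apply: intg_cts; cts.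
set Y := Rintegral _ _ _ in G.
set Z := \int[mu]_(t in `[0, T]) (s t ^+ 2 * cos (gam t)).
have H1 : `|Y + A * Z| <= 2 * C * q * (tau * sig) + 2 * C * q * sig ^+ 2.
  have -> : Y + A * Z = \int[mu]_(t in `[0, T]) (Yk K beta t + s t ^+ 2 * A * cos (gam t)).
    rewrite RintD// -RintZ//; last by apply: intg_cts; cts.
    by congr (_ + _); apply: Rint_eq => t _; ring.
  apply: (@le_trans _ _ (\int[mu]_(t in `[0, T]) (2 * C * q * `|s t| + 2 * C * q * s t ^+ 2))).
    apply: Rint_bnd => //; [exact: intgD|by apply: intg_cts; cts|].
    move=> t; rewrite /= in_itv/= => tT; have [h1 h2] := Hq t tT; exact: YK.
  rewrite RintD//; [|by apply: intgZ|by apply: intgZ].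
  rewrite RintZ// RintZ// sigE lerD2r ler_wpM2l//; first by pos.
  exact: abss_le.
have H2 : sig ^+ 2 / 2 <= Z.
  rewrite sigE -[leLHS](_ : \int[mu]_(t in `[0, T]) (2^-1 * s t ^+ 2) = _); last by rewrite RintZ// mulrC.
  apply: le_Rintegral => //; [exact: intgZ|by apply: intg_cts; cts|].
  move=> t; rewrite /= in_itv/= => tT; rewrite mulrC; have := gam_cos t tT; have := sqr_ge0 (s t); nra.
set I1 := I01 _ in G; set I2 := I01 _ in G.
have H3 : 1 - 4 * C ^+ 2 * `|sT| ^+ 2 <= I1.
  have : `|I01 (fun x => (cos (sT * M x) - 1) * (e_ K x * e_ K x))| <= C ^+ 2 * `|sT| ^+ 2 * 4.
    apply: I01_bndb; [by cts|by cts| |].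
      move=> x /andP[x0 x1]; apply: (le_trans (cos_sub1 _)); rewrite -exprMn -[leLHS]real_normK ?num_real//.
      by apply: lerXn2r; rewrite ?nnegrE ?mulr_ge0// normrM mulrC ler_wpM2r// bM// !ltW.
    move=> x _; rewrite normrM (_ : 4 = 2 * 2 :> R); last by ring.
    by apply: ler_pM => //; exact: e_bnd.
  have -> : I01 (fun x => (cos (sT * M x) - 1) * (e_ K x * e_ K x)) = I1 - 1.
    rewrite -[X in _ - X](@e_norm R K K0) /I1 -I01B; [|by cts..].
    by apply: I01_ext => x _; ring.
  rewrite ler_norml => /andP[h _]; lra.
have H4 : `|I2| <= 4 * C ^+ 3 * `|sT| ^+ 3.
  have [_] := sin_err (fun x => e_ 1 x * e_ K x) 4 ltac:(by cts) ltac:(by []) (fun x _ => e1eK x).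
  have -> : I01 (fun x => (sin (sT * M x) - sT * M x) * (e_ 1 x * e_ K x)) = I2.
    rewrite -[RHS]subr0 -hKs -I01B; [|by cts..].
    by apply: I01_ext => x _; ring.
  move/le_trans; apply; lra.
have aa : al * al = 1.
  by rewrite -expr2 -real_normK ?num_real// al1 expr1n.
have r01 : 0 <= Num.sqrt (1 - de ^+ 2) <= 1.
  rewrite sqrtr_ge0/=; have := @ler_wsqrtr R (1 - de ^+ 2) 1; rewrite sqrtr1; apply.
  have := sqr_ge0 de; lra.
have E : de * I1 + `|A| * Z = al * Num.sqrt (1 - de ^+ 2) * I2 + al * (Y + A * Z).
  rewrite -G -alA; transitivity ((al * al) * (de * I1) + al * A * Z); last by ring.
  by rewrite aa mul1r.
have H5 : `|al * Num.sqrt (1 - de ^+ 2) * I2| <= 4 * C ^+ 3 * `|sT| ^+ 3.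
  have /andP[r0 r1] := r01.
  rewrite !normrM al1 mul1r (ger0_norm r0) -[leRHS]mul1r; exact: ler_pM.
have H6 : `|al * (Y + A * Z)| <= 2 * C * q * (tau * sig) + 2 * C * q * sig ^+ 2.
  by rewrite normrM al1 mul1r.
have H7 : de * (1 - 4 * C ^+ 2 * `|sT| ^+ 2) <= de * I1 by rewrite ler_wpM2l// ltW.
have H8 : `|A| * (sig ^+ 2 / 2) <= `|A| * Z by rewrite ler_wpM2l.
have := le_trans (ler_norm _) H5; have := le_trans (ler_norm _) H6.
move: E H7 H8; set t1 := al * _ * I2; set t2 := al * (_ + _); set t3 := de * I1; set t4 := `|A| * Z.
set c3 := C ^+ 3; lra.
Qed.

(** [ep1] lets half of the left side of [phase_bnd] absorb its quadratic term, so that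
    [|sT| <= (40 C^2 / kp) sig]; [ep2] bounds the cosine error by [de / 4]; [ep3] makes the other
    errors at most [|A| / 2 * sig ^+ 2]. *)
Hypotheses (A0 : A != 0) (kp0 : 0 < kp)
  (ep1 : 8 * C ^+ 3 * ep <= kp) (ep2 : 16 * C ^+ 2 * ep ^+ 2 <= 1)
  (ep3 : 4 * C ^+ 3 * (40 * C ^+ 2 / kp) ^+ 2 * ep + 10 * C ^+ 2 * (tau + ep) <= `|A| / 2).

Lemma no_reach : False.
Proof.
have [q /andP[q0 q1] Hq] := energy; have [hP hQ] := Hq T TT.
have := quad_id q q0 Hq; have := phase_bnd q q0 hP hQ.
have := sep T TT; rewrite -/sT.
have := sig_ep; have sg0 : 0 <= sig := sqrtr_ge0 _.
have := normr_ge0 sT; have /andP[d0 d1] := de01.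
move: (`|sT|) => z z0 sg_ep zep ph qd.
have := ep3; set D := 40 * C ^+ 2 / kp => ep3'.
have C3 : 0 <= C ^+ 3 by rewrite exprn_ge0.
have zD : z <= D * sig.
  rewrite /D mulrAC ler_pdivlMr//.
  have e1 : 4 * C ^+ 3 * z ^+ 2 <= kp / 2 * z.
    rewrite expr2 mulrA ler_wpM2r//.
    have : C ^+ 3 * z <= C ^+ 3 * ep by rewrite ler_wpM2l.
    by move: ep1; move: (C ^+ 3) => c3; lra.
  have e2 : C * q <= C * (5 * C * sig) by rewrite ler_wpM2l.
  move: e1 e2 ph; rewrite expr2; move: (C ^+ 3) => c3; lra.
have sg2 := sqr_ge0 sig.
have z3 : 4 * C ^+ 3 * z ^+ 3 <= 4 * C ^+ 3 * D ^+ 2 * ep * sig ^+ 2.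
  have zz : z ^+ 3 <= (D * sig) ^+ 2 * ep.
    rewrite exprSr; apply: ler_pM => //; first exact: sqr_ge0.
    by apply: lerXn2r; rewrite ?nnegrE// (le_trans z0).
  rewrite (_ : 4 * C ^+ 3 * D ^+ 2 * ep * sig ^+ 2 = 4 * C ^+ 3 * ((D * sig) ^+ 2 * ep)); last by ring.
  by rewrite ler_wpM2l// mulr_ge0.
have Cq : 2 * C * q <= 10 * C ^+ 2 * sig.
  have : C * q <= C * (5 * C * sig) by rewrite ler_wpM2l.
  rewrite expr2; lra.
have q3 : 2 * C * q * (tau * sig) <= 10 * C ^+ 2 * tau * sig ^+ 2.
  rewrite (_ : 10 * C ^+ 2 * tau * sig ^+ 2 = 10 * C ^+ 2 * sig * (tau * sig)); last by ring.
  by rewrite ler_wpM2r// mulr_ge0.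
have q4 : 2 * C * q * sig ^+ 2 <= 10 * C ^+ 2 * ep * sig ^+ 2.
  rewrite ler_wpM2r//; apply: (le_trans Cq); rewrite ler_wpM2l//; pos.
have z2 : 4 * C ^+ 2 * z ^+ 2 * de <= de / 4.
  rewrite mulrC ler_wpM2l ?(ltW d0)//.
  have : C ^+ 2 * z ^+ 2 <= C ^+ 2 * ep ^+ 2.
    by rewrite ler_wpM2l ?sqr_ge0//; apply: lerXn2r; rewrite ?nnegrE.
  have := ep2; rewrite -!mulrA; move: (C ^+ 2 * z ^+ 2) (C ^+ 2 * ep ^+ 2) => y1 y2; lra.
have key : (4 * C ^+ 3 * D ^+ 2 * ep + 10 * C ^+ 2 * (tau + ep)) * sig ^+ 2 <= `|A| / 2 * sig ^+ 2.
  by rewrite ler_wpM2r.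
(* The terms in [sig ^+ 2] are absorbed by [|A| / 2], leaving [de / 2 <= de / 4] against
   [0 < de]. *)
have := le_trans qd (lerD (lerD (lerD z3 q3) q4) z2).
lra.
Qed.

End Contradiction.
End Estimate.
End Core.

(** * Choice of the constants *)
Section Constants.
Context {R : realType}.
Local Notation mu := (@lebesgue_measure R).
Variables (M M1 M2 : R -> R) (K : nat).
Hypotheses (dM : has_deriv M M1) (dM1 : has_deriv M1 M2) (cM2 : continuous M2).
Hypotheses (K0 : (0 < K)%N) (hK : I01 (fun x => M x * e_ 1 x * e_ K x) = 0).
Let A := I01 (fun x => M1 x ^+ 2 * e_ K x * e_ 1 x).
Hypothesis A0 : A != 0.

Let cM : continuous M. Proof. exact: hder_cts dM. Qed.
Let cM1 : continuous M1. Proof. exact: hder_cts dM1. Qed.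

(** Otherwise all sine coefficients of [M e_1] vanish by Cauchy-Schwarz; then [M] and its derivative
    are zero on (0, 1), and so is [A]. *)
Lemma mass_pos : 0 < I01 (fun x => (M x * e_ 1 x) ^+ 2).
Proof.
rewrite lt_def; apply/andP; split; last by apply: Rintegral_ge0 => x _; exact: sqr_ge0.
apply: contra A0 => /eqP k0.
have cr : continuous (fun x => M x * e_ 1 x) by cts.
have r0 x : 0 < x < 1 -> M x * e_ 1 x = 0.
  apply: (@sine_unique R (fun x => M x * e_ 1 x)) => // j.
  have := CSn (measurable_itv _) (L2_cts _ cr) (L2_cts _ (e_cts j)).
  rewrite /n2 -/(I01 (fun x => (M x * e_ 1 x) ^+ 2)) k0 sqrtr0 mul0r normr_le0 => /eqP.
  by [].
have e1 (x : R) : 0 < x < 1 -> e_ 1 x != 0.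
  move=> /andP[x0 x1]; rewrite mulf_neq0// gt_eqF ?sqrtr_gt0// mul1r.
  have pi0 := @pi_gt0 R.
  by apply: sin_gt0_pi; rewrite mulr_gt0//= gtr_pMr.
have M0 x : 0 < x < 1 -> M x = 0.
  by move=> xx; have /eqP := r0 x xx; rewrite mulf_eq0 (negbTE (e1 x xx)) orbF => /eqP.
have M10 x : 0 < x < 1 -> M1 x = 0.
  move=> /andP[x0 x1]; have := dM x => dMx.
  have [_ <-] := hder_derive1 x dM.
  have -> : derive1 M x = derive1 (fun=> 0 : R) x; last first.
    by rewrite derive1_cst.
  rewrite !derive1E; apply: near_eq_derive; near=> y; apply: M0; apply/andP; split; near: y.
    exact: lt_nbhsr.
  exact: lt_nbhsl.
apply/eqP; rewrite -[RHS](I01_cst 0); apply: I01_ext => x xx.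
by rewrite M10// expr0n/= !mul0r.
Unshelve. all: by end_near. Qed.

(** The constants depend on [M] and [K] only, so one [ep] serves all times below [Tstar]. *)
Lemma no_control : exists2 Tstar : R, 0 < Tstar & exists2 ep : R, 0 < ep &
  forall T, 0 < T < Tstar -> forall (u s : R -> R) (a b : nat -> R -> R) (B al de : R),
  L2 `[0, T] u -> \int[mu]_(t in `[0, T]) (u t ^+ 2) <= ep ^+ 2 ->
  acf T u s u -> s 0 = 0 ->
  (forall j, continuous (a j)) -> (forall j, continuous (b j)) ->
  (forall t, decay (a^~ t) B) -> (forall t, decay (b^~ t) B) ->
  (forall t, a 0 t = 0) -> (forall t, b 0 t = 0) ->
  (forall j, acf T u (a j)
    (fun t => lambda j * b j t - I01 (fun x => e_ j x * (M x * ssum (b^~ t) x)) * u t)) ->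
  (forall j, acf T u (b j)
    (fun t => - lambda j * a j t + I01 (fun x => e_ j x * (M x * ssum (a^~ t) x)) * u t)) ->
  (forall j, a j 0 = (j == 1%N)%:R) -> (forall j, b j 0 = 0) ->
  `|al| = 1 -> al * A = `|A| -> 0 < de <= 1 ->
  (forall x, 0 < x < 1 -> ssum (a^~ T) x = Num.sqrt (1 - de ^+ 2) * e_ 1 x * cos (lambda 1 * T)
    + al * de * e_ K x * sin (lambda 1 * T)) ->
  (forall x, 0 < x < 1 -> ssum (b^~ T) x = - (Num.sqrt (1 - de ^+ 2) * e_ 1 x * sin (lambda 1 * T))
    + al * de * e_ K x * cos (lambda 1 * T)) -> False.
Proof.
have cF k : continuous (Fk M1 M2 k) by rewrite /Fk; cts.
have cG k : continuous (fun x => M1 x ^+ 2 * e_ k x) by cts.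
have [c1 c10 h1] := cts_bnd _ cM.
have [c2 c20 h2] := cts_bnd _ (cF 1%N); have [c3 c30 h3] := cts_bnd _ (cF K).
have [c4 c40 h4] := cts_bnd _ (cG 1%N); have [c5 c50 h5] := cts_bnd _ (cG K).
pose C := 1 + c1 + c2 + c3 + c4 + c5.
have [C1 k1 k2 k3 k4] : [/\ 1 <= C, c1 <= C, c2 <= C, c3 <= C & c4 <= C] by rewrite /C; split; lra.
have k5 : c5 <= C by rewrite /C; lra.
have C0 : 0 < C by lra.
have kp0 := mass_pos; set kp := I01 _ in kp0.
have An0 : 0 < `|A| by rewrite normr_gt0.
pose lamd := `|lambda K - lambda 1 : R|.
pose D := (40 * C ^+ 2 / kp) ^+ 2.
have D0 : 0 <= D by exact: sqr_ge0.
have C2 : 0 < C ^+ 2 by exact: exprn_gt0.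
have C3 : 0 < C ^+ 3 by exact: exprn_gt0.
(* The number 80 makes [10 * C ^+ 2 * tau] at most [|A| / 8]. *)
pose tau := Num.min 1 (`|A| / (80 * C ^+ 2)).
have tau0 : 0 < tau by rewrite /tau lt_min ltr01 divr_gt0// mulr_gt0.
have tau1 : tau <= 1 by rewrite /tau ge_min lexx.
have tauA : 80 * C ^+ 2 * tau <= `|A|.
  by rewrite mulrC -ler_pdivlMr ?mulr_gt0// /tau ge_min lexx orbT.
(* The first two bounds yield [ep1] and [ep2]. The last two contribute [|A| / 8] and [|A| / 4] to
   [ep3], which [tau] completes to [|A| / 2]. *)
pose ep := Num.min (Num.min (kp / (8 * C ^+ 3)) (4 * C)^-1)
  (Num.min (`|A| / (80 * C ^+ 2)) (`|A| / (16 * C ^+ 3 * (D + 1)))).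
have D1 : 0 < D + 1 by lra.
have ep0 : 0 < ep.
  rewrite /ep !lt_min invr_gt0 !divr_gt0//; first by rewrite mulr_gt0.
  - by rewrite mulr_gt0// mulr_gt0.
  - by rewrite mulr_gt0.
  - by rewrite mulr_gt0.
have epa : ep <= kp / (8 * C ^+ 3) by rewrite /ep !ge_min lexx.
have epb : ep <= (4 * C)^-1 by rewrite /ep !ge_min lexx orbT.
have epc : ep <= `|A| / (80 * C ^+ 2) by rewrite /ep !ge_min lexx !orbT.
have epd : ep <= `|A| / (16 * C ^+ 3 * (D + 1)) by rewrite /ep !ge_min lexx !orbT.
have ep1 : 8 * C ^+ 3 * ep <= kp by rewrite mulrC -ler_pdivlMr ?mulr_gt0.
have ep2 : 16 * C ^+ 2 * ep ^+ 2 <= 1.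
  have e : 4 * C * ep <= 1 by rewrite mulrC -ler_pdivlMr ?mulr_gt0// div1r.
  rewrite (_ : 16 * C ^+ 2 * ep ^+ 2 = (4 * C * ep) ^+ 2); last by ring.
  by rewrite expr_le1// !mulr_ge0// ltW.
have ep3 : 4 * C ^+ 3 * D * ep + 10 * C ^+ 2 * (tau + ep) <= `|A| / 2.
  have e1 : 80 * C ^+ 2 * ep <= `|A| by rewrite mulrC -ler_pdivlMr ?mulr_gt0.
  have e2 : 16 * C ^+ 3 * (D + 1) * ep <= `|A|.
    by rewrite mulrC -ler_pdivlMr ?mulr_gt0// mulr_gt0.
  have e3 : 0 <= C ^+ 3 * ep by rewrite mulr_ge0// ltW.
  lra.
(* The first bound gives [T <= tau ^+ 2], the second a phase drift of at most 1/2; the added 1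
   covers [K = 1], where [lamd = 0]. *)
pose Tstar := Num.min (tau ^+ 2) (1 / (2 * (lamd + 1))).
have l0 : 0 < lamd + 1 by rewrite ltr_wpDl// /lamd.
exists Tstar; first by rewrite /Tstar lt_min exprn_gt0//= divr_gt0// mulr_gt0.
exists ep => // T /andP[T0 TT] u s a b B al de Lu u2 Hs s0 ca cb aB bB a0 b0 Ha Hb ai bi al1 alA de01 PT QT.
have T1 : T <= tau ^+ 2 by apply/ltW/(lt_le_trans TT); rewrite /Tstar ge_min lexx.
have T2 : T <= 1 / (2 * (lamd + 1)) by apply/ltW/(lt_le_trans TT); rewrite /Tstar ge_min lexx orbT.
have T3 : T <= 1 by apply: (le_trans T1); rewrite expr_le1// ltW.
have T4 : lamd * T <= 1 / 2.
  move: T2; rewrite ler_pdivlMr ?mulr_gt0// => T2; have := ltW T0; lra.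
(* Cauchy-Schwarz bounds [s t ^+ 2] by [t] times the integral of [u ^+ 2], and [t <= T <= 1]. *)
have sep t : 0 <= t <= T -> `|s t| <= ep.
  move=> /andP[t0 tT]; have [_ _ ->] := Hs; last by rewrite t0.
  rewrite s0 add0r -ler_sqr ?nnegrE ?(ltW ep0)// real_normK ?num_real//.
  have st : `[0, t]%classic `<=` `[0, T]%classic by apply: sub0T.
  have Lt : L2 `[0, t] u by apply: (L2S _ _ st Lu).
  have L1 : L2 `[0, t] (fun=> 1 : R).
    by apply: (L2_bnd (C := 1)) => //; [exact: mu_cc_fin|move=> x _; rewrite normr1].
  have := CS (measurable_itv _) L1 Lt.
  rewrite (_ : \int[mu]_(x in `[0, t]) (1 * u x) = \int[mu]_(x in `[0, t]) u x); last first.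
    by apply: Rint_eq => x _; rewrite mul1r.
  move/le_trans; apply; apply: le_trans u2.
  rewrite Rintegral_cst// mu_cc// subr0 expr1n mul1r.
  have [_ iu] := Lu.
  rewrite (@Rint_split _ (fun x => u x ^+ 2) 0 t T)//.
  have p1 : 0 <= \int[mu]_(x in `[0, t]) (u x ^+ 2) by apply: Rintegral_ge0 => x _; exact: sqr_ge0.
  have p2 : 0 <= \int[mu]_(x in `[t, T]) (u x ^+ 2) by apply: Rintegral_ge0 => x _; exact: sqr_ge0.
  apply: (@le_trans _ _ (\int[mu]_(x in `[0, t]) (u x ^+ 2))); last by rewrite lerDl.
  by rewrite ler_piMl// (le_trans tT).
have bnd (f : R -> R) c : (forall x, 0 <= x <= 1 -> `|f x| <= c) -> c <= C -> forall x, 0 <= x <= 1 -> `|f x| <= C.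
  by move=> h cC x xx; apply: le_trans (h x xx) cC.
apply: (@no_reach R T u M M1 M2 s a b B (ltW T0) Lu dM dM1 cM2 Hs ca cb aB bB a0 b0 Ha Hb K C T3 s0 ai bi K0 hK C1
  _ _ _ _ _ tau ep al de) => //.
- exact: bnd h1 k1.
- exact: bnd h2 k2.
- exact: bnd h3 k3.
- exact: bnd h4 k4.
- exact: bnd h5 k5.
- exact: ltW.
- exact: ltW.
Qed.
End Constants.

(** * Smooth steps *)
Section Smooth.
Context {R : realType}.
Local Notation mu := (@lebesgue_measure R).

(** The flat function [exp(- 1/x)], weighted by powers of [1/x]: derivatives stay in the span of
    this family, so smoothness reduces to a single derivative formula. *)
Definition flat (n : nat) (x : R) : R := if 0 < x then x^-1 ^+ n * expR (- x^-1) else 0.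

Lemma expR_pow_bnd (n : nat) (y : R) : 0 <= y -> y ^+ n.+1 * expR (- y) <= (n.+1)`!%:R.
Proof.
move=> y0; rewrite expRN ler_pdivrMr ?expR_gt0//.
have h := expR_ge1Dxn n y0; have f0 : 0 < (n.+1)`!%:R :> R by rewrite ltr0n fact_gt0.
have : y ^+ n.+1 / (n.+1)`!%:R <= expR y by apply: le_trans h; rewrite lerDr.
by rewrite ler_pdivrMr// mulrC.
Qed.

(** The exponential absorbs two further powers of [1/h]; a bound quadratic in [h] then gives
    derivative 0 at 0, for every [n] at once. *)
Lemma flat_sq n (h : R) : `|flat n h| <= (n.+2)`!%:R * h ^+ 2.
Proof.
rewrite /flat; case: ifPn => h0; last by rewrite normr0 mulr_ge0// sqr_ge0.
have y0 : 0 <= h^-1 by rewrite invr_ge0 ltW.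
rewrite ger0_norm; last by rewrite mulr_ge0 ?exprn_ge0// expR_ge0.
have -> : h^-1 ^+ n * expR (- h^-1) = (h^-1 ^+ n.+2 * expR (- h^-1)) * h ^+ 2.
  by rewrite !exprS; field; rewrite gt_eqF.
by rewrite ler_wpM2r ?sqr_ge0// expR_pow_bnd.
Qed.

Lemma deriv_of_sq (f : R -> R) (K : R) : (forall h, `|f h| <= K * h ^+ 2) ->
  is_derive (0 : R) (1 : R) f 0.
Proof.
move=> H.
have K0 : 0 <= K by have := H 1; rewrite expr1n mulr1; apply: le_trans.
have f0 : f 0 = 0 by apply/eqP; rewrite -normr_le0; have := H 0; rewrite expr0n/= mulr0.
have L : h^-1 *: ((f \o shift 0) (h *: (1 : R)) - f 0) @[h --> (0 : R)^'] --> (0 : R).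
  apply/cvgrPdist_le => e e0; rewrite /=.
  have d0 : 0 < e / (K + 1) by rewrite divr_gt0// ltr_wpDl.
  exists (e / (K + 1)) => //= h; rewrite /ball/= sub0r normrN => hd hn0.
  rewrite sub0r normrN f0 subr0 addr0 /GRing.scale/= mulr1 normrM normfV.
  rewrite mulrC ler_pdivrMr ?normr_gt0//; apply: (le_trans (H h)).
  rewrite -[h ^+ 2]real_normK ?num_real// expr2 mulrA ler_wpM2r//.
  move: hd; rewrite ltr_pdivlMr ?ltr_wpDl// => hd.
  have := normr_ge0 h; move: hd; rewrite mulrDr mulr1; lra.
by apply: DeriveDef; [apply/cvg_ex; exists 0|apply/cvg_lim].
Qed.

Lemma hderX n : has_deriv (fun x : R => x ^+ n) (fun x => n%:R * x ^+ n.-1).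
Proof.
elim: n => [|n IH].
  by apply: (hder_eq _ (hder_cst (1 : R))) => x; rewrite mul0r.
have -> : (fun x : R => x ^+ n.+1) = (fun x => x * x ^+ n) by apply/funext => x; rewrite exprS.
apply: (hder_eq _ (hderM (@hder_id R) IH)) => x /=.
case: n {IH} => [|n]; first by rewrite !mul0r mulr0 addr0.
by rewrite /= -[n.+2%:R]natr1 exprS; ring.
Qed.

Lemma hder_flat n : has_deriv (flat n) (fun x => flat n.+2 x - n%:R * flat n.+1 x).
Proof.
move=> x; have [x0|x0|x0] := ltgtP x 0.
- rewrite /flat ltNge (ltW x0)/= mulr0 subrr.
  apply: near_eq_is_derive (hder_cst (0 : R) x).
  near=> y; rewrite ltNge ltW//; near: y; exact: lt_nbhsl.
- rewrite /flat x0.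
  pose k (y : R) := y ^+ n * expR (- y).
  have dk : has_deriv k (fun y => n%:R * y ^+ n.-1 * expR (- y) + y ^+ n * (expR (- y) * - 1)).
    have dE : has_deriv expR (@expR R) by move=> z; exact: is_derive_expR.
    exact: hderM (hderX n) (hder_comp dE (hderN (@hder_id R))).
  apply: (near_eq_is_derive (f := k \o (fun y => y^-1))).
    near=> y; rewrite ifT//; near: y; exact: lt_nbhsr.
  have xn0 : x != 0 by rewrite gt_eqF.
  have dV : is_derive x (1 : R) (fun y : R => y^-1) (- x ^- 2).
    by have := is_deriveV xn0 (hder_id x); rewrite /GRing.scale/= mulr1.
  have := is_derive1_comp (dk x^-1) dV.
  congr is_derive; case: n {k dk} => [|n] /=; rewrite !exprS ?expr0; field; exact: xn0.
- rewrite x0 /flat ltxx mulr0 subrr; exact: deriv_of_sq (flat_sq n).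
Unshelve. all: by end_near. Qed.

(* The constructors are chosen to make the class stable under derivation. *)
Inductive smooth : (R -> R) -> Prop :=
| smooth_flat n : smooth (flat n)
| smooth_cst c : smooth (fun=> c)
| smoothD f g : smooth f -> smooth g -> smooth (fun x => f x + g x)
| smoothM f g : smooth f -> smooth g -> smooth (fun x => f x * g x)
| smooth_aff f c d : smooth f -> smooth (fun x => f (c * x + d))
| smooth_prim f F : smooth f -> has_deriv F f -> smooth F.

Lemma smooth_deriv f : smooth f -> exists2 f', smooth f' & has_deriv f f'.
Proof.
elim=> {f} [n|c|f g _ [f' sf df] _ [g' sg dg]|f g sf0 [f' sf df] sg0 [g' sg dg]|f c d _ [f' sf df]|f F sf _ dF].
- exists (fun x => flat n.+2 x + (- n%:R) * flat n.+1 x).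
    apply: smoothD; first exact: smooth_flat.
    by apply: smoothM; [exact: smooth_cst|exact: smooth_flat].
  by apply: (hder_eq _ (hder_flat n)) => x; rewrite mulNr.
- by exists (fun=> 0); [exact: smooth_cst|exact: hder_cst].
- by exists (fun x => f' x + g' x); [exact: smoothD|exact: hderD].
- exists (fun x => f' x * g x + f x * g' x); last exact: hderM.
  by apply: smoothD; exact: smoothM.
- exists (fun x => f' (c * x + d) * c).
    by apply: smoothM; [exact: smooth_aff|exact: smooth_cst].
  apply: (hder_eq _ (hder_comp df (hderD (hder_lin c) (hder_cst d)))) => x.
  by rewrite addr0.
- by exists f.
Qed.

Lemma derive1_hder (f f' : R -> R) : has_deriv f f' -> derive1 f = f'.
Proof. by move=> df; apply/funext => x; have [] := hder_derive1 x df. Qed.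

Lemma smooth_derivable f : smooth f -> forall n x, derivable (derive1n n f) x 1.
Proof.
move=> sf n x; elim: n f sf => [|n IH] f sf; have [f' sf' df] := smooth_deriv _ sf.
  by have [] := df x.
by rewrite derive1Sn (derive1_hder _ _ df); exact: IH.
Qed.

Lemma smooth_cts f : smooth f -> continuous f.
Proof. by move=> /smooth_deriv [f' _ df]; exact: hder_cts df. Qed.

Lemma smooth_step : exists (eta rho : R -> R) (c : R), [/\ smooth eta, has_deriv eta rho,
  continuous rho, 0 <= c & forall x, [/\ 0 <= eta x <= 1, 0 <= rho x <= c,
    (x <= 0 -> eta x = 0 /\ rho x = 0) & (1 <= x -> eta x = 1 /\ rho x = 0)]].
Proof.
(* A bump that vanishes outside (0, 1); [eta] is its normalised primitive and [rho] the normalised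
   bump. *)
pose b x := flat 0 x * flat 0 (-1 * x + 1).
have sb : smooth b by apply: smoothM; [|apply: smooth_aff]; exact: smooth_flat.
have cb := smooth_cts _ sb.
have f01 x : 0 <= flat 0 x <= 1.
  rewrite /flat; case: ifPn => x0; last by rewrite lexx ler01.
  by rewrite expr0 mul1r expR_ge0 -expR0 ler_expR oppr_le0 invr_ge0 ltW.
have b0 x : 0 <= b x by rewrite /b mulr_ge0//; [case/andP: (f01 x)|case/andP: (f01 (-1 * x + 1))].
have b1 x : b x <= 1.
  have /andP[p1 p2] := f01 x; have /andP[p3 p4] := f01 (-1 * x + 1).
  by rewrite /b mulr_ile1.
have bl x : x <= 0 -> b x = 0 by move=> x0; rewrite /b /flat ltNge x0 mul0r.
have br x : 1 <= x -> b x = 0.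
  by move=> x1; rewrite /b [flat 0 (_ + _)]/flat ltNge (_ : -1 * x + 1 <= 0) ?mulr0//; lra.
have [F dF] := antideriv cb.
have mono x y : x <= y -> F x <= F y.
  move=> xy; rewrite -subr_ge0 -(ftc xy dF cb); apply: Rintegral_ge0 => z _; exact: b0.
have Fl x : x <= 0 -> F x = F 0.
  move=> x0; apply/esym/eqP; rewrite -subr_eq0 -(ftc x0 dF cb); apply/eqP.
  rewrite -[RHS](mul0r (fine (mu `[x, 0]))) -Rintegral_cst//.
  by apply: Rint_eq => z; rewrite /= in_itv/= => /andP[_]; exact: bl.
have Fr x : 1 <= x -> F x = F 1.
  move=> x1; apply/eqP; rewrite -subr_eq0 -(ftc x1 dF cb); apply/eqP.
  rewrite -[RHS](mul0r (fine (mu `[1, x]))) -Rintegral_cst//.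
  by apply: Rint_eq => z; rewrite /= in_itv/= => /andP[+ _]; exact: br.
have Fpos : 0 < F 1 - F 0.
  rewrite -(ftc ler01 dF cb).
  (* On the middle half both factors of [b] are at least [exp(- 4)], so the normalising integral is
     positive. *)
  pose m := expR (- 4) * expR (- 4) : R.
  have bm x : 1 / 4 <= x <= 3 / 4 -> m <= b x.
    move=> /andP[x1 x2]; rewrite /b /flat !ifT; [|lra|lra].
    rewrite !expr0 !mul1r; apply: ler_pM; rewrite ?expR_ge0// ler_expR lerN2.
      by rewrite -[leRHS]invrK lef_pV2 ?posrE; lra.
    by rewrite -[leRHS]invrK lef_pV2 ?posrE; lra.
  rewrite (@Rint_split _ b 0 (1 / 4) 1); [|lra|lra|exact: intg_cts].
  rewrite (@Rint_split _ b (1 / 4) (3 / 4) 1); [|lra|lra|exact: intg_cts].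
  have h1 : 0 <= \int[mu]_(x in `[0, (1 / 4)]) b x by apply: Rintegral_ge0.
  have h3 : 0 <= \int[mu]_(x in `[(3 / 4), 1]) b x by apply: Rintegral_ge0.
  have h2 : m * (3 / 4 - 1 / 4) <= \int[mu]_(x in `[(1 / 4), (3 / 4)]) b x.
    by apply: Rint_ge => //; lra.
  have m0 : 0 < m by rewrite mulr_gt0 ?expR_gt0.
  move: h1 h2 h3; set j1 := Rintegral _ _ _; set j2 := Rintegral _ _ _; set j3 := Rintegral _ _ _; lra.
set d := F 1 - F 0 in Fpos.
have di : 0 <= d^-1 by rewrite invr_ge0 ltW.
exists (fun x => d^-1 * (F x + - F 0)), (fun x => d^-1 * b x), d^-1; split => //.
- apply: smoothM; first exact: smooth_cst.
  by apply: smoothD; [apply: smooth_prim sb dF|exact: smooth_cst].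
- by apply: hderZ; apply: (hder_eq _ (hderD dF (hder_cst (- F 0)))) => x; rewrite addr0.
- by cts.
- move=> x; split.
  + have [x0|x0] := leP x 0; first by rewrite Fl// subrr mulr0 lexx ler01.
    have h : F 0 <= F x by apply: mono; exact: ltW.
    have h1 : F x <= F 1.
      by have [/mono//|/ltW/Fr ->] := leP x 1.
    rewrite mulr_ge0 ?subr_ge0//= mulrC ler_pdivrMr// mul1r /d; lra.
  + by rewrite mulr_ge0//= ler_piMr.
  + by move=> x0; rewrite Fl// subrr mulr0 bl// mulr0.
  + by move=> x1; rewrite Fr// br// mulr0 mulVf// gt_eqF.
Qed.
End Smooth.

(** * The lemma of du Bois-Reymond *)
Section WeakDerivative.
Context {R : realType}.
Local Notation mu := (@lebesgue_measure R).
Implicit Types (f g : R -> R).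

Lemma cvg0_lt {T : Type} {F : set_system T} {FF : Filter F} (h : T -> \bar R) (e : R) :
  h x @[x --> F] --> 0%E -> 0 < e -> \forall x \near F, (h x < e%:E)%E.
Proof. by move=> hF e0; exact: (hF [set y | (y < e%:E)%E] (nbhs_open_ereal_lt (f := fun=> e) e0)). Qed.

Lemma small_int f c d : intg `[c, d] f -> forall e : R, 0 < e -> exists2 d0 : R, 0 < d0 &
  forall x y, c <= x -> x <= y -> y <= d -> y - x < d0 -> \int[mu]_(t in `[x, y]) `|f t| < e.
Proof.
move=> If e e0.
have If' : intg setT (f \_ `[c, d]).
  rewrite /intg -restrict_EFin; apply/integrable_restrict => //; by rewrite setTI.
have [d0 [d00 H]] := integral_normr_continuous If' e0.
exists d0 => // x y cx xy yd yx.
have := H `[x, y]%classic (measurable_itv _).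
have m1 : (mu `[x, y]%classic < d0%:E)%E.
  by rewrite -[mu _]fineK ?mu_cc ?lte_fin// ge0_fin_numE// mu_cc_fin.
move=> /(_ m1).
congr (_ < _); apply: Rint_eq => t /=; rewrite in_itv/= => /andP[t1 t2].
by rewrite patchE ifT// inE/= in_itv/= (le_trans cx t1) (le_trans t2 yd).
Qed.

Lemma Rint_supp f D D' : D `<=` D' -> (forall x, D' x -> ~ D x -> f x = 0) ->
  \int[mu]_(x in D') f x = \int[mu]_(x in D) f x.
Proof.
move=> DD' f0; rewrite [LHS]Rintegral_mkcond [RHS]Rintegral_mkcond.
apply: Rint_eq => x _; rewrite !patchE; have [/set_mem D'x|D'x] := ifPn.
  by case: ifPn => // /negP nD; rewrite f0// => Dx; apply: nD; rewrite inE.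
by rewrite ifN//; apply/negP => /set_mem /DD' Dx; move/negP: D'x; apply; rewrite inE.
Qed.

Lemma Rint0 f D : (forall x, D x -> f x = 0) -> \int[mu]_(x in D) f x = 0.
Proof. by move=> f0; rewrite (@Rint_supp f set0 D) ?Rintegral_set0// => x /f0. Qed.

Lemma loc_intg f D c d : locally_integrable D f -> `[c, d]%classic `<=` D -> intg `[c, d] f.
Proof.
move=> [mf oD H] cd; apply/integrableP; split.
  by apply/measurable_EFinP; apply: measurable_funS mf => //; exact: open_measurable.
by apply: (H _ cd); exact: segment_compact.
Qed.

Lemma sub_cc_oo (c d : R) : 0 < c -> d < 1 -> `[c, d]%classic `<=` (`]0, 1[%classic : set R).
Proof. by move=> c0 d1 x /=; rewrite !in_itv/= => /andP[x1 x2]; apply/andP; split; lra. Qed.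

(** A one-sided Lebesgue point, matching steps whose transition lies to the right of [p]. *)
Definition lebesgue_right f (p : R) := forall e : R, 0 < e -> exists2 d : R, 0 < d & forall r, 0 < r -> r < d ->
  \int[mu]_(x in `[p, p + r]) `|f x - f p| <= e * r.

Lemma ae_lebesgue_right f : intg `]0, 1[ f -> {ae mu, forall x, 0 < x < 1 -> lebesgue_right f x}.
Proof.
move=> If; have locF := integrable_locally_restrict (measurable_itv _) If.
have Fae := ae_filter_ringOfSetsType mu.
apply: filterS (lebesgue_differentiation locF) => p Hp /andP[p0 p1] e e0.
(* The interval [p, p + r] is enclosed in the ball of radius [2 * r], of length [4 * r]: an average
   below [e / 4] there means an integral below [e * r]. *)
have e4 : 0 < e / 4 by lra.
have FF : Filter (0 : R)^'+ by exact: at_right_proper_filter.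
pose F := f \_ `]0, 1[.
have : nbhs (0 : R) (fun r : R => 0 < r -> (davg F p r < (e / 4)%:E)%E) := @cvg0_lt _ _ _ _ _ Hp e4.
move=> /(_ FF) /nbhs_ballP[d /= d0 H].
have FE x : 0 < x < 1 -> F x = f x by move=> x01; rewrite /F patchE ifT// inE/= in_itv.
(* Keeping [r] below [1 - p] leaves [p, p + r] inside (0, 1), where [F] agrees with [f]. *)
exists (Num.min (d / 2) (1 - p)) => [|r r0]; first by rewrite lt_min; apply/andP; split; lra.
rewrite lt_min => /andP[rd rp].
have rb : ball 0 d (2 * r) by rewrite /ball/= sub0r normrN gtr0_norm; lra.
have r2 : 0 < 2 * r by lra.
have {H} := H _ rb r2; rewrite /davg /iavg lebesgue_measure_ball; last by rewrite ltW.
have mF : measurable_fun setT F.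
  apply/(measurable_restrictT _ _).1 => //; exact: intg_meas If.
pose G y := `|F y - F p|.
have mF' D : measurable D -> measurable_fun D (fun x => (G x)%:E).
  move=> mD; apply/measurable_EFinP; apply: measurableT_comp => //; apply: measurable_funB => //.
  exact: measurable_funS mF.
set I := (\int[mu]_(y in _) _)%E => HI.
have sub : `[p, p + r]%classic `<=` ball p (2 * r).
  move=> x /=; rewrite in_itv/= => /andP[x1 x2]; rewrite /ball/= distrC ger0_norm; lra.
have mB : measurable (ball p (2 * r)) by exact: measurable_ball.
have le1 : (\int[mu]_(y in `[p, (p + r)%R]) (G y)%:E <= I)%E.
  have -> : I = (\int[mu]_(y in ball p (2 * r)%R) (G y)%:E)%E by [].
  by apply: ge0_subset_integral => //; [exact: (mF' _ mB)|move=> x _; rewrite lee_fin /G].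
have I0 : (0 <= I)%E by apply: integral_ge0.
have rne : (2 * r) *+ 2 != 0 by apply/eqP; lra.
have -> : \int[mu]_(x in `[p, p + r]) `|f x - f p| = \int[mu]_(x in `[p, p + r]) G x.
  apply: Rint_eq => x /=; rewrite in_itv/= => /andP[x1 x2]; rewrite /G !FE//; apply/andP; split; lra.
move: HI le1 I0; rewrite inver (negbTE rne).
case: I => [v| |] //; last by rewrite gt0_muley ?lte_fin ?invr_gt0; [|lra].
rewrite -EFinM lte_fin => Hv le1 v0; rewrite /Rintegral -lee_fin fineK.
  apply: (le_trans le1); rewrite lee_fin.
  move: Hv; rewrite mulrC ltr_pdivrMr; lra.
rewrite ge0_fin_numE; last by apply: integral_ge0 => x _; rewrite lee_fin /G.
exact: le_lt_trans le1 (ltry _).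
Qed.


Lemma step_at : exists2 c : R, 0 <= c & forall p r : R, 0 < r -> exists (E D : R -> R),
  [/\ smooth E, has_deriv E D, continuous D & forall x, [/\ 0 <= E x <= 1, 0 <= D x <= c / r,
    (x <= p -> E x = 0 /\ D x = 0) & (p + r <= x -> E x = 1 /\ D x = 0)]].
Proof.
have [eta [rho [c [se dE cr c0 H]]]] := @smooth_step R.
exists c => // p r r0; have ri : 0 < r^-1 by rewrite invr_gt0.
have aff x : r^-1 * x + - (p / r) = (x - p) / r by field; rewrite gt_eqF.
exists (fun x => eta (r^-1 * x + - (p / r))), (fun x => rho (r^-1 * x + - (p / r)) * r^-1).
split.
- exact: smooth_aff.
- apply: (hder_eq _ (hder_comp dE (hderD (hder_lin r^-1) (hder_cst (- (p / r)))))) => x.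
  by rewrite addr0.
- cts; apply: (@cts_comp _ (fun x => r^-1 * x + - (p / r)) rho) => //; cts.
- move=> x; rewrite aff; have [h1 /andP[h2 h2'] h3 h4] := H ((x - p) / r); split => //.
  + by rewrite mulr_ge0 ?(ltW ri)//= ler_pM2r.
  + move=> xp; have /h3[-> ->] : (x - p) / r <= 0 by rewrite ler_pdivrMr//; lra.
    by rewrite mul0r.
  + move=> xp; have /h4[-> ->] : 1 <= (x - p) / r by rewrite ler_pdivlMr//; lra.
    by rewrite mul0r.
Qed.

Lemma intgMc f h c d : intg `[c, d] f -> continuous h -> intg `[c, d] (fun x => f x * h x).
Proof.
move=> If ch; have ch' : continuous (fun x => h (x + c)).
  by apply: (@cts_comp _ (fun x => x + c) h) => //; cts.
have [cd|dc] := leP c d; last by rewrite set_itv_ge ?bnd_simp -?ltNge//; exact: integrable_set0.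
have [C C0 hC] := cts_bnd_itv (d - c) ltac:(lra) _ ch'.
apply: (@intg_le _ _ _ (fun x => C * `|f x|)) => //.
- apply: measurable_funM; [exact: intg_meas If|exact: meas_cts].
- by apply: intgZ => //; apply: intg_norm.
- move=> x /=; rewrite in_itv/= => /andP[x1 x2]; rewrite normrM mulrC ler_wpM2r//.
  have := hC (x - c); rewrite subrK; apply; apply/andP; split; lra.
Qed.

(** [D] is a probability density bounded by [c / r], so the weighted mean of [f] is off by at most
    [c] times its mean deviation from [f p]. *)
Lemma step_avg f (D : R -> R) (p r c : R) : 0 < r -> intg `[p, p + r] f -> continuous D ->
  (forall x, 0 <= D x <= c / r) -> \int[mu]_(x in `[p, p + r]) D x = 1 ->
  `|\int[mu]_(x in `[p, p + r]) (f x * D x) - f p| <=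
  c / r * \int[mu]_(x in `[p, p + r]) `|f x - f p|.
Proof.
move=> r0 If cD D0 D1.
have Ic : intg `[p, p + r] (fun=> f p) by apply: intg_cst => //; exact: mu_cc_fin.
have Id : intg `[p, p + r] (fun x => f x - f p) by exact: intgB.
rewrite -{1}[f p]mulr1 -D1 -RintZ//; last exact: intg_cts.
rewrite -RintB//; [|exact: intgMc|by apply: intgZ => //; exact: intg_cts].
rewrite -RintZ//; last by apply: intg_norm.
apply: Rint_bnd => //.
- by apply: intgB => //; [exact: intgMc|apply: intgZ => //; exact: intg_cts].
- by apply: intgZ => //; apply: intg_norm.
move=> x _; rewrite -mulrBl normrM mulrC ler_wpM2r//.
by have /andP[h1 h2] := D0 x; rewrite ger0_norm.
Qed.

(** Error count for [du_bois_reymond]: [c * e] for each of the two averages of [f], and [e] for each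
    of three integrals of [g] over the transition zones. *)
Lemma du_bois_reymond_arith (c r e G1 G2 J1 J2 J3 J Ib Ia fb fa Nb Na : R) : 0 <= c -> 0 < r ->
  G1 < e -> G2 < e -> `|J1| <= G1 -> `|J2| <= G2 -> `|J3| <= G2 ->
  `|Ib - fb| <= c / r * Nb -> `|Ia - fa| <= c / r * Na -> Ia + (0 - Ib) = - (J2 + (J + J1)) ->
  Nb <= e * r -> Na <= e * r -> `|fb - fa - (J3 + J)| <= (2 * c + 3) * e.
Proof.
move=> c0 r0 p1 p2 p3 p4 p5 p6 p7 E n1 n2.
have cre : c / r * (e * r) = c * e by field; rewrite gt_eqF.
have cr0 : 0 <= c / r by rewrite divr_ge0// ltW.
have {n1} q1 := le_trans p6 (ler_wpM2l cr0 n1).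
have {n2} q2 := le_trans p7 (ler_wpM2l cr0 n2).
move: q1 q2; rewrite !cre; clear p6 p7 cre cr0 c0 r0.
have -> : (2 * c + 3) * e = 2 * (c * e) + 3 * e by ring.
move: (c * e) => ce.
have {}p3 := le_lt_trans p3 p1; have {}p4 := le_lt_trans p4 p2; have {}p5 := le_lt_trans p5 p2.
move: p3 p4 p5; rewrite !ler_norml !ltr_norml => /andP[? ?] /andP[? ?] /andP[? ?] /andP[? ?] /andP[? ?].
by apply/andP; split; lra.
Qed.

(* Test with the difference of two smooth steps, of width [r], at [al] and [be]:
   its derivative averages [f] near both points. *)
Lemma du_bois_reymond f g (al be : R) : intg `]0, 1[ f -> weak_derivative 0 1 f g -> 0 < al -> al < be -> be < 1 ->
  lebesgue_right f al -> lebesgue_right f be -> f be - f al = \int[mu]_(x in `[al, be]) g x.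
Proof.
move=> If [_ lg W] al0 ab b1 La Lb.
have [c c0 H] := step_at.
apply/eqP; rewrite -subr_eq0 -normr_le0; apply/ler_addgt0Pr => e1 e10; rewrite add0r.
pose e := e1 / (2 * c + 3).
have k0 : 0 < 2 * c + 3 by lra.
have e0 : 0 < e by rewrite divr_gt0.
have [da da0 Ha] := La _ e0; have [db db0 Hb] := Lb _ e0.
pose m := (1 + be) / 2.
have m1 : be < m < 1 by rewrite /m; apply/andP; split; lra.
have Ig : intg `[al, m] g by apply: (loc_intg _ _ _ _ lg); apply: sub_cc_oo => //; lra.
have [dg dg0 Hg] := small_int _ _ _ Ig e e0.
(* The halving makes all bounds strict: the transitions are disjoint, end before [m], are short
   enough for the Lebesgue points, and carry little of [g]. *)
pose r := Num.min (Num.min da db) (Num.min (Num.min dg (be - al)) (m - be)) / 2.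
have [r0 [ra rb rg rab rm]] : 0 < r /\ [/\ r < da, r < db, r < dg, r < be - al & r < m - be].
  have h : 0 < Num.min (Num.min da db) (Num.min (Num.min dg (be - al)) (m - be)).
    by rewrite !lt_min da0 db0 dg0 !subr_gt0 ab; case/andP: m1 => ->.
  have : r < Num.min (Num.min da db) (Num.min (Num.min dg (be - al)) (m - be)).
    by rewrite /r ltr_pdivrMr//; lra.
  by rewrite !lt_min => /andP[/andP[? ?] /andP[/andP[? ?] ?]]; split => //; rewrite divr_gt0.
have ga : al + r - al < dg by rewrite addrAC subrr add0r.
have gb' : be + r - be < dg by rewrite addrAC subrr add0r.
have bm : be + r <= m by lra.
have am : al + r <= m by lra.
have {Ha} := Ha r r0 ra; have {Hb} := Hb r r0 rb.
have [Ea [Da [sa hda cDa Pa]]] := H al r r0; have [Eb [Db [sb hdb cDb Pb]]] := H be r r0.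
pose ph x := Ea x + (-1) * Eb x.
have sph : smooth ph by apply: smoothD => //; apply: smoothM => //; exact: smooth_cst.
have dph : has_deriv ph (fun x => Da x + (-1) * Db x) by apply: hderD => //; exact: hderZ.
have arbr : al + r <= be + r by rewrite lerD2r ltW.
have out x : x \notin `[al, be + r] -> [/\ ph x = 0, Da x = 0 & Db x = 0].
  have [_ _ h1 h2] := Pa x; have [_ _ h3 h4] := Pb x.
  rewrite in_itv/= negb_and -!ltNge /ph => /orP[xa|xb].
    by have [-> ->] := h1 (ltW xa); have [-> ->] := h3 (ltW (lt_trans xa ab)); rewrite mulr0 addr0.
  by have [-> ->] := h2 (ltW (le_lt_trans arbr xb)); have [-> ->] := h4 (ltW xb); rewrite mulN1r subrr.
have ph1 x : `|ph x| <= 1.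
  have [h1 _ _ _] := Pa x; have [h2 _ _ _] := Pb x.
  by move: h1 h2; clear; rewrite /ph ler_norml => /andP[h1 h2] /andP[h3 h4]; apply/andP; split; lra.
have ph0 x : x \notin `[al, be + r] -> ph x = 0.
  by move=> /out[].
have tph : test_function 0 1 ph.
  split; first exact: smooth_derivable.
  by exists al, (be + r); split => //; lra.
have := W _ tph; rewrite (derive1_hder _ _ dph).
have sub : `[al, be + r]%classic `<=` (`]0, 1[%classic : set R) by apply: sub_cc_oo => //; lra.
rewrite (@Rint_supp _ `[al, be + r])//; last first.
  by move=> x _ /= /negP /out[_ -> ->]; rewrite mulr0 addr0 mulr0.
rewrite (@Rint_supp (fun x => g x * ph x) `[al, be + r])//; last first.
  by move=> x _ /= /negP /ph0 ->; rewrite mulr0.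
have cph := smooth_cts _ sph.
have Ifm : intg `[al, be + r] f by apply: intgS If.
have Igm : intg `[al, be + r] g.
  by apply: intgS Ig => //; apply: subset_itvl; rewrite bnd_simp.
have c1 : continuous (fun x => Da x + -1 * Db x) by cts.
have I1 := intgMc _ _ _ _ Ifm c1; have I2 := intgMc _ _ _ _ Igm cph.
have o1 : al <= al + r by rewrite lerDl ltW.
have o2 := arbr.
have o3 : al + r <= be by rewrite addrC -lerBrDr ltW.
have o4 : be <= be + r by rewrite lerDl ltW.
have subA : `[al, al + r]%classic `<=` `[al, be + r]%classic by apply: subset_itvl; rewrite bnd_simp.
have subB : `[be, be + r]%classic `<=` `[al, be + r]%classic by apply: subset_itvr; rewrite bnd_simp ltW.
have subM : `[al + r, be + r]%classic `<=` `[al, be + r]%classic by apply: subset_itvr; rewrite bnd_simp.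
(* On the two transition intervals the derivative of [ph] averages [f] near [al] and, with a minus
   sign, near [be]; between them [ph = 1] yields the integral of [g]. *)
rewrite (Rint_split o1 o2 I1) (Rint_split o3 o4 (intgS _ _ subM I1))//.
rewrite (Rint_split o1 o2 I2) (Rint_split o3 o4 (intgS _ _ subM I2))//.
have subC : `[al, be]%classic `<=` `[al, be + r]%classic by apply: subset_itvl; rewrite bnd_simp.
rewrite (Rint_split o1 o3 (intgS _ _ subC Igm))//.
have -> : \int[mu]_(x in `[al, (al + r)]) (f x * (Da x + -1 * Db x)) = \int[mu]_(x in `[al, (al + r)]) (f x * Da x).
  apply: Rint_eq => x /=; rewrite in_itv/= => /andP[_ x2]; have [_ _ h _] := Pb x.
  by have [_ ->] := h (le_trans x2 o3); rewrite mulr0 addr0.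
have -> : \int[mu]_(x in `[(al + r), be]) (f x * (Da x + -1 * Db x)) = 0.
  apply: Rint0 => x /=; rewrite in_itv/= => /andP[x1 x2].
  have [_ _ h _] := Pb x; have [_ _ _ h'] := Pa x.
  by have [_ ->] := h x2; have [_ ->] := h' x1; rewrite mulr0 addr0 mulr0.
have -> : \int[mu]_(x in `[be, (be + r)]) (f x * (Da x + -1 * Db x)) = - \int[mu]_(x in `[be, (be + r)]) (f x * Db x).
  rewrite -RintN//; last by apply: intgMc => //; exact: intgS Ifm.
  apply: Rint_eq => x /=; rewrite in_itv/= => /andP[x1 _]; have [_ _ _ h] := Pa x.
  by have [_ ->] := h (le_trans o3 x1); rewrite add0r mulN1r mulrN.
have -> : \int[mu]_(x in `[(al + r), be]) (g x * ph x) = \int[mu]_(x in `[(al + r), be]) g x.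
  apply: Rint_eq => x /=; rewrite in_itv/= => /andP[x1 x2].
  have [_ _ h _] := Pb x; have [_ _ _ h'] := Pa x; rewrite /ph.
  by have [-> _] := h x2; have [-> _] := h' x1; rewrite mulr0 addr0 mulr1.
have intD p E D : has_deriv E D -> continuous D -> E p = 0 -> E (p + r) = 1 ->
    \int[mu]_(x in `[p, p + r]) D x = 1.
  by move=> hE cD E0 E1; rewrite (ftc _ hE cD) ?E0 ?E1 ?subr0// lerDl ltW.
have IDa : \int[mu]_(x in `[al, al + r]) Da x = 1.
  apply: (intD _ _ _ hda cDa); first by have [_ _ h _] := Pa al; have [] := h (lexx _).
  by have [_ _ _ h] := Pa (al + r); have [] := h (lexx _).
have IDb : \int[mu]_(x in `[be, be + r]) Db x = 1.
  apply: (intD _ _ _ hdb cDb); first by have [_ _ h _] := Pb be; have [] := h (lexx _).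
  by have [_ _ _ h] := Pb (be + r); have [] := h (lexx _).
have Ba : forall x, 0 <= Da x <= c / r by move=> x; have [] := Pa x.
have Bb : forall x, 0 <= Db x <= c / r by move=> x; have [] := Pb x.
have := step_avg _ _ _ _ _ r0 (intgS (measurable_itv _) (measurable_itv _) subA Ifm) cDa Ba IDa.
have := step_avg _ _ _ _ _ r0 (intgS (measurable_itv _) (measurable_itv _) subB Ifm) cDb Bb IDb.
have gs D : measurable D -> D `<=` `[al, be + r]%classic -> intg D (fun x => g x * ph x) /\ intg D g.
  by move=> mD sD; split; exact: intgS sD _.
have gb D : measurable D -> D `<=` `[al, be + r]%classic ->
    `|\int[mu]_(x in D) (g x * ph x)| <= \int[mu]_(x in D) `|g x| /\
    `|\int[mu]_(x in D) g x| <= \int[mu]_(x in D) `|g x|.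
  move=> mD sD; have [h1 h2] := gs D mD sD; split; last exact: le_normr_Rintegral.
  apply: Rint_bnd => //; first exact: intg_norm.
  by move=> x _; rewrite normrM ler_piMr.
have [] := gb _ (measurable_itv _) subA; have [+ _] := gb _ (measurable_itv _) subB.
have := Hg al (al + r) (lexx _) o1 am ga.
have := Hg be (be + r) (ltW ab) o4 bm gb'.
have ce : (2 * c + 3) * e = e1 by rewrite /e; field; rewrite gt_eqF.
move=> p1 p2 p3 p4 p5 p6 p7 E n1 n2; rewrite -ce.
exact: du_bois_reymond_arith c0 r0 p1 p2 p3 p4 p5 p6 p7 E n1 n2.
Qed.

End WeakDerivative.

(** * The L2 norm *)
Section L2norm.
Context {R : realType}.
Local Notation mu := (@lebesgue_measure R).
Local Notation Re := complex.Re.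
Local Notation Im := complex.Im.

Lemma L2normE (a b : R) (f : R -> R[i]) : L2norm a b f =
  ((\int[mu]_(x in `]a, b[) (Re (f x) ^+ 2 + Im (f x) ^+ 2)%:E) `^ 2^-1)%E.
Proof.
rewrite /L2norm unlock; congr (_ `^ _)%E; rewrite [RHS]integral_mkcond; apply: eq_integral => x _ /=.
rewrite (powR_mulrn 2)// !patchE; case: ifPn => _; last by rewrite normr0 expr0n.
by case: (f x) => c d /=; rewrite ger0_norm ?sqrtr_ge0// sqr_sqrtr// addr_ge0 ?sqr_ge0.
Qed.

Lemma poweR_half_lt (x : \bar R) (e : R) : (0 <= x)%E -> 0 < e ->
  (x `^ 2^-1 < e%:E)%E -> (x < (e ^+ 2)%:E)%E.
Proof.
move=> + e0 h; have : (x < +oo)%E.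
  by apply: (lty_poweRy (r := 2^-1)); [apply/eqP; lra|exact: lt_trans h (ltry _)].
move: h; case: x => [v| |] //=; move=> h _; rewrite lee_fin => v0; move: h; rewrite !lte_fin powR12_sqrt// => h.
by rewrite -(sqr_sqrtr v0) ltr_pXn2r// nnegrE ?sqrtr_ge0// ltW.
Qed.

Lemma meas_normc2 D (f : R -> R[i]) : measurable_fun D (fun x => Re (f x)) ->
  measurable_fun D (fun x => Im (f x)) ->
  measurable_fun D (fun x => Re (f x) ^+ 2 + Im (f x) ^+ 2).
Proof. by move=> m1 m2; apply: measurable_funD; exact: meas_sq. Qed.

Lemma L2norm_lt (a b : R) (f : R -> R[i]) (e : R) : 0 < e ->
  measurable_fun `]a, b[ (fun x => Re (f x)) -> measurable_fun `]a, b[ (fun x => Im (f x)) ->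
  (L2norm a b f < e%:E)%E ->
  [/\ L2 `]a, b[ (fun x => Re (f x)), L2 `]a, b[ (fun x => Im (f x)),
   \int[mu]_(x in `]a, b[) (Re (f x) ^+ 2) <= e ^+ 2 & \int[mu]_(x in `]a, b[) (Im (f x) ^+ 2) <= e ^+ 2].
Proof.
move=> e0 m1 m2; rewrite L2normE.
have p0 x : 0 <= Re (f x) ^+ 2 + Im (f x) ^+ 2 by rewrite addr_ge0 ?sqr_ge0.
move=> /(poweR_half_lt _ _ _ e0) => h.
have {}h : (\int[mu]_(x in `]a, b[) (Re (f x) ^+ 2 + Im (f x) ^+ 2)%:E < (e ^+ 2)%:E)%E.
  by apply: h; apply: integral_ge0 => x _; rewrite lee_fin.
have I2 : intg `]a, b[ (fun x => Re (f x) ^+ 2 + Im (f x) ^+ 2).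
  apply/integrableP; split; first by apply/measurable_EFinP; exact: meas_normc2.
  apply: le_lt_trans (lt_trans h (ltry _)); apply: ge0_le_integral => //.
  - by apply/measurable_EFinP; apply: measurableT_comp => //; exact: meas_normc2.
  - by apply/measurable_EFinP; exact: meas_normc2.
  - by move=> x _ /=; rewrite lee_fin ger0_norm.
have h2 : \int[mu]_(x in `]a, b[) (Re (f x) ^+ 2 + Im (f x) ^+ 2) <= e ^+ 2.
  by rewrite -lee_fin /Rintegral fineK ?integral_fune_fin_num//; exact: ltW.
have I3 : intg `]a, b[ (fun x => Re (f x) ^+ 2).
  apply: (intg_le _ (meas_sq m1) I2) => // x _.
  by rewrite ger0_norm ?sqr_ge0// lerDl sqr_ge0.
have I4 : intg `]a, b[ (fun x => Im (f x) ^+ 2).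
  apply: (intg_le _ (meas_sq m2) I2) => // x _.
  by rewrite ger0_norm ?sqr_ge0// lerDr sqr_ge0.
split => //; apply: le_trans h2; apply: le_Rintegral => // x _; rewrite ?lerDl ?lerDr sqr_ge0//.
Qed.

Lemma inL2P (a b : R) (f : R -> R[i]) :
  inL2 a b f <-> L2 `]a, b[ (fun x => Re (f x)) /\ L2 `]a, b[ (fun x => Im (f x)).
Proof.
split=> [[m1 m2]|[L1 L2']].
  rewrite -ge0_fin_numE ?Lnorm_ge0// => /fineK hE.
  have h : (L2norm a b f < (fine (L2norm a b f) + 1)%:E)%E by rewrite -[X in (X < _)%E]hE lte_fin ltrDl.
  by have [] := L2norm_lt _ _ _ _ _ m1 m2 h; rewrite ?ltr_wpDl// fine_ge0// Lnorm_ge0.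
have [m1 i1] := L1; have [m2 i2] := L2'; split => //.
rewrite L2normE; apply: poweR_lty.
have := intgD (measurable_itv _) i1 i2 => /integrableP[_].
by under eq_integral => x _ do rewrite /= ger0_norm ?addr_ge0 ?sqr_ge0//.
Qed.

Lemma L2_of_inL2_real (a b : R) (f : R -> R) : inL2 a b (fun x => (f x)%:C%C) -> L2 `]a, b[ f.
Proof. by move=> /inL2P[]. Qed.

(** Data are given on open intervals, while the absolutely continuous calculus works on closed ones;
    extension by zero passes from one to the other. *)
Lemma L2_patch (a b : R) (f : R -> R) : L2 `]a, b[ f -> measurable_fun setT (f \_ `]a, b[) /\ L2 `[a, b] (f \_ `]a, b[).
Proof.
move=> Lf; have mh : measurable_fun setT (f \_ `]a, b[) by apply/(measurable_restrictT _ _).1 => //; case: Lf.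
split => //; split; first exact: measurable_funS mh.
have -> : (fun x => (f \_ `]a, b[) x ^+ 2) = (fun x => f x ^+ 2) \_ `]a, b[.
  by apply/funext => x; rewrite !patchE; case: ifP => // _; exact: expr0n.
rewrite /intg -restrict_EFin; apply/integrable_restrict => //.
by rewrite setIidr; [case: Lf|exact: subset_itv_oo_cc].
Qed.

End L2norm.

(** * The C2 representative of mu *)
Section Representative.
Context {R : realType}.
Local Notation mu := (@lebesgue_measure R).
Local Notation U := (`]0, 1[%classic : set R).
Implicit Types (f g h : R -> R).

Definition ae01 (P : R -> Prop) := {ae mu, forall x : R, 0 < x < 1 -> P x}.

Lemma aeS (P Q : R -> Prop) : (forall x, P x -> Q x) -> {ae mu, forall x, P x} -> {ae mu, forall x, Q x}.
Proof. have Fae := ae_filter_ringOfSetsType mu; move=> PQ hP; exact: filterS PQ hP. Qed.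

Lemma aeS2 (P Q S : R -> Prop) : (forall x, P x -> Q x -> S x) -> {ae mu, forall x, P x} ->
  {ae mu, forall x, Q x} -> {ae mu, forall x, S x}.
Proof. have Fae := ae_filter_ringOfSetsType mu; move=> PQ hP hQ; exact: filterS2 PQ hP hQ. Qed.

Lemma ae_point (P : R -> Prop) (a b : R) : a < b -> {ae mu, forall x, P x} -> exists2 x, a < x < b & P x.
Proof.
move=> ab [N [mN N0 sN]]; apply: contrapT => h.
have sub : `]a, b[%classic `<=` N.
  by move=> x; rewrite /= in_itv/= => xab; apply: sN => /= hx; apply: h; exists x.
have : (mu `]a, b[%classic <= mu N)%E by apply: le_measure; rewrite ?inE.
by rewrite N0 lebesgue_measure_itv/= lte_fin ab leNgt -EFinB lte_fin subr_gt0 ab.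
Qed.

Lemma Rint_ae D f g : measurable D -> measurable_fun D f -> measurable_fun D g ->
  {ae mu, forall x, D x -> f x = g x} -> \int[mu]_(x in D) f x = \int[mu]_(x in D) g x.
Proof.
move=> mD mf mg fg; rewrite /Rintegral; congr fine; apply: ae_eq_integral => //.
- exact/measurable_EFinP.
- exact/measurable_EFinP.
- by apply: aeS fg => x h Dx /=; rewrite h.
Qed.

(** One right Lebesgue point is fixed as base point; comparing every other such point with it
    identifies the constant. *)
Lemma du_bois_reymond_ae f g (A : R -> R) : intg U f -> weak_derivative 0 1 f g ->
  (forall al be, 0 < al -> al < be -> be < 1 -> \int[mu]_(x in `[al, be]) g x = A be - A al) ->
  exists k, ae01 (fun x => f x = A x + k).
Proof.
move=> If W HA; have h := ae_lebesgue_right _ If.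
have [x0 /andP[x00 x01] r0'] := ae_point _ _ _ ltr01 h; have r0 := r0' ltac:(apply/andP; split; lra).
exists (f x0 - A x0); apply: aeS h => x hx x1; have rx := hx x1; case/andP: x1 => xx0 xx1.
have [xl|xl|<-] := ltgtP x x0; last by rewrite addrC subrK.
  have := du_bois_reymond _ _ _ _ If W xx0 xl x01 rx r0; rewrite HA//; lra.
have := du_bois_reymond _ _ _ _ If W x00 xl xx1 r0 rx; rewrite HA//; lra.
Qed.

Lemma ae01_meas_int f (F : R -> R) (al be : R) : 0 < al -> be < 1 -> measurable_fun U f -> continuous F ->
  ae01 (fun x => f x = F x) -> \int[mu]_(x in `[al, be]) f x = \int[mu]_(x in `[al, be]) F x.
Proof.
move=> al0 be1 mf cF h; have sub := sub_cc_oo _ _ al0 be1.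
apply: Rint_ae => //; [exact: measurable_funS mf|exact: meas_cts|].
apply: aeS h => x hx /sub; rewrite /= in_itv/=; exact: hx.
Qed.

Lemma du_bois_reymond_cts f g (G : R -> R) : intg U f -> weak_derivative 0 1 f g ->
  measurable_fun U g -> continuous G -> ae01 (fun x => g x = G x) ->
  exists2 F, has_deriv F G & ae01 (fun x => f x = F x).
Proof.
move=> If W mg cG gG; have [F dF] := antideriv cG.
have [|k hk] := du_bois_reymond_ae f g F If W; last first.
  exists (fun x => F x + k) => //.
  by apply: (hder_eq _ (hderD dF (hder_cst k))) => x; rewrite addr0.
move=> al be al0 ab be1; rewrite (ae01_meas_int _ _ _ _ al0 be1 mg cG gG).
by rewrite (ftc (ltW ab) dF cG).
Qed.

(** Here [g] itself takes the place of the control: with weight [1 + |g|] it has a continuous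
    primitive. *)
Lemma du_bois_reymond_L2 f g : intg U f -> weak_derivative 0 1 f g -> L2 U g ->
  exists2 F, continuous F & ae01 (fun x => f x = F x).
Proof.
move=> If W Lg; pose h := g \_ `]0, 1[.
have hE x : 0 < x < 1 -> h x = g x by move=> x01; rewrite /h patchE ifT// inE/= in_itv.
have [_ Lh] := L2_patch _ _ _ Lg.
have [A A0 hA] := acf_exists 1 h ler01 Lh h (dom_u _ _ Lh).
have [|k hk] := du_bois_reymond_ae f g A If W; last first.
  have [cA _] := hA; exists (fun x => A x + k); last exact: hk.
  by apply: ctsD => //; exact: cts_cst.
move=> al be al0 ab be1; rewrite (acf_incr _ _ Lh _ _ _ _ hA (ltW al0) (ltW ab) (ltW be1)).
apply: Rint_eq => x /=; rewrite in_itv/= => /andP[x1 x2]; rewrite hE//; apply/andP; split; lra.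
Qed.

Lemma oo_intg f : L2 U f -> intg U f.
Proof. by apply: L2_intg => //; exact: mu_oo_fin. Qed.

(** Regularity climbs down from the top: the second derivative has a continuous representative since
    the third is in L2, and integrating it twice represents the first derivative and [m]. The weak
    derivative [g] is retained in order to identify any other one. *)
Lemma sobolev3_C2 (m : R -> R) : sobolev 0 1 3 m -> exists (M M1 M2 : R -> R), [/\ has_deriv M M1,
  has_deriv M1 M2, continuous M2, L2 U m & ae01 (fun x => m x = M x) /\
  exists g, [/\ weak_derivative 0 1 m g, measurable_fun U g & ae01 (fun x => g x = M1 x)]].
Proof.
move=> [/L2_of_inL2_real L0 [g1 W1 [/L2_of_inL2_real L1 [g2 W2 [/L2_of_inL2_real L2' [g3 W3 [/L2_of_inL2_real L3 _]]]]]]].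
have [M2 cM2 e2] := du_bois_reymond_L2 _ _ (oo_intg _ L2') W3 L3.
have [M1 d1 e1] := du_bois_reymond_cts _ _ _ (oo_intg _ L1) W2 L2'.1 cM2 e2.
have [M d0 e0] := du_bois_reymond_cts _ _ _ (oo_intg _ L0) W1 L1.1 (hder_cts d1) e1.
by exists M, M1, M2; split => //; split => //; exists g1; split => //; exact: L1.1.
Qed.

Lemma test_cts (ph : R -> R) : test_function 0 1 ph -> continuous ph.
Proof.
move=> [d _] x; have := d 0%N x; rewrite derive1n0 => dx.
exact/differentiable_continuous/derivable1_diffP.
Qed.

(** * Uniqueness of weak derivatives *)

Lemma weak_uniq f g h : weak_derivative 0 1 f g -> weak_derivative 0 1 f h ->
  weak_derivative 0 1 (fun=> 0) (fun x => g x - h x).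
Proof.
move=> [_ lg Wg] [_ lh Wh]; split.
- split; [exact: measurable_cst|by have [] := lg|move=> K _ _].
  by rewrite integral0_eq// => x _; rewrite normr0.
- exact: locally_integrableB.
- move=> ph tph; have cph := test_cts _ tph.
  have [_ [c [d [c0 d1 ph0]]]] := tph.
  have := Wg _ tph; rewrite (Wh _ tph) => /oppr_inj E.
  rewrite Rint0; last by move=> x _; rewrite mul0r.
  have sub := sub_cc_oo _ _ c0 d1.
  have S k : \int[mu]_(x in `]0, 1[) (k x * ph x) = \int[mu]_(x in `[c, d]) (k x * ph x).
    by apply: Rint_supp => // x _ /= /negP /ph0 ->; rewrite mulr0.
  rewrite S; rewrite !S in E.
  rewrite (_ : \int[mu]_(x in _) _ = \int[mu]_(x in `[c, d]) (g x * ph x - h x * ph x)).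
    rewrite RintB//; first by rewrite E subrr oppr0.
      by apply: intgMc => //; exact: loc_intg lg sub.
    by apply: intgMc => //; exact: loc_intg lh sub.
  by apply: Rint_eq => x _; rewrite mulrBl.
Qed.

(** For the zero function every point is a right Lebesgue point, so [du_bois_reymond] holds between
    any two points. *)
Lemma weak0_int k (al be : R) : weak_derivative 0 1 (fun=> 0) k -> 0 < al -> al < be -> be < 1 ->
  \int[mu]_(x in `[al, be]) k x = 0.
Proof.
move=> W a0 ab b1; have r0 p : lebesgue_right (fun=> 0 : R) p.
  move=> e e0; exists 1 => // r r0 _; rewrite Rint0; last by move=> x _; rewrite subrr normr0.
  by rewrite mulr_ge0// ltW.
rewrite -(du_bois_reymond _ _ _ _ _ W a0 ab b1 (r0 _) (r0 _)) ?subrr//.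
by apply: intg_cst => //; exact: mu_oo_fin.
Qed.

(** The primitive of [k] cut off to [c, d] vanishes on (c, d), while its derivative is [k] almost
    everywhere there. *)
Lemma int0_ae_sub k (c d : R) : locally_integrable `]0, 1[ k ->
  (forall al be, 0 < al -> al < be -> be < 1 -> \int[mu]_(x in `[al, be]) k x = 0) ->
  0 < c -> d < 1 -> {ae mu, forall x, c < x < d -> k x = 0}.
Proof.
move=> lk W c0 d1.
have Ik := loc_intg _ _ _ _ lk (sub_cc_oo _ _ c0 d1).
have locK := integrable_locally_restrict (measurable_itv `[c, d]) Ik.
pose K := k \_ `[c, d].
have IK : intg setT K by rewrite /intg -restrict_EFin; apply/integrable_restrict => //; rewrite setTI.
have IKy y : intg `]-oo, y] K by apply: intgS IK.
have FT := @FTC1 R K -oo%O IKy locK; rewrite /= in FT; apply: aeS FT => x /(_ (ltNyr _)) [dF eF] /andP[cx xd].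
have kx : K x = k x by rewrite /K patchE ifT// inE/= in_itv/= !ltW.
rewrite -kx -eF derive1E; set F := fun x => _.
have FE y : c < y -> y < d -> F y = 0.
  move=> cy yd; rewrite /F (@Rint_supp _ _ `[c, y]) => [|z /=|z /=].
  - rewrite -(W _ _ c0 cy (lt_trans yd d1)); apply: Rint_eq => z /=; rewrite in_itv/= => /andP[z1 z2].
    by rewrite /K patchE ifT// inE/= in_itv/= z1 (le_trans z2)// ltW.
  - by rewrite !in_itv/= => /andP[].
  - rewrite !in_itv/= => zy nz; rewrite /K patchE ifN//; apply/negP; rewrite inE/= in_itv/= => /andP[z1 _].
    by apply: nz; rewrite z1 zy.
have dF0 : is_derive x (1 : R) F 0.
  have dc : is_derive x (1 : R) (fun=> 0 : R) (0 : R) by exact: is_derive_cst.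
  apply: near_eq_is_derive dc.
  near=> y; rewrite FE//; near: y; [exact: lt_nbhsr|exact: lt_nbhsl].
exact: derive_val.
Unshelve. all: by end_near. Qed.

(** As [k] is only locally integrable, (0, 1) is exhausted by countably many intervals at positive
    distance from its ends. *)
Lemma int0_ae k : locally_integrable `]0, 1[ k ->
  (forall al be, 0 < al -> al < be -> be < 1 -> \int[mu]_(x in `[al, be]) k x = 0) ->
  ae01 (fun x => k x = 0).
Proof.
move=> lk W.
have c0 n : 0 < (n.+2%:R)^-1 :> R by rewrite invr_gt0.
have d1 n : 1 - (n.+2%:R)^-1 < 1 :> R by rewrite ltrBlDr ltrDl.
have H n := int0_ae_sub _ _ _ lk W (c0 n) (d1 n).
have H' : {ae mu, forall x n, (n.+2%:R)^-1 < x < 1 - (n.+2%:R)^-1 -> k x = 0}.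
  exact/ae_foralln.
apply: aeS H' => x h' x01.
have m0 : 0 < Num.min x (1 - x) by rewrite lt_min subr_gt0.
have [N hN] := exists_small 1 _ m0; move: hN; rewrite div1r lt_min => /andP[n1 n2].
have le : (N.+2%:R)^-1 <= (N.+1%:R)^-1 :> R by rewrite lef_pV2 ?posrE// ler_nat.
apply: (h' N); move: le n1 n2; move: (N.+1%:R^-1 : R) (N.+2%:R^-1 : R) => p q le n1 n2; apply/andP; split; lra.
Qed.

Lemma weak_deriv_ae f g h (G : R -> R) : weak_derivative 0 1 f g -> weak_derivative 0 1 f h ->
  ae01 (fun x => h x = G x) -> ae01 (fun x => g x = G x).
Proof.
move=> Wg Wh hG; have W := weak_uniq _ _ _ Wg Wh; have [_ lk _] := W.
have H := int0_ae _ lk (fun al be a0 ab b1 => weak0_int _ _ _ W a0 ab b1).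
apply: aeS2 hG H => x hx h' x01; rewrite -hx//; apply/eqP; rewrite -subr_eq0; apply/eqP; exact: h'.
Qed.

Lemma ae01_cts f g : continuous f -> continuous g -> ae01 (fun x => f x = g x) ->
  forall x, 0 < x < 1 -> f x = g x.
Proof.
move=> cf cg h x /andP[x0 x1]; apply/eqP; rewrite -subr_eq0 -normr_le0; apply/ler_addgt0Pr => e e0.
have cfg : continuous (fun x => f x - g x) by cts.
have /nbhs_ballP[d /= d0 hd] : nbhs x [set y | `|(f x - g x) - (f y - g y)| < e].
  by have /cvgr_dist_lt := cfg x; apply.
pose b := x + Num.min d (1 - x).
have xb : x < b by rewrite ltrDl lt_min d0 subr_gt0.
have [y /andP[y1 y2] hy] := ae_point _ _ _ xb h.
have yd : y < x + d by apply: (lt_le_trans y2); rewrite lerD2l ge_min lexx.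
have y3 : y < 1 by apply: (lt_le_trans y2); rewrite -lerBrDl ge_min lexx orbT.
have := hd y; rewrite /ball/= ltr_distlC => /(_ ltac:(apply/andP; split; lra)).
by rewrite hy ?subrr ?subr0 ?add0r; [exact: ltW|apply/andP; split; lra].
Qed.

End Representative.

(** * Sine coefficients in L2 *)
Section Coefficients.
Context {R : realType}.
Local Notation mu := (@lebesgue_measure R).
Local Notation Re := complex.Re.
Local Notation Im := complex.Im.
Local Notation U := (`]0, 1[%classic : set R).
Implicit Types (f g : R -> R[i]) (c : bool).

(** The boolean selects the real part ([true]) or the imaginary part, so that facts on coefficients
    are proved once; multiplication by [i] becomes negation of the boolean, up to sign. *)
Definition pr c (z : R[i]) : R := if c then Re z else Im z.

Lemma prD c z w : pr c (z + w) = pr c z + pr c w.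
Proof. by case: c z w => [] [? ?] [? ?]. Qed.

Lemma prB c z w : pr c (z - w) = pr c z - pr c w.
Proof. by case: c z w => [] [? ?] [? ?]. Qed.

Lemma prZ c (r : R) z : pr c (r%:C%C * z) = r * pr c z.
Proof. by case: c z => [] [? ?] /=; rewrite mul0r ?subr0 ?addr0. Qed.

Lemma inL2_pr c f : inL2 0 1 f -> L2 U (fun x => pr c (f x)).
Proof. by move=> /inL2P[? ?]; case: c. Qed.

Lemma pr_inL2 f : (forall c, L2 U (fun x => pr c (f x))) -> inL2 0 1 f.
Proof. by move=> h; apply/inL2P; split; [exact: (h true)|exact: (h false)]. Qed.

Lemma L2e j : L2 U (e_ j).
Proof. exact: L2_cts (@e_cts _ _). Qed.

Definition cf c f j := I01 (fun x => pr c (f x) * e_ j x).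

Lemma inner_cf f j : inner f (phi j) = (cf true f j +i* cf false f j)%C.
Proof.
by congr (_ +i* _)%C; apply: Rint_eq => x _; case: (f x) => p q /=;
  rewrite !(oppr0, mulr0, subr0, add0r).
Qed.

Lemma pr_intg c f j : inL2 0 1 f -> intg U (fun x => pr c (f x) * e_ j x).
Proof. by move=> /(inL2_pr c) h; apply: L2M => //; exact: L2e. Qed.

Lemma inL2B f g : inL2 0 1 f -> inL2 0 1 g -> inL2 0 1 (fun x => f x - g x).
Proof.
move=> hf hg; apply: pr_inL2 => c.
have -> : (fun x => pr c (f x - g x)) = (fun x => pr c (f x) - pr c (g x)) by apply/funext => x; rewrite prB.
by apply: L2B => //; exact: inL2_pr.
Qed.

Lemma inL2D f g : inL2 0 1 f -> inL2 0 1 g -> inL2 0 1 (fun x => f x + g x).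
Proof.
move=> hf hg; apply: pr_inL2 => c.
have -> : (fun x => pr c (f x + g x)) = (fun x => pr c (f x) + pr c (g x)) by apply/funext => x; rewrite prD.
by apply: L2D => //; exact: inL2_pr.
Qed.

Lemma cfD c f g j : inL2 0 1 f -> inL2 0 1 g -> cf c (fun x => f x + g x) j = cf c f j + cf c g j.
Proof.
move=> hf hg; rewrite /cf /I01 -RintD//; [|exact: pr_intg|exact: pr_intg].
by apply: Rint_eq => x _; rewrite prD mulrDl.
Qed.

Lemma cfB c f g j : inL2 0 1 f -> inL2 0 1 g -> cf c (fun x => f x - g x) j = cf c f j - cf c g j.
Proof.
move=> hf hg; rewrite /cf /I01 -RintB//; [|exact: pr_intg|exact: pr_intg].
by apply: Rint_eq => x _; rewrite prB mulrBl.
Qed.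

Lemma cf_le c f j (e : R) : (0 < j)%N -> 0 < e -> inL2 0 1 f -> (L2norm 0 1 f < e%:E)%E -> `|cf c f j| <= e.
Proof.
move=> j0 e0 hf; have [m1 m2 _] := hf.
move=> /(L2norm_lt _ _ _ _ e0 m1 m2)[L1 L2' i1 i2].
have Lc : L2 U (fun x => pr c (f x)) by case: c.
have h := CSn (measurable_itv _) Lc (L2e j); apply: (le_trans h).
have -> : n2 U (e_ j) = 1.
  have E : \int[mu]_(x in U) (e_ j x ^+ 2) = 1 by rewrite -[RHS](@e_norm R j j0); apply: Rint_eq => x _; rewrite expr2.
  by rewrite /n2 E sqrtr1.
rewrite mulr1 /n2 -[leRHS](ger0_norm (ltW e0)) -sqrtr_sqr ler_sqrt ?sqr_ge0//.
by case: c {Lc h}.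
Qed.

Lemma cf_ae c f g j : inL2 0 1 f -> inL2 0 1 g -> ae01 (fun x => f x = g x) -> cf c f j = cf c g j.
Proof.
move=> hf hg fg; apply: Rint_ae => //; try exact: (intg_meas (pr_intg _ _ _ _)).
by apply: aeS fg => x h; rewrite /= in_itv/= => /h ->.
Qed.

Lemma prM c (r z : R[i]) : pr c (r * z) = Re r * pr c z + (if c then - Im r else Im r) * pr (~~ c) z.
Proof. by case: c r z => [] [? ?] [? ?] /=; rewrite ?mulNr. Qed.

Lemma inL2Z (r : R[i]) f : inL2 0 1 f -> inL2 0 1 (fun x => r * f x).
Proof.
move=> hf; apply: pr_inL2 => c.
rewrite (_ : (fun x => _) = fun x => Re r * pr c (f x) + (if c then - Im r else Im r) * pr (~~ c) (f x)).
  by apply: L2D => //; apply: L2Z => //; exact: inL2_pr.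
by apply/funext => x; rewrite prM.
Qed.

Lemma cfZ c (r : R[i]) f j : inL2 0 1 f ->
  cf c (fun x => r * f x) j = Re r * cf c f j + (if c then - Im r else Im r) * cf (~~ c) f j.
Proof.
move=> hf; rewrite /cf /I01 -!RintZ//; try exact: pr_intg.
rewrite -RintD//; try (apply: intgZ => //; exact: pr_intg).
by apply: Rint_eq => x _; rewrite prM mulrDl !mulrA.
Qed.

Lemma inL2_sum (I : Type) (s : seq I) (F : I -> R -> R[i]) : (forall i, inL2 0 1 (F i)) ->
  inL2 0 1 (fun x => \sum_(i <- s) F i x) /\
  forall c j, cf c (fun x => \sum_(i <- s) F i x) j = \sum_(i <- s) cf c (F i) j.
Proof.
move=> hF; elim: s => [|i s [IH1 IH2]].
  have E : (fun x : R => \sum_(i <- [::]) F i x) = fun=> 0 by apply/funext => x; rewrite big_nil.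
  rewrite E; split.
    by apply: pr_inL2 => c; apply: L2_cts; case: c; exact: cts_cst.
  by move=> c j; rewrite big_nil /cf; apply: Rint0 => x _; case: c => /=; rewrite mul0r.
have E : (fun x : R => \sum_(i <- i :: s) F i x) = fun x => F i x + \sum_(i <- s) F i x.
  by apply/funext => x; rewrite big_cons.
rewrite E; split.
  exact: inL2D.
by move=> c j; rewrite big_cons -IH2 cfD.
Qed.

Lemma inL2_phi k : inL2 0 1 (@phi R k).
Proof.
by apply: pr_inL2; case; [exact: (L2e k)|apply: L2_cts; exact: cts_cst].
Qed.

Lemma cf_phi c k j : (0 < j)%N -> cf c (@phi R k) j = (c && (k == j))%:R.
Proof.
move=> j0; rewrite /cf; case: c => /=; last by apply: Rint0 => x _; rewrite mul0r.
have [->|kj] := eqVneq k j; first exact: e_norm.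
exact: e_orth.
Qed.

(** A coefficient is continuous for the L2 distance, and that of the spectral sum no longer changes
    once the sum contains the index [j]. *)
Lemma cf_group c (t : R) f g j : (0 < j)%N -> schrodinger_group t f g ->
  cf c g j = cos (lambda j * t) * cf c f j + (if c then 1 else -1) * sin (lambda j * t) * cf (~~ c) f j.
Proof.
move=> j0 [hf hg hl].
set rhs := (X in _ = X).
apply/eqP; rewrite -subr_eq0 -normr_le0; apply/ler_addgt0Pr => e e0; rewrite add0r.
have /= [N _ hN] := cvg0_lt _ _ hl e0.
pose n := maxn N j; have := hN n (leq_maxl _ _).
pose r k := cexpi (- (lambda k * t)) * inner f (phi k).
have [S1 S2] := inL2_sum _ (index_iota 1 n.+1) (fun k x => r k * phi k x) (fun k => inL2Z (r k) _ (inL2_phi k)).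
have h1 := inL2B _ _ hg S1.
move=> /(cf_le c _ _ _ j0 e0 h1); rewrite (cfB _ _ _ _ hg S1) S2.
suff -> : \sum_(k <- index_iota 1 n.+1) cf c (fun x => r k * phi k x) j = rhs by [].
rewrite (bigD1_seq j) ?iota_uniq//=; last by rewrite mem_index_iota j0 ltnS leq_maxr.
rewrite big1 ?addr0 => [|k kj]; last first.
  by rewrite (cfZ _ _ _ _ (inL2_phi k)) !cf_phi// (negbTE kj) !andbF !mulr0 addr0.
rewrite (cfZ _ _ _ _ (inL2_phi j)) !cf_phi// eqxx !andbT /rhs /r inner_cf /cexpi cosN sinN.
by case: (c) => /=; ring.
Qed.

Lemma cf_leE c f j : (0 < j)%N -> inL2 0 1 f -> (`|cf c f j|%:E <= L2norm 0 1 f)%E.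
Proof.
move=> j0 hf; apply/lee_addgt0Pr => e e0; have [_ _ fin] := hf.
have n0 : (0 <= L2norm 0 1 f)%E by exact: Lnorm_ge0.
move: (fin) n0 (fun e e0 => cf_le c f j e j0 e0 hf); case: (L2norm 0 1 f) => [v| |]// _.
rewrite lee_fin => v0 h; rewrite -EFinD lee_fin; apply: h; first by lra.
by rewrite lte_fin ltrDl.
Qed.

Lemma cfR c (r : R) f j : inL2 0 1 f -> cf c (fun x => r%:C%C * f x) j = r * cf c f j.
Proof.
move=> hf; rewrite /cf /I01 -RintZ//; last exact: pr_intg.
by apply: Rint_eq => x _; rewrite prZ mulrA.
Qed.

Lemma Rint_bigsum (I : Type) (s : seq I) (F : I -> R -> R) D : measurable D -> (forall i, intg D (F i)) ->
  intg D (fun x => \sum_(i <- s) F i x) /\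
  \int[mu]_(x in D) (\sum_(i <- s) F i x) = \sum_(i <- s) \int[mu]_(x in D) F i x.
Proof.
move=> mD hF; elim: s => [|i s [IH1 IH2]].
  have E : (fun x : R => \sum_(i <- [::]) F i x) = fun=> 0 by apply/funext => x; rewrite big_nil.
  rewrite E big_nil; split; first exact: integrable0.
  exact: Rint0.
have E : (fun x : R => \sum_(i <- i :: s) F i x) = fun x => F i x + \sum_(i <- s) F i x.
  by apply/funext => x; rewrite big_cons.
by rewrite E big_cons -IH2; split; [exact: intgD|rewrite RintD].
Qed.

Lemma Rint_indic D (a b v : R) : measurable D ->
  intg `]a, b[ (fun x => \1_D x * v) /\
  \int[mu]_(x in `]a, b[) (\1_D x * v) = fine (mu (D `&` `]a, b[%classic)) * v.
Proof.
move=> mD.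
have I1 : intg `]a, b[ (\1_D : R -> R).
  apply: (intg_bnd (C := 1)) => //; [exact: mu_oo_fin|].
  by move=> x _; rewrite indicE; case: (_ \in _); rewrite ?normr1 ?normr0.
have E : (fun x => \1_D x * v) = (fun x => v * \1_D x : R) by apply/funext => x; rewrite mulrC.
rewrite E; split; first exact: intgZ.
by rewrite RintZ// mulrC /Rintegral integral_indic.
Qed.

(** Coefficient and integral commute exactly on simple functions; by [cf_leE] both approximation
    errors are bounded by the L2 distances in the definition of the Bochner integral. *)
Lemma cf_bochner c (t : R) (F : R -> R -> R[i]) (G : R -> R[i]) j : (0 < j)%N -> 0 <= t ->
  bochner_integral 0 t F G -> intg `]0, t[ (fun tau => cf c (F tau) j) ->
  cf c G j = \int[mu]_(tau in `]0, t[) cf c (F tau) j.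
Proof.
move=> j0 t0 [hF hG [S [S1 S2 S3]]] If.
apply/eqP; rewrite -subr_eq0 -normr_le0; apply/ler_addgt0Pr => e e0; rewrite add0r.
have e2 : 0 < e / 2 by lra.
have /= [N2 _ hN2] := cvg0_lt _ _ S2 e2; have /= [N3 _ hN3] := cvg0_lt _ _ S3 e2.
pose n := maxn N2 N3; have {hN2} h2 := hN2 n (leq_maxl _ _); have {hN3} h3 := hN3 n (leq_maxr _ _).
move: (S n) (S1 n) h2 h3 => {S S1 S2 S3} S iS h2 h3.
pose m i : R := fine (mu (@simple_dom _ S i `&` `]0, t[%classic)).
pose v i := cf c (@simple_val _ S i) j.
have hv i : inL2 0 1 (@simple_val _ S i) := @simple_val_inL2 _ S i.
have [A1 A2] := inL2_sum _ (index_enum _) (fun i x => (m i)%:C%C * @simple_val _ S i x) (fun i => inL2Z _ _ (hv i)).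
have hB tau := inL2_sum _ (index_enum _) (fun i x => (\1_(@simple_dom _ S i) tau)%:C%C * @simple_val _ S i x) (fun i => inL2Z _ _ (hv i)).
have mt : measurable (`]0, t[%classic : set R) by [].
have hC i := Rint_indic _ 0 t (v i) (@simple_dom_measurable _ S i).
have [C1 C2] := Rint_bigsum _ (index_enum _) (fun i tau => \1_(@simple_dom _ S i) tau * v i) _ mt (fun i => (hC i).1).
have EG : cf c (simple_integral 0 t S) j = \int[mu]_(tau in `]0, t[) cf c (simple_eval S tau) j.
  rewrite (A2 c j) (_ : Rintegral _ _ _ = \int[mu]_(tau in `]0, t[) (\sum_i \1_(@simple_dom _ S i) tau * v i)).
    by rewrite C2; apply: eq_bigr => i _; rewrite cfR// (hC i).2.
  by apply: Rint_eq => tau _; rewrite (hB tau).2; apply: eq_bigr => i _; rewrite cfR.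
have IS : intg `]0, t[ (fun tau => cf c (simple_eval S tau) j).
  by apply: intg_eq C1 => tau _; rewrite (hB tau).2; apply: eq_bigr => i _; rewrite cfR.
have := cf_le c _ _ _ j0 e2 (inL2B _ _ hG A1) h3; rewrite (cfB _ _ _ _ hG A1) EG => q1.
have Id := intgB mt If IS.
have q2 : `|\int[mu]_(tau in `]0, t[) (cf c (F tau) j - cf c (simple_eval S tau) j)| <= e / 2.
  apply: (le_trans (le_normr_Rintegral _ _)) => //.
  rewrite -lee_fin /Rintegral fineK; last by apply: integral_fune_fin_num => //; exact: intg_norm.
  apply: le_trans (ltW h2); apply: ge0_le_integral => //.
  - by apply/measurable_EFinP; apply: measurableT_comp => //; exact: intg_meas Id.
  - by case/integrableP: iS.
  - move=> tau taut; have hFt : inL2 0 1 (F tau) by apply: hF; rewrite inE.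
    by rewrite -(cfB _ _ _ _ hFt (hB tau).1); apply: cf_leE => //; exact: inL2B (hB tau).1.
rewrite (RintB mt If IS) in q2.
move: q1 q2; move: (cf c G j) (Rintegral _ _ _) (Rintegral _ _ _) => x1 x2 x3.
by rewrite !ler_norml => /andP[? ?] /andP[? ?]; apply/andP; split; lra.
Qed.

(* Integrating [r] twice, with constants making the result vanish at 0 and 1,
   gives a continuous function with zero sine coefficients. *)
Lemma coef_unique (r : R -> R) : L2 U r -> (forall j, (0 < j)%N -> I01 (fun x => r x * e_ j x) = 0) ->
  ae01 (fun x => r x = 0).
Proof.
move=> Lr hr; pose h := r \_ `]0, 1[.
have hE x : 0 < x < 1 -> h x = r x by move=> x01; rewrite /h patchE ifT// inE/= in_itv.
have [_ Lh] := L2_patch _ _ _ Lr.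
have [A A0 hA] := acf_exists 1 h ler01 Lh h (dom_u _ _ Lh).
have [cA _ _] := hA.
have [B0 dB0] := antideriv cA.
pose B x := B0 x - B0 0 - (B0 1 - B0 0) * x.
have dB : has_deriv B (fun x => A x - (B0 1 - B0 0)).
  apply: (hder_eq _ (hderB (hderB dB0 (hder_cst (B0 0))) (hder_lin (B0 1 - B0 0)))) => x.
  by rewrite subr0.
have B00 : B 0 = 0 by rewrite /B; ring.
have B1 : B 1 = 0 by rewrite /B; ring.
have hB j : I01 (fun x => B x * e_ j x) = 0.
  case: j => [|j]; first by apply: Rint0 => x _; rewrite e0_ mulr0.
  have l0 : 0 < lambda j.+1 :> R by exact: lambda_gt0.
  have e1 := @hder_e R j.+1; have e2 := @hder_de R j.+1.
  have ce := @e_cts R j.+1; have cd := @de_cts R j.+1.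
  have := @acfM R 1 h ler01 Lh _ _ _ _ hA (acf_der _ _ ler01 _ _ e1 cd).
  move=> [_ _ /(_ 1)]; rewrite e_1 !mulr0 A0 mul0r add0r lexx ler01 => /(_ isT) p1.
  have p2 : \int[mu]_(t in `[0, 1]) (A t * de_ j.+1 t) = 0.
    have I1 := dom_intg _ _ Lh _ 0 1 (domMc _ _ ler01 _ _ (dom_u _ _ Lh) ce) (lexx _) (lexx _).
    have p3 : \int[mu]_(t in `[0, 1]) (e_ j.+1 t * h t) = 0.
      rewrite -Rint_cc_oo// -[RHS](hr j.+1 isT); apply: Rint_eq => x /=.
      by rewrite in_itv/= => x01; rewrite hE// mulrC.
    by move: p1; rewrite RintD//; [rewrite p3 add0r|apply: intg_cts; cts].
  have ck : continuous (fun x => A x - (B0 1 - B0 0)) by cts.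
  have cB := hder_cts dB.
  have := I01_ftc _ _ (hderM dB e2) ltac:(cts).
  rewrite B00 B1 !mul0r subr0 I01D; [|by cts|by cts].
  have -> : I01 (fun x => (A x - (B0 1 - B0 0)) * de_ j.+1 x) = 0.
    rewrite (_ : (fun x => _) = fun x => A x * de_ j.+1 x - (B0 1 - B0 0) * de_ j.+1 x).
      rewrite I01B; [|by cts|by cts]; rewrite I01Z; last exact: cd.
      by rewrite (I01_ftc _ _ e1 cd) e_0 e_1 subrr mulr0 subr0 I01_cc//; cts.
    by apply/funext => x; rewrite mulrBl.
  rewrite add0r (_ : (fun x => _) = fun x => (- lambda j.+1) * (B x * e_ j.+1 x)).
    rewrite I01Z; last by cts.
    by move=> /eqP; rewrite mulf_eq0 oppr_eq0 (gt_eqF l0) => /eqP.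
  by apply/funext => x; ring.
(* Since [B] vanishes on (0, 1), [A] is constant there, so [r] has zero integral over every compact
   subinterval. *)
have B01 := sine_unique _ (hder_cts dB) hB.
have Ak x : 0 < x < 1 -> A x = B0 1 - B0 0.
  move=> /andP[x0 x1]; have d1 := dB x.
  have d0 : is_derive x (1 : R) B 0.
    have dc : is_derive x (1 : R) (fun=> 0 : R) (0 : R) by exact: is_derive_cst.
    apply: near_eq_is_derive dc.
    by near=> y; rewrite B01//; apply/andP; split; near: y; [exact: lt_nbhsr|exact: lt_nbhsl].
  have := @derive_val _ _ _ _ _ _ _ d1; rewrite (@derive_val _ _ _ _ _ _ _ d0) => /esym/eqP.
  by rewrite subr_eq0 => /eqP.
apply: int0_ae; first by apply: open_integrable_locally; [exact: interval_open|exact: oo_intg].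
move=> al be a0 ab b1.
rewrite (_ : Rintegral _ _ _ = \int[mu]_(x in `[al, be]) h x).
  have := acf_incr _ _ Lh _ _ _ _ hA (ltW a0) (ltW ab) (ltW b1).
  by rewrite !Ak ?subrr//; [lra|lra].
by apply: Rint_eq => x /=; rewrite in_itv/= => /andP[x1 x2]; rewrite hE//; lra.
Unshelve. all: by end_near. Qed.

End Coefficients.

(** * Sine coefficients of a mild solution *)
Section MildSolution.
Context {R : realType}.
Local Notation mu := (@lebesgue_measure R).
Local Notation U := (`]0, 1[%classic : set R).

Lemma Hs_coef (f : R -> R[i]) c j (e : R) : (0 < j)%N -> 0 < e -> (Hs0norm 3 f < e%:E)%E ->
  `|cf c f j| * j%:R ^+ 3 <= e.
Proof.
move=> j0 e0; rewrite /Hs0norm => /(poweR_half_lt _ _ _ e0).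
pose w k : \bar R := ((k%:R `^ 3 * Normc.normc (inner f (phi k))) ^+ 2)%:E.
have w0 k : (0 <= w k)%E by rewrite lee_fin sqr_ge0.
rewrite -[X in (X < _)%E]/(\sum_(1 <= k <oo) w k)%E => /(_ (nneseries_ge0 (fun k _ _ => w0 k))) h.
have {h} : (w j <= (e ^+ 2)%:E)%E.
  apply: le_trans (ltW h); apply: le_trans (nneseries_lim_ge j.+1 (fun k _ _ => w0 k)).
  by rewrite big_nat_recr//= leeDr// sume_ge0.
rewrite /w lee_fin powR_mulrn// inner_cf ler_pXn2r ?nnegrE//; last 2 first.
- by rewrite mulr_ge0 ?exprn_ge0// sqrtr_ge0.
- exact: ltW.
apply: le_trans; rewrite mulrC ler_wpM2l ?exprn_ge0//= -sqrtr_sqr ler_sqrt ?addr_ge0 ?sqr_ge0//.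
by case: c; rewrite ?lerDl ?lerDr sqr_ge0.
Qed.

Variables (T : R) (m u : R -> R) (psi : R -> R -> R[i]) (M : R -> R).
Hypotheses (T0 : 0 < T) (Lm : L2 U m) (cM : continuous M) (mM : ae01 (fun x => m x = M x)).
Hypotheses (Lu : L2 `]0, T[ u) (mild : mild_solution T m u (phi 1) psi).

(* The equation constrains [psi t] only for [t] in [[0, T]]; clipping makes the
   coefficients continuous on the whole line. *)
Let clip (t : R) : R := Num.max 0 (Num.min t T).

Lemma clip_in t : 0 <= clip t <= T.
Proof. by rewrite /clip le_max lexx ge_max (ltW T0) ge_min lexx orbT. Qed.

Lemma clip_id t : 0 <= t <= T -> clip t = t.
Proof. by move=> /andP[t0 tT]; rewrite /clip min_l// max_r. Qed.

Lemma clip_lip s t : `|clip s - clip t| <= `|s - t|.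
Proof.
rewrite /clip; wlog st : s t / s <= t.
  by move=> h; have [/h//|/ltW /h] := leP s t; rewrite distrC (distrC t).
have h : Num.max 0 (Num.min s T) <= Num.max 0 (Num.min t T).
  by rewrite !maxEle !minEle; repeat case: ifPn; rewrite -?ltNge; move=> *; lra.
rewrite distrC (distrC s) !ger0_norm ?subr_ge0//.
by rewrite !maxEle !minEle; repeat case: ifPn; rewrite -?ltNge; move=> *; lra.
Qed.

Lemma psi_in t : 0 <= t <= T -> inL2 0 1 (psi t) /\ (Hs0norm 3 (psi t) < +oo)%E.
Proof. by move=> t01; case: mild => + _ _ => /(_ t); rewrite inE/= => /(_ t01) []. Qed.

Lemma psi_near t : 0 <= t <= T -> forall e, 0 < e -> exists2 d : R, 0 < d & forall s, `|s - t| < d -> 0 <= s <= T ->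
  forall c j, (0 < j)%N -> `|cf c (psi s) j - cf c (psi t) j| * j%:R ^+ 3 <= e.
Proof.
move=> t01 e e0; case: mild => _ + _ => /(_ t); rewrite inE/= => /(_ t01) h.
have /nbhs_ballP[d /= d0 hd] : nbhs t (fun s => `[0, T]%classic s -> (Hs0norm 3 (fun x => (psi s x - psi t x)%R) < e%:E)%E).
  have FF : Filter (within `[0, T] (nbhs t)) by apply: within_filter.
  exact: (@cvg0_lt R _ _ FF _ _ h e0).
exists d => // s sd s01 c j j0; rewrite -cfB; [|by have [] := psi_in s s01|by have [] := psi_in t t01].
apply: Hs_coef => //; apply: hd; first by rewrite /ball/= distrC.
by rewrite /= in_itv.
Qed.

(** Near each time the weighted coefficients are bounded by the norm at that time plus a constant;
    compactness of [0, T] makes the bound uniform in time and index. *)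
Lemma psi_bnd : exists2 C : R, 0 <= C & forall t, 0 <= t <= T -> forall c j, (0 < j)%N -> `|cf c (psi t) j| * j%:R ^+ 3 <= C.
Proof.
pose P (C : R) (t : R) := 0 <= t <= T -> forall c j, (0 < j)%N -> `|cf c (psi t) j| * j%:R ^+ 3 <= C.
have /compact_near_coveringP cov := @segment_compact R 0 T.
have : \forall C \near +oo%R, `[0, T]%classic `<=` P C.
  apply: cov => t /=; rewrite in_itv/= => t01.
  have [d d0 hd] := psi_near t t01 1 ltr01.
  have [h1 h2] := psi_in t t01.
  pose H : R := fine (Hs0norm 3 (psi t)) + 1.
  have H0 : 0 <= fine (Hs0norm 3 (psi t)) by apply: fine_ge0; exact: poweR_ge0.
  have hH : (Hs0norm 3 (psi t) < H%:E)%E.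
    rewrite /H EFinD fineK; last by rewrite ge0_fin_numE// poweR_ge0.
    by rewrite lteDl ?lte_fin// ge0_fin_numE// poweR_ge0.
  exists (ball t d, [set C | H + 1 <= C]); first split => /=.
  - exact: nbhsx_ballx.
  - by apply: nbhs_pinfty_ge; exact: num_real.
  move=> [s C] /= [sd HC] s01 c j j0; apply: le_trans HC.
  have q1 := Hs_coef _ c _ _ j0 (ltr_wpDl H0 ltr01) hH.
  have q2 := hd s _ s01 c j j0; rewrite distrC in q2; have {}q2 := q2 sd.
  rewrite addrC -[cf c (psi s) j](subrK (cf c (psi t) j)).
  apply: (le_trans (ler_wpM2r _ (ler_normD _ _))); first exact: exprn_ge0.
  by rewrite mulrDl lerD// distrC.
move=> [C0 [_ hC]]; exists (`|C0| + 1) => [|t t01]; first by rewrite addr_ge0.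
have C1 : C0 < `|C0| + 1 by rewrite (le_lt_trans (ler_norm C0))// ltrDl.
by have := hC _ C1 t; rewrite /= in_itv/= => /(_ t01 t01).
Qed.

Definition ac c j t := cf c (psi (clip t)) j.

Lemma ac0 c t : ac c 0 t = 0.
Proof. by apply: Rint0 => x _; rewrite e0_ mulr0. Qed.

Lemma ac_cts c j : continuous (ac c j).
Proof.
case: j => [|j] t.
  rewrite (_ : ac c 0 = fun=> 0); first exact: cst_continuous.
  by apply/funext => s; exact: ac0.
apply/cvgrPdist_lt => e e0.
have e2 : 0 < e / 2 by lra.
have [d d0 hd] := psi_near _ (clip_in t) _ e2.
apply/nbhs_ballP; exists d => //= s; rewrite /ball/= distrC => std.
have := hd _ (le_lt_trans (clip_lip s t) std) (clip_in s) c j.+1 isT.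
rewrite distrC => h; apply: le_lt_trans (_ : e / 2 < e); last by lra.
by apply: le_trans h; rewrite ler_peMr// exprn_ege1// ler1n.
Qed.

(** Cubic decay is turned into the shifted quadratic decay of [decay]; the factor 4 comes from
    [(x + 1)^2 <= 4 x^3] for [x = j + 1]. *)
Lemma ac_decay : exists2 B : R, 0 <= B & forall c t, decay (fun j => ac c j t) B.
Proof.
have [C C0 hC] := psi_bnd; exists (4 * C); first by rewrite mulr_ge0.
move=> c t [|j]; first by rewrite ac0 normr0 divr_ge0 ?mulr_ge0 ?exprn_ge0.
have := hC _ (clip_in t) c j.+1 isT; rewrite ler_pdivlMr ?exprn_gt0//; move=> h.
apply: (@le_trans _ _ (4 * (`|ac c j.+1 t| * j.+1%:R ^+ 3))); last by rewrite ler_wpM2l.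
rewrite [leRHS]mulrCA ler_wpM2l//.
have -> : j.+2%:R = j.+1%:R + 1 :> R by rewrite -natr1.
have j1 : 1 <= j.+1%:R :> R by rewrite ler1n.
move: (j.+1%:R : R) j1 => x x1; rewrite exprS; nra.
Qed.

(** Both sides are square integrable with the same sine coefficients, so [coef_unique] applies to
    the difference. *)
Lemma psi_repr t : 0 <= t <= T -> forall c, ae01 (fun x => pr c (psi t x) = ssum (fun j => ac c j t) x).
Proof.
move=> t01 c; have [B B0 hB] := ac_decay; have [ht _] := psi_in t t01.
have cs := ssum_cts _ _ (hB c t).
have L1 := inL2_pr c _ ht; have L2' := L2_cts _ cs.
have H := coef_unique (fun x => pr c (psi t x) - ssum (fun j => ac c j t) x) (L2B (measurable_itv _) L1 L2').
have {}H := H _.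
apply: aeS (H _) => [x h x01|j j0]; first by apply/eqP; rewrite -subr_eq0 h.
have E : (fun x => (pr c (psi t x) - ssum (fun j => ac c j t) x) * e_ j x) =
  (fun x => pr c (psi t x) * e_ j x - ssum (fun j => ac c j t) x * e_ j x) by apply/funext => x; rewrite mulrBl.
rewrite E /I01 RintB//; [|exact: pr_intg|apply: L2M => //; exact: L2e].
rewrite -/(I01 (fun x => ssum (fun j => ac c j t) x * e_ j x)) (ssum_coef _ _ _ (hB c t) j0).
by rewrite /ac clip_id// subrr.
Qed.

(** * From Duhamel's formula to equations for the coefficients *)

Definition mP c j t := I01 (fun x => e_ j x * (M x * ssum (fun k => ac c k t) x)).

Lemma mP_cts c j : continuous (mP c j).
Proof.
have [B B0 hB] := ac_decay; apply: fam_I01.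
apply: famM; first by apply: fam_x; exact: (@e_cts R j).
apply: famM; first exact: fam_x.
exact: (@fam_ssum _ (ac c) B (ac_cts c) (hB c)).
Qed.

Lemma mP_cf c j t : 0 <= t <= T -> inL2 0 1 (fun x => (u t * m x)%:C%C * psi t x) ->
  cf c (fun x => (u t * m x)%:C%C * psi t x) j = u t * mP c j t.
Proof.
move=> t01 hL; have [B B0 hB] := ac_decay.
have cs := ssum_cts _ _ (hB c t); have ce := @e_cts R j.
rewrite /mP -I01Z; last by cts.
have c1 : continuous (fun x => u t * (e_ j x * (M x * ssum (fun k => ac c k t) x))) by cts.
apply: Rint_ae => //; [exact: intg_meas (pr_intg _ _ _ hL)|exact: meas_cts|].
apply: aeS2 mM (psi_repr _ t01 c) => x h1 h2; rewrite /= in_itv/= => x01.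
by rewrite prZ h1// h2//; ring.
Qed.

Let v : R -> R := u \_ `]0, T[.

Lemma v_u t : 0 < t < T -> v t = u t.
Proof. by move=> t01; rewrite /v patchE ifT// inE/= in_itv. Qed.

Lemma Lv : L2 `[0, T] v.
Proof. by have [] := L2_patch _ _ _ Lu. Qed.

(** The factor [i] before the Bochner integral exchanges real and imaginary parts, whence the [~~ c]
    and the first sign; the propagator mixes them a second time. *)
Lemma duhamel c j t : (0 < j)%N -> 0 <= t <= T ->
  ac c j t = (if c then cos (lambda j * t) else - sin (lambda j * t)) * (j == 1%N)%:R +
   (if c then -1 else 1) * \int[mu]_(tau in `[0, t]) (v tau * (cos (lambda j * (t - tau)) * mP (~~ c) j tau +
      (if c then -1 else 1) * sin (lambda j * (t - tau)) * mP c j tau)).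
Proof.
move=> j0 t01; have [t0 tT] := andP t01; have [hpsi _] := psi_in t t01.
have [_ _ /(_ t)] := mild; rewrite inE/= => /(_ t01) [g [F [G [hg hF hB ae]]]].
have [_ Ig _] := hg; have [_ IG _] := hB.
rewrite {1}/ac clip_id//.
have IiG := inL2Z 'i%C _ IG.
have E : cf c (psi t) j = cf c g j + (if c then -1 else 1) * cf (~~ c) G j.
  rewrite (cf_ae c _ _ j hpsi (inL2D _ _ Ig IiG)).
    rewrite (cfD _ _ _ _ Ig IiG) cfZ//; case: c => /=; ring.
  by apply: aeS ae => x h x01; apply: h; rewrite in_itv.
have hF' tau : 0 < tau < t -> cf (~~ c) (F tau) j = v tau * (cos (lambda j * (t - tau)) * mP (~~ c) j tau +
      (if c then -1 else 1) * sin (lambda j * (t - tau)) * mP c j tau).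
  move=> tt; have htau : 0 <= tau <= T by lra.
  have sg : schrodinger_group (t - tau) (fun x : R => (u tau * m x)%:C%C * psi tau x) (F tau).
    by apply: hF; rewrite in_itv.
  have [If _ _] := sg.
  have t1 : 0 < tau < T by lra.
  rewrite (cf_group (~~ c) _ _ _ _ j0 sg) (mP_cf (~~ c) j _ htau If) (mP_cf (~~ ~~ c) j _ htau If) negbK (v_u _ t1).
  move: (cos _) (sin _) (mP (~~ c) j tau) (mP c j tau) (u tau); clear => p q r s w.
  by case: c => /=; ring.
have cM' k : continuous (fun tau => cos (lambda j * (t - tau)) * mP (~~ c) j tau +
      k * sin (lambda j * (t - tau)) * mP c j tau).
  have cc : continuous (fun tau => cos (lambda j * (t - tau))) by clear; cts.
  have cs : continuous (fun tau => sin (lambda j * (t - tau))) by clear; cts.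
  exact: (ctsD (ctsM cc (mP_cts (~~ c) j)) (ctsM (ctsM (@cts_cst R k) cs) (mP_cts c j))).
have Iv : intg `[0, t] v.
  by apply: (intgS _ _ _ (L2_intg _ _ Lv)) => //; [apply: subset_itvl; rewrite bnd_simp|exact: mu_cc_fin].
have Ivc := intgMc _ _ _ _ Iv (cM' (if c then -1 else 1)).
rewrite E (cf_group _ _ _ _ _ j0 hg) !cf_phi// (cf_bochner _ _ _ _ _ j0 t0 hB); last first.
  have Ivo := intgS (measurable_itv `]0, t[) (measurable_itv _) (@subset_itv_oo_cc _ _ 0 t) Ivc.
  by apply: intg_eq Ivo => tau; rewrite /= in_itv/= => /hF' ->.
congr (_ + _ * _); first by rewrite (eq_sym j); by case: (c) => /=; rewrite ?mulr0 ?addr0 ?mul0r ?add0r ?mulN1r ?mulNr.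
rewrite -Rint_cc_oo//; apply: Rint_eq => tau; rewrite /= in_itv/=; exact: hF'.
Qed.

Lemma acf_congr (X Y al : R -> R) : acf T v X al -> continuous Y -> (forall t, 0 <= t <= T -> Y t = X t) ->
  acf T v Y al.
Proof.
move=> [_ dX hX] cY XY; split => // t t01; rewrite !XY//; first exact: hX.
by rewrite lexx ltW.
Qed.

(** The addition formulas split the propagator at [t - tau] into functions of [t] times functions of
    [tau]. The coefficients are then products of [C], [S] and primitives, to which the product rule
    applies. *)
Lemma ac_sys j : (0 < j)%N -> [/\ forall c, ac c j 0 = (c && (j == 1%N))%:R,
  acf T v (ac true j) (fun t => lambda j * ac false j t - mP false j t * v t) &
  acf T v (ac false j) (fun t => - lambda j * ac true j t + mP true j t * v t)].
Proof.
move=> j0; set lj : R := lambda j; pose p := mP true j; pose q := mP false j.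
have cp : continuous p := mP_cts true j; have cq : continuous q := mP_cts false j.
pose C t := cos (lj * t); pose S t := sin (lj * t); pose de : R := (j == 1%N)%:R.
have dC : has_deriv C (fun t => - lj * S t).
  by apply: (hder_eq _ (hder_comp (@hder_cos R) (hder_lin lj))) => t; rewrite mulrC mulrN mulNr.
have dS : has_deriv S (fun t => lj * C t).
  by apply: (hder_eq _ (hder_comp (@hder_sin R) (hder_lin lj))) => t; rewrite mulrC.
have cC := hder_cts dC; have cS := hder_cts dS.
have T0' := ltW T0; have dv := dom_u _ _ Lv.
have c1 := ctsD (ctsM cC cq) (ctsM cS cp).
have c2 := ctsD (ctsM cS cq) (ctsN (ctsM cC cp)).
have d1 := domMc _ _ T0' _ _ dv c1; have d2 := domMc _ _ T0' _ _ dv c2.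
(* [N1] and [N2] collect the parts of Duhamel's integral depending on [tau] only, after splitting
   the propagator. *)
have [N1 N10 hN1] := acf_exists T v T0' Lv _ d1.
have [N2 N20 hN2] := acf_exists T v T0' Lv _ d2.
have It t : 0 <= t <= T -> \int[mu]_(x in `[0, t]) ((C x * q x + S x * p x) * v x) = N1 t /\
    intg `[0, t] (fun x => (C x * q x + S x * p x) * v x).
  move=> t01; have [t0 tT] := andP t01; have [_ _ /(_ t t01)] := hN1; rewrite N10 add0r => ->; split => //.
  exact: dom_intg _ _ Lv _ _ _ d1 (lexx _) tT.
have It2 t : 0 <= t <= T -> \int[mu]_(x in `[0, t]) ((S x * q x - C x * p x) * v x) = N2 t /\
    intg `[0, t] (fun x => (S x * q x - C x * p x) * v x).
  move=> t01; have [t0 tT] := andP t01; have [_ _ /(_ t t01)] := hN2; rewrite N20 add0r => ->; split => //.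
  exact: dom_intg _ _ Lv _ _ _ d2 (lexx _) tT.
have E1 t : 0 <= t <= T -> ac true j t = C t * (de + -1 * N1 t) + -1 * (S t * N2 t).
  move=> t01; rewrite duhamel//; have [i1 j1] := It t t01; have [i2 j2] := It2 t t01.
  rewrite (_ : Rintegral _ _ _ = C t * N1 t + S t * N2 t) -/lj -/(C t) -/de; first ring.
  rewrite -i1 -i2 -!RintZ// -RintD//; try exact: intgZ.
  apply: Rint_eq => x _; rewrite /= mulrBr cosB sinB -/(C t) -/(S t) -/(C x) -/(S x) -/(p x) -/(q x).
  by move: (C t) (S t) (C x) (S x) (p x) (q x) (v x) => *; ring.
have E2 t : 0 <= t <= T -> ac false j t = -1 * (S t * (de + -1 * N1 t)) + -1 * (C t * N2 t).
  move=> t01; rewrite duhamel//; have [i1 j1] := It t t01; have [i2 j2] := It2 t t01.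
  rewrite (_ : Rintegral _ _ _ = S t * N1 t + -1 * C t * N2 t) -/lj -/(S t) -/de; first ring.
  rewrite -i1 -i2 -!RintZ// -RintD//; try exact: intgZ.
  apply: Rint_eq => x _; rewrite /= mulrBr cosB sinB -/(C t) -/(S t) -/(C x) -/(S x) -/(p x) -/(q x).
  by move: (C t) (S t) (C x) (S x) (p x) (q x) (v x) => *; ring.
have aC := acf_der T v T0' _ _ dC (ctsM (@cts_cst R (- lj)) cS); have aS := acf_der T v T0' _ _ dS (ctsM (@cts_cst R lj) cC).
have aZ := acfD T v Lv _ _ _ _ (acf_cst T v T0' de) (acfZ T v T0' Lv (-1) _ _ hN1).
have ca c : continuous (ac c j) := ac_cts c j.
have CS1 t : C t ^+ 2 + S t ^+ 2 = 1 := cos2Dsin2 _.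
have h0 : 0 <= (0 : R) <= T by rewrite lexx.
split.
- have C0 : C 0 = 1 by rewrite /C mulr0 cos0.
  have S0 : S 0 = 0 by rewrite /S mulr0 sin0.
  by case=> /=; rewrite ?E1 ?E2// C0 S0 N10 N20 /de; ring.
- have aX := acfD T v Lv _ _ _ _ (acfM T v T0' Lv _ _ _ _ aC aZ) (acfZ T v T0' Lv (-1) _ _ (acfM T v T0' Lv _ _ _ _ aS hN2)).
  have {}aX := acf_congr _ _ _ aX (ca true) E1.
  apply: (acf_ext T v _ _ _ aX).
    apply: domD; first by exact: (dom_cts _ _ T0' _ (ctsM (@cts_cst R lj) (ca false))).
    rewrite (_ : (fun t => _) = fun t => - q t * v t); last by apply/funext => t; rewrite mulNr.
    exact: (domMc _ _ T0' _ _ dv (ctsN cq)).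
  move=> t t01; rewrite E2// -/(q t).
  have := CS1 t; move: (C t) (S t) (p t) (q t) (v t) (N1 t) (N2 t) => x y P Q V n1 n2 CS.
  have -> : Q * V = (x ^+ 2 + y ^+ 2) * (Q * V) by rewrite CS mul1r.
  by move: (lj) => l; ring.
- have aX := acfD T v Lv _ _ _ _ (acfZ T v T0' Lv (-1) _ _ (acfM T v T0' Lv _ _ _ _ aS aZ))
    (acfZ T v T0' Lv (-1) _ _ (acfM T v T0' Lv _ _ _ _ aC hN2)).
  have {}aX := acf_congr _ _ _ aX (ca false) E2.
  apply: (acf_ext T v _ _ _ aX).
    apply: domD; first exact: (dom_cts _ _ T0' _ (ctsM (@cts_cst R (- lj)) (ca true))).
    exact: (domMc _ _ T0' _ _ dv cp).
  move=> t t01; rewrite E1// -/(p t).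
  have := CS1 t; move: (C t) (S t) (p t) (q t) (v t) (N1 t) (N2 t) => x y P Q V n1 n2 CS.
  have -> : P * V = (x ^+ 2 + y ^+ 2) * (P * V) by rewrite CS mul1r.
  by move: (lj) => l; ring.
Qed.

Lemma mild_fourier : exists (a b : nat -> R -> R) (B : R),
  [/\ forall j, continuous (a j) /\ continuous (b j),
     forall t, decay (a^~ t) B /\ decay (b^~ t) B,
     forall t, a 0%N t = 0 /\ b 0%N t = 0,
     forall j, a j 0 = (j == 1%N)%:R /\ b j 0 = 0 &
   [/\ forall j, acf T v (a j) (fun t => lambda j * b j t - I01 (fun x => e_ j x * (M x * ssum (b^~ t) x)) * v t),
     forall j, acf T v (b j) (fun t => - lambda j * a j t + I01 (fun x => e_ j x * (M x * ssum (a^~ t) x)) * v t),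
     ae01 (fun x => complex.Re (psi T x) = ssum (a^~ T) x) &
     ae01 (fun x => complex.Im (psi T x) = ssum (b^~ T) x)]].
Proof.
have [B B0 hB] := ac_decay.
have TT : 0 <= T <= T by rewrite lexx ltW.
have z c : acf T v (ac c 0%N) (fun=> 0).
  by rewrite (_ : ac c 0 = fun=> 0); [exact: acf_cst T v (ltW T0) 0|apply/funext => t; exact: ac0].
have m0 c t : mP c 0 t = 0 by apply: Rint0 => x _; rewrite e0_ mul0r.
exists (ac true), (ac false), B; split.
- by move=> j; split; exact: ac_cts.
- by move=> t; split; exact: hB.
- by move=> t; rewrite !ac0.
- move=> [|j]; first by rewrite !ac0.
  by have [h _ _] := ac_sys j.+1 isT; rewrite !h.
split.
- move=> [|j]; last by have [] := ac_sys j.+1 isT.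
  rewrite (_ : (fun t => _) = fun=> 0)//; apply/funext => t.
  by rewrite ac0 -/(mP false 0 t) m0 mulr0 mul0r subr0.
- move=> [|j]; last by have [] := ac_sys j.+1 isT.
  rewrite (_ : (fun t => _) = fun=> 0)//; apply/funext => t.
  by rewrite ac0 -/(mP true 0 t) m0 mulr0 mul0r addr0.
- exact: psi_repr TT true.
- exact: psi_repr TT false.
Qed.

End MildSolution.

Local Open Scope complex_scope.

(** * The theorem *)
Section Data.
Context {R : realType}.
Local Notation U := (`]0, 1[%classic : set R).

Lemma inner_real (f : R -> R) (g : R -> R) j k : measurable_fun U f ->
  continuous g -> ae01 (fun x => f x = g x) ->
  inner (fun x => (f x)%:C * phi j x) (phi k) = (I01 (fun x => g x * e_ j x * e_ k x))%:C.
Proof.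
move=> mf cg fg; rewrite inner_cf; congr (_ +i* _); last first.
  by apply: Rint0 => x _ /=; rewrite mulr0 mul0r addr0 mul0r.
have cj := @e_cts R j; have ck := @e_cts R k.
have E : (fun x => pr true ((f x)%:C * phi j x) * e_ k x) = (fun x => f x * (e_ j x * e_ k x)).
  by apply/funext => x; rewrite /= mulr0 subr0 mulrA.
rewrite /cf E; apply: Rint_ae => //.
- by apply: measurable_funM => //; apply: meas_cts => //; cts.
- by apply: meas_cts => //; cts.
- by apply: aeS fg => x h; rewrite /= in_itv/= => /h ->; rewrite mulrA.
Qed.

Lemma sg_real (x : R) : Num.sg (x%:C) = (Num.sg x)%:C.
Proof.
rewrite /Num.sg -[0]/(0%:C) -[1]/(1%:C) (inj_eq (@complexI _)) ltcR; do 2 case: ifP => // _.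
by rewrite rmorphN.
Qed.

Lemma target_pr (al : R) K (T de x : R) :
  complex.Re (target al%:C K T de x) = Num.sqrt (1 - de ^+ 2) * e_ 1 x * cos (lambda 1 * T)
     + al * de * e_ K x * sin (lambda 1 * T) /\
  complex.Im (target al%:C K T de x) = - (Num.sqrt (1 - de ^+ 2) * e_ 1 x * sin (lambda 1 * T))
     + al * de * e_ K x * cos (lambda 1 * T).
Proof.
rewrite /target /cexpi cosN sinN /phi -/(e_ 1 x) -/(e_ K x) /=.
move: (cos _) (sin _) (Num.sqrt _) (e_ 1 x) (e_ K x) => c s r p q.
by split; ring.
Qed.

End Data.

Theorem theorem3 (R : realType) (K : nat) (mu dmu : R -> R)
  (hK : (0 < K)%N)
  (hmu : sobolev 0 1 3 mu)
  (hdmu : weak_derivative 0 1 mu dmu)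
  (h0 : inner (fun x => (mu x)%:C * phi 1 x) (phi K) = 0)
  (hA : A_coef dmu K <> 0) :
  exists2 Tstar : R, 0 < Tstar &
    forall T : R, 0 < T < Tstar ->
    exists2 eps : R, 0 < eps &
      forall u : R -> R,
        inL2 0 T (fun t => (u t)%:C) ->
        (L2norm 0 T (fun t => (u t)%:C) < eps%:E)%E ->
        forall psi : R -> R -> R[i], mild_solution T mu u (phi 1) psi ->
        forall delta : R, 0 < delta <= 1 ->
          ~ eq_ae01 (psi T)
              (target (Num.sg (A_coef dmu K)) K T delta).

Proof.
have [M [M1 [M2 [dM dM1 cM2 Lm [muM [g [Wg mg gM1]]]]]]] := sobolev3_C2 _ hmu.
have cM1 := hder_cts dM1; have cM := hder_cts dM.
(* [dmu] is an arbitrary weak derivative of [mu]; uniqueness identifies it with the continuous [M1],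
   so that [A_coef] becomes a classical integral. *)
have dmuM1 := weak_deriv_ae _ _ _ _ hdmu Wg gM1.
have mdmu : measurable_fun (`]0, 1[%classic : set R) dmu by have [_ [] ] := hdmu.
have E0 : I01 (fun x => M x * e_ 1 x * e_ K x) = 0.
  by move: h0; rewrite (inner_real _ _ _ _ Lm.1 cM muM) => /complexI.
pose A := I01 (fun x => M1 x ^+ 2 * e_ K x * e_ 1 x).
have EA : A_coef dmu K = A%:C.
  rewrite /A_coef (inner_real _ (fun x => M1 x ^+ 2)).
  - by congr (_%:C); apply: I01_ext => x _; rewrite mulrAC.
  - exact: meas_sq.
  - by cts.
  - by apply: aeS dmuM1 => x h /h ->.
have A0 : A != 0 by apply/eqP => A0; apply: hA; rewrite EA A0.
have [Tstar Tstar0 [ep ep0 H]] := no_control _ _ _ _ dM dM1 cM2 hK E0 A0.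
exists Tstar => // T TT; exists ep => // u hu hu' psi hpsi de de01 htar.
have T0 : 0 < T by case/andP: TT.
have Lu := L2_of_inL2_real _ _ _ hu; have [mu1 mu2 _] := hu.
have [_ _ u2 _] := L2norm_lt _ _ _ _ ep0 mu1 mu2 hu'.
have [a [b [B [c1 c2 c3 c4 [s1 s2 r1 r2]]]]] := mild_fourier _ _ _ _ _ T0 cM muM Lu hpsi.
have [_ Lv] := L2_patch _ _ _ Lu.
(* The primitive is taken of the extension of [u] by zero, which is square integrable on the closed
   interval with the same norm. *)
have [s s0 hs] := acf_exists _ _ (ltW T0) Lv _ (dom_u _ _ Lv).
have v2 : \int[lebesgue_measure]_(t in `[0, T]) ((u \_ `]0, T[) t ^+ 2) <= ep ^+ 2.
  rewrite -Rint_cc_oo; last by case: Lv.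
  apply: le_trans u2; rewrite le_eqVlt; apply/orP; left; apply/eqP; apply: Rint_eq => t tT.
  by rewrite patchE ifT// inE.
rewrite EA sg_real in htar.
have hT c : ae01 (fun x => pr c (psi T x) = pr c (target (Num.sg A)%:C K T de x)).
  by apply: aeS htar => x h x01; rewrite h// in_itv.
have ce1 := @e_cts R 1; have ceK := @e_cts R K.
have [d1 d2] := c2 T.
apply: (H T TT _ s a b B (Num.sg A) de Lv v2 hs s0) => //.
- by move=> j; have [] := c1 j.
- by move=> j; have [] := c1 j.
- by move=> t; have [] := c2 t.
- by move=> t; have [] := c2 t.
- by move=> t; have [] := c3 t.
- by move=> t; have [] := c3 t.
- by move=> j; have [] := c4 j.
- by move=> j; have [] := c4 j.
- by rewrite normr_sg A0.
- by rewrite [RHS]normrEsg.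
(* Both sides are continuous, so equality almost everywhere becomes equality at every point of (0,
   1). *)
- apply: ae01_cts; [exact: ssum_cts d1|by cts|].
  apply: aeS2 r1 (hT true) => x h1 h2 x01; rewrite -h1// -(target_pr _ _ _ _ _).1; exact: h2.
- apply: ae01_cts; [exact: ssum_cts d2|by cts|].
  apply: aeS2 r2 (hT false) => x h1 h2 x01; rewrite -h1// -(target_pr _ _ _ _ _).2; exact: h2.
Qed.
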